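(* Let $\Pi$ be the mixed initial-boundary value problem of the linear theory of thermopiezoelectricity of homogeneous nonsimple (second-gradient) materials described in the context, with unknown $\mathcal U=(u_i,\theta,\varphi)$. As part of the theory, the quadratic form $$\mathcal P(\xi,\eta_i)=\frac1\beta\left(\gamma\xi^2+2a_i^{(56)}\xi\eta_i+a_{ij}^{(66)}\eta_i\eta_j\right)$$ satisfies $\mathcal P(\xi,\eta_i)\ge 0$ for all real $\xi$ and all $(\eta_1,\eta_2,\eta_3)\in\mathbb R^3$. Assume that i) $\rho>0$, $\beta>0$, $T_0>0$; ii) the constitutive coefficients satisfy the symmetry relations listed in the context; iii) the quadratic form $$W=\frac12a_{ijkl}^{(11)}e_{ij}e_{kl}+\frac12a_{ijklhm}^{(22)}\kappa_{ijk}\kappa_{lhm}+a_{ijklh}^{(12)}e_{ij}\kappa_{klh}$$ in the variables $e_{ij}=e_{ji}$, $\kappa_{ijk}=\kappa_{jik}$ is positive semi-definite; iv) the quadratic form $$G=-\frac12a_{ij}^{(33)}E_iE_j-\frac12a_{ijkl}^{(77)}V_{ij}V_{kl}-a_{ijk}^{(37)}E_iV_{jk}-a_i^{(34)}E_i\Theta-a_{ij}^{(47)}V_{ij}\Theta-\frac12\left(a^{(44)}+\frac{\gamma}{\beta^2}\right)\Theta^2$$ in the variables $E_i$, $V_{ij}=V_{ji}$ and the scalar $\Theta$ (which stands for $\theta+\beta\dot\theta$) is positive definite. Then, if $S_4$ is nonempty, the problem $\Pi$ has at most one solution.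
   Context: Conventions: Latin indices range over $\{1,2,3\}$, repeated indices are summed, $f_{,i}=\partial f/\partial x_i$, a superposed dot is $\partial/\partial t$. $B\subset\mathbb R^3$ is a region (bounded, connected) with smooth boundary $\partial B$ and outward unit normal $n_i$; $I=[0,t_0)$ with $t_0\le+\infty$. All functions are understood to be as smooth as needed for every expression to make sense. The body is homogeneous: $\rho,T_0,\beta$ and all constitutive coefficients are real constants. Unknowns: displacement $u_i$, temperature difference $\theta$, electric potential $\varphi$, functions on $\bar B\times I$. Geometrical equations: $e_{ij}=\frac12(u_{i,j}+u_{j,i})$, $\kappa_{ijk}=u_{k,ij}$, $E_i=-\varphi_{,i}$, $V_{ij}=E_{i,j}$. Constitutive equations: $$\tau_{ij}=a^{(11)}_{ijkl}e_{kl}+a^{(12)}_{ijklh}\kappa_{klh}+a^{(13)}_{ijk}E_k+a^{(14)}_{ij}(\theta+\beta\dot\theta)+a^{(17)}_{ijkl}V_{kl},$$ $$\mu_{ijk}=a^{(12)}_{lhijk}e_{lh}+a^{(22)}_{ijklhm}\kappa_{lhm}+a^{(23)}_{ijkl}E_l+a^{(24)}_{ijk}(\theta+\beta\dot\theta)+a^{(27)}_{ijklh}V_{lh},$$ $$-\sigma_i=a^{(13)}_{jki}e_{jk}+a^{(23)}_{jkli}\kappa_{jkl}+a^{(33)}_{ij}E_j+a^{(34)}_i(\theta+\beta\dot\theta)+a^{(37)}_{ijk}V_{jk},$$ $$-\rho\eta=a^{(14)}_{ij}e_{ij}+a^{(24)}_{ijk}\kappa_{ijk}+a^{(34)}_iE_i+a^{(44)}(\theta+\beta\dot\theta)+a^{(47)}_{ij}V_{ij}+\frac1\beta\left(\gamma\dot\theta+a^{(56)}_i\theta_{,i}\right)+\alpha^{(4)},$$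 $$-Q_{ij}=a^{(17)}_{klij}e_{kl}+a^{(27)}_{klmij}\kappa_{klm}+a^{(37)}_{kij}E_k+a^{(47)}_{ij}(\theta+\beta\dot\theta)+a^{(77)}_{ijkl}V_{kl},$$ $$-\frac{q_i}{T_0}=\frac1\beta\left(a^{(56)}_i\dot\theta+a^{(66)}_{ij}\theta_{,j}\right),$$ where $\gamma=a^{(55)}-\beta^2a^{(44)}-\alpha^{(4)}b^{(55)}$ with $a^{(55)},b^{(55)}$ real constants. Symmetry relations: $a^{(11)}_{ijkl}=a^{(11)}_{jikl}=a^{(11)}_{klij}$; $a^{(22)}_{ijklhm}=a^{(22)}_{jiklhm}=a^{(22)}_{lhmijk}$; $a^{(33)}_{ij}=a^{(33)}_{ji}$; $a^{(66)}_{ij}=a^{(66)}_{ji}$; $a^{(77)}_{ijkl}=a^{(77)}_{jikl}=a^{(77)}_{klij}$; $a^{(12)}_{ijklh}=a^{(12)}_{jiklh}=a^{(12)}_{ijlkh}$; $a^{(13)}_{ijk}=a^{(13)}_{jik}$; $a^{(14)}_{ij}=a^{(14)}_{ji}$; $a^{(17)}_{ijkl}=a^{(17)}_{jikl}=a^{(17)}_{klij}$; $a^{(23)}_{ijkl}=a^{(23)}_{jikl}$; $a^{(24)}_{ijk}=a^{(24)}_{jik}$; $a^{(27)}_{ijkhl}=a^{(27)}_{jikhl}=a^{(27)}_{ijklh}$; $a^{(37)}_{ijk}=a^{(37)}_{ikj}$; $a^{(47)}_{ij}=a^{(47)}_{ji}$. Balance equations on $B\times I$: $$\tau_{ji,j}-\mu_{kji,kj}+\rho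 f_i=\rho\ddot u_i,\qquad \sigma_{i,i}-Q_{ji,ji}=g,\qquad \rho T_0\dot\eta+q_{i,i}-\rho r=0,$$ with prescribed body force $f_i$, free charge density $g$, heat supply $r$. Surface operators and quantities on $\partial B$: $\mathcal D=n_i\,\partial/\partial x_i$ (normal derivative), $\mathcal D_i=(\delta_{ij}-n_in_j)\,\partial/\partial x_j$ (surface gradient), and $$P_i=(\tau_{ji}-\mu_{kji,k})n_j-\mathcal D_j(\mu_{kji}n_k)+(\mathcal D_ln_l)\mu_{kji}n_kn_j,\qquad R_i=\mu_{kji}n_kn_j,$$ $$\Lambda=(\sigma_j-Q_{kj,k})n_j-\mathcal D_j(Q_{kj}n_k)+(\mathcal D_ln_l)Q_{kj}n_kn_j,\qquad H=Q_{kj}n_kn_j.$$ Problem $\Pi$: find $\mathcal U=(u_i,\theta,\varphi)$ satisfying the geometrical, constitutive and balance equations, the initial conditions in $\bar B$ $$u_i(0)=u_i^0,\quad \dot u_i(0)=v_i^0,\quad \theta(0)=\theta^0,\quad \eta(0)=\eta^0,$$ and the boundary conditions $$u_i=\hat u_i\text{ on }S_1\times I,\quad P_i=\hat P_i\text{ on }\Sigma_1\times I;\qquad \mathcal Du_i=\hat d_i\text{ on }S_2\times I,\quad R_i=\hat R_i\text{ on }\Sigma_2\times I;$$ $$\theta=\hat\theta\text{ on }S_3\times I,\quad q_in_i=\hat q\text{ on }\Sigma_3\times I;\qquad \varphi=\hat\varphi\text{ on }S_4\times I,\quad \Lambda=\hat\Lambda\text{ on }\Sigma_4\times I;$$ $$\mathcal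 D\varphi=\hat\xi\text{ on }S_5\times I,\quad H=\hat H\text{ on }\Sigma_5\times I,$$ where all the right-hand sides are prescribed functions and $S_i,\Sigma_i\subset\partial B$ satisfy $\bar S_i\cup\Sigma_i=\partial B$, $S_i\cap\Sigma_i=\varnothing$ for $i=1,\dots,5$ (closure relative to $\partial B$). *)

(* Defs.v *)
From HB Require Import structures.
From mathcomp Require Import all_boot all_order all_algebra.
From mathcomp Require Import all_classical all_reals all_analysis.
Export numFieldNormedType.Exports.
Export Order.TTheory GRing.Theory Num.Theory.

Set Implicit Arguments.
Unset Strict Implicit.
Unset Printing Implicit Defensive.

Local Open Scope classical_set_scope.
Local Open Scope ring_scope.

(* For k > 0: f is Frechet differentiable on O and all its directional
   derivatives are of class C^(k-1).  In finite dimension, on an open set O,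
   this is the usual notion. *)
Fixpoint class_C (R : realType) (V W : normedModType R) (k : nat) (O : set V)
    (f : V -> W) : Prop :=
  if k is k'.+1 then
    (forall x, O x -> differentiable f x) /\
    (forall v, class_C k' O ('D_v f))
  else forall x, O x -> {for x, continuous f}.

Definition class_Coo (R : realType) (V W : normedModType R) (O : set V)
    (f : V -> W) : Prop := forall k, class_C k O f.

Notation space R := 'rV[R]_3.

Definition basis (R : realType) (i : 'I_3) : space R := delta_mx 0 i.

Definition bd (R : realType) (B : set (space R)) : set (space R) :=
  closure B `\` B°.

(* Inside U, the region B is {psi < 0}; since the gradient of psi does not
   vanish, the boundary of B inside U is {psi = 0} and B lies on one side. *)
Definition local_defining_function (R : realType) (B U : set (space R))
    (psi : space R -> R) : Prop :=
  [/\ open U, class_Coo U psi,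
      forall x, U x -> exists i, 'D_(basis R i) psi x != 0 &
      forall x, U x -> (B x <-> psi x < 0)].

Definition smooth_region (R : realType) (B : set (space R)) : Prop :=
  [/\ open B, connected B, bounded_set B &
      forall x, bd B x ->
        exists U psi, U x /\ local_defining_function B U psi].

(* On bd B, n is the outward unit normal, grad psi / |grad psi| (Euclidean
   norm); n is moreover a smooth extension of it to a neighbourhood of bd B,
   so that the partial derivatives of n make sense.  Only tangential
   derivatives of n will occur, and these do not depend on the extension. *)
Definition outward_unit_normal (R : realType) (B : set (space R))
    (n : 'I_3 -> space R -> R) : Prop :=
  (exists O, [/\ open O, bd B `<=` O & forall i, class_Coo O (n i)]) /\
  (forall U psi x, local_defining_function B U psi -> bd B x -> U x ->
     forall i, n i x = 'D_(basis R i) psi x /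
                       Num.sqrt (\sum_(j < 3) 'D_(basis R j) psi x ^+ 2)).

Notation spacetime R := ('rV[R]_3 * R)%type.
Notation field R := ('rV[R]_3 * R -> R).

Definition interval_I (R : realType) (t0 : \bar R) : set R :=
  [set t | 0 <= t /\ (t%:E < t0)%E].

(* The map f, restricted to A `*` I, is of class C^k on A `*` I (possibly
   not open): f is of class C^k on an open neighbourhood of A `*` I. *)
Definition class_C_upto (R : realType) (k : nat) (A : set (space R))
    (I : set R) (f : field R) : Prop :=
  exists O : set (spacetime R), [/\ open O, A `*` I `<=` O & class_C k O f].

Definition dx (R : realType) (i : 'I_3) (f : field R) : field R :=
  'D_((basis R i, 0) : spacetime R) f.

Definition dt (R : realType) (f : field R) : field R :=
  'D_((0, 1) : spacetime R) f.

(* a11, a12, ... are the coefficients a^(11), a^(12), ...; alpha4 is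
   alpha^(4). *)
Record material (R : realType) := Material {
  rho : R; T0 : R; beta : R;
  a11 : 'I_3 -> 'I_3 -> 'I_3 -> 'I_3 -> R;
  a12 : 'I_3 -> 'I_3 -> 'I_3 -> 'I_3 -> 'I_3 -> R;
  a13 : 'I_3 -> 'I_3 -> 'I_3 -> R;
  a14 : 'I_3 -> 'I_3 -> R;
  a17 : 'I_3 -> 'I_3 -> 'I_3 -> 'I_3 -> R;
  a22 : 'I_3 -> 'I_3 -> 'I_3 -> 'I_3 -> 'I_3 -> 'I_3 -> R;
  a23 : 'I_3 -> 'I_3 -> 'I_3 -> 'I_3 -> R;
  a24 : 'I_3 -> 'I_3 -> 'I_3 -> R;
  a27 : 'I_3 -> 'I_3 -> 'I_3 -> 'I_3 -> 'I_3 -> R;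
  a33 : 'I_3 -> 'I_3 -> R;
  a34 : 'I_3 -> R;
  a37 : 'I_3 -> 'I_3 -> 'I_3 -> R;
  a44 : R;
  a47 : 'I_3 -> 'I_3 -> R;
  a55 : R;
  b55 : R;
  a56 : 'I_3 -> R;
  a66 : 'I_3 -> 'I_3 -> R;
  a77 : 'I_3 -> 'I_3 -> 'I_3 -> 'I_3 -> R;
  alpha4 : R }.

Definition gamma (R : realType) (m : material R) : R :=
  a55 m - beta m ^+ 2 * a44 m - alpha4 m * b55 m.

Record symmetry_relations (R : realType) (m : material R) : Prop := {
  sym11 : forall i j k l,
    a11 m i j k l = a11 m j i k l /\ a11 m i j k l = a11 m k l i j;
  sym22 : forall i j k l h p,
    a22 m i j k l h p = a22 m j i k l h p /\
    a22 m i j k l h p = a22 m l h p i j k;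
  sym33 : forall i j, a33 m i j = a33 m j i;
  sym66 : forall i j, a66 m i j = a66 m j i;
  sym77 : forall i j k l,
    a77 m i j k l = a77 m j i k l /\ a77 m i j k l = a77 m k l i j;
  sym12 : forall i j k l h,
    a12 m i j k l h = a12 m j i k l h /\ a12 m i j k l h = a12 m i j l k h;
  sym13 : forall i j k, a13 m i j k = a13 m j i k;
  sym14 : forall i j, a14 m i j = a14 m j i;
  sym17 : forall i j k l,
    a17 m i j k l = a17 m j i k l /\ a17 m i j k l = a17 m k l i j;
  sym23 : forall i j k l, a23 m i j k l = a23 m j i k l;
  sym24 : forall i j k, a24 m i j k = a24 m j i k;
  sym27 : forall i j k h l,
    a27 m i j k h l = a27 m j i k h l /\ a27 m i j k h l = a27 m i j k l h;
  sym37 : forall i j k, a37 m i j k = a37 m i k j;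
  sym47 : forall i j, a47 m i j = a47 m j i }.

Definition form_P (R : realType) (m : material R) (xi : R) (eta : 'I_3 -> R)
  : R :=
  (beta m)^-1 * (gamma m * xi ^+ 2
    + 2 * (\sum_(i < 3) a56 m i * xi * eta i)
    + \sum_(i < 3) \sum_(j < 3) a66 m i j * eta i * eta j).

Definition form_W (R : realType) (m : material R) (e : 'I_3 -> 'I_3 -> R)
    (kappa : 'I_3 -> 'I_3 -> 'I_3 -> R) : R :=
  2^-1 * (\sum_(i < 3) \sum_(j < 3) \sum_(k < 3) \sum_(l < 3)
            a11 m i j k l * e i j * e k l)
  + 2^-1 * (\sum_(i < 3) \sum_(j < 3) \sum_(k < 3)
            \sum_(l < 3) \sum_(h < 3) \sum_(p < 3)
            a22 m i j k l h p * kappa i j k * kappa l h p)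
  + \sum_(i < 3) \sum_(j < 3) \sum_(k < 3) \sum_(l < 3) \sum_(h < 3)
      a12 m i j k l h * e i j * kappa k l h.

Definition form_G (R : realType) (m : material R) (E : 'I_3 -> R)
    (V : 'I_3 -> 'I_3 -> R) (Theta : R) : R :=
  - 2^-1 * (\sum_(i < 3) \sum_(j < 3) a33 m i j * E i * E j)
  - 2^-1 * (\sum_(i < 3) \sum_(j < 3) \sum_(k < 3) \sum_(l < 3)
              a77 m i j k l * V i j * V k l)
  - \sum_(i < 3) \sum_(j < 3) \sum_(k < 3) a37 m i j k * E i * V j k
  - \sum_(i < 3) a34 m i * E i * Theta
  - \sum_(i < 3) \sum_(j < 3) a47 m i j * V i j * Theta
  - 2^-1 * (a44 m + gamma m / beta m ^+ 2) * Theta ^+ 2.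

Definition P_nonnegative (R : realType) (m : material R) : Prop :=
  forall xi eta, 0 <= form_P m xi eta.

Definition W_positive_semidefinite (R : realType) (m : material R) : Prop :=
  forall e kappa,
    (forall i j, e i j = e j i) ->
    (forall i j k, kappa i j k = kappa j i k) ->
    0 <= form_W m e kappa.

Definition G_positive_definite (R : realType) (m : material R) : Prop :=
  forall E V Theta,
    (forall i j, V i j = V j i) ->
    ~ [/\ forall i, E i = 0, forall i j, V i j = 0 & Theta = 0] ->
    0 < form_G m E V Theta.

Record state (R : realType) := State {
  disp : 'I_3 -> field R;
  temp : field R;
  pot : field R }.

Definition strain (R : realType) (s : state R) (i j : 'I_3) : field R :=
  fun p => 2^-1 * (dx j (disp s i) p + dx i (disp s j) p).

Definition kap (R : realType) (s : state R) (i j k : 'I_3) : field R :=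
  dx j (dx i (disp s k)).

Definition efield (R : realType) (s : state R) (i : 'I_3) : field R :=
  fun p => - dx i (pot s) p.

Definition egrad (R : realType) (s : state R) (i j : 'I_3) : field R :=
  dx j (efield s i).

Definition vartheta (R : realType) (m : material R) (s : state R) : field R :=
  fun p => temp s p + beta m * dt (temp s) p.

Definition tau (R : realType) (m : material R) (s : state R) (i j : 'I_3)
  : field R := fun p =>
  \sum_(k < 3) \sum_(l < 3) a11 m i j k l * strain s k l p
  + \sum_(k < 3) \sum_(l < 3) \sum_(h < 3) a12 m i j k l h * kap s k l h p
  + \sum_(k < 3) a13 m i j k * efield s k p
  + a14 m i j * vartheta m s p
  + \sum_(k < 3) \sum_(l < 3) a17 m i j k l * egrad s k l p.

Definition mu (R : realType) (m : material R) (s : state R) (i j k : 'I_3)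
  : field R := fun p =>
  \sum_(l < 3) \sum_(h < 3) a12 m l h i j k * strain s l h p
  + \sum_(l < 3) \sum_(h < 3) \sum_(q < 3) a22 m i j k l h q * kap s l h q p
  + \sum_(l < 3) a23 m i j k l * efield s l p
  + a24 m i j k * vartheta m s p
  + \sum_(l < 3) \sum_(h < 3) a27 m i j k l h * egrad s l h p.

Definition sigma (R : realType) (m : material R) (s : state R) (i : 'I_3)
  : field R := fun p =>
  - (\sum_(j < 3) \sum_(k < 3) a13 m j k i * strain s j k p
  + \sum_(j < 3) \sum_(k < 3) \sum_(l < 3) a23 m j k l i * kap s j k l p
  + \sum_(j < 3) a33 m i j * efield s j p
  + a34 m i * vartheta m s p
  + \sum_(j < 3) \sum_(k < 3) a37 m i j k * egrad s j k p).

Definition entropy (R : realType) (m : material R) (s : state R)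
  : field R := fun p =>
  - (rho m)^-1 *
  (\sum_(i < 3) \sum_(j < 3) a14 m i j * strain s i j p
  + \sum_(i < 3) \sum_(j < 3) \sum_(k < 3) a24 m i j k * kap s i j k p
  + \sum_(i < 3) a34 m i * efield s i p
  + a44 m * vartheta m s p
  + \sum_(i < 3) \sum_(j < 3) a47 m i j * egrad s i j p
  + (beta m)^-1 * (gamma m * dt (temp s) p
                   + \sum_(i < 3) a56 m i * dx i (temp s) p)
  + alpha4 m).

Definition quad (R : realType) (m : material R) (s : state R) (i j : 'I_3)
  : field R := fun p =>
  - (\sum_(k < 3) \sum_(l < 3) a17 m k l i j * strain s k l p
  + \sum_(k < 3) \sum_(l < 3) \sum_(h < 3) a27 m k l h i j * kap s k l h p
  + \sum_(k < 3) a37 m k i j * efield s k p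
  + a47 m i j * vartheta m s p
  + \sum_(k < 3) \sum_(l < 3) a77 m i j k l * egrad s k l p).

Definition heat_flux (R : realType) (m : material R) (s : state R) (i : 'I_3)
  : field R := fun p =>
  - T0 m * ((beta m)^-1 * (a56 m i * dt (temp s) p
                           + \sum_(j < 3) a66 m i j * dx j (temp s) p)).

Definition normal_deriv (R : realType) (n : 'I_3 -> space R -> R)
    (f : field R) : field R :=
  fun p => \sum_(i < 3) n i p.1 * dx i f p.

Definition surf_grad (R : realType) (n : 'I_3 -> space R -> R) (i : 'I_3)
    (f : field R) : field R :=
  fun p => \sum_(j < 3) ((i == j)%:R - n i p.1 * n j p.1) * dx j f p.

(* The D_l n_l of the theory, n being viewed as time-independent. *)
Definition surf_div_normal (R : realType) (n : 'I_3 -> space R -> R)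
  : field R :=
  fun p => \sum_(l < 3) surf_grad n l (fun q => n l q.1) p.

Definition surf_P (R : realType) (m : material R) (n : 'I_3 -> space R -> R)
    (s : state R) (i : 'I_3) : field R := fun p =>
  \sum_(j < 3) (tau m s j i p - \sum_(k < 3) dx k (mu m s k j i) p) * n j p.1
  - \sum_(j < 3) \sum_(k < 3)
      surf_grad n j (fun q => mu m s k j i q * n k q.1) p
  + surf_div_normal n p *
      \sum_(k < 3) \sum_(j < 3) mu m s k j i p * n k p.1 * n j p.1.

Definition surf_R (R : realType) (m : material R) (n : 'I_3 -> space R -> R)
    (s : state R) (i : 'I_3) : field R := fun p =>
  \sum_(k < 3) \sum_(j < 3) mu m s k j i p * n k p.1 * n j p.1.

Definition surf_Lambda (R : realType) (m : material R)
    (n : 'I_3 -> space R -> R) (s : state R) : field R := fun p =>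
  \sum_(j < 3) (sigma m s j p - \sum_(k < 3) dx k (quad m s k j) p) * n j p.1
  - \sum_(j < 3) \sum_(k < 3)
      surf_grad n j (fun q => quad m s k j q * n k q.1) p
  + surf_div_normal n p *
      \sum_(k < 3) \sum_(j < 3) quad m s k j p * n k p.1 * n j p.1.

Definition surf_H (R : realType) (m : material R) (n : 'I_3 -> space R -> R)
    (s : state R) : field R := fun p =>
  \sum_(k < 3) \sum_(j < 3) quad m s k j p * n k p.1 * n j p.1.

Record boundary_parts (R : realType) := BoundaryParts {
  S1 : set (space R); Sigma1 : set (space R);
  S2 : set (space R); Sigma2 : set (space R);
  S3 : set (space R); Sigma3 : set (space R);
  S4 : set (space R); Sigma4 : set (space R);
  S5 : set (space R); Sigma5 : set (space R) }.

Definition splits_boundary (R : realType) (B S Sigma : set (space R)) : Prop :=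
  [/\ S `<=` bd B, Sigma `<=` bd B,
      (closure S `&` bd B) `|` Sigma = bd B & S `&` Sigma = set0].

Definition boundary_splitting (R : realType) (B : set (space R))
    (b : boundary_parts R) : Prop :=
  [/\ splits_boundary B (S1 b) (Sigma1 b), splits_boundary B (S2 b) (Sigma2 b),
      splits_boundary B (S3 b) (Sigma3 b), splits_boundary B (S4 b) (Sigma4 b)
    & splits_boundary B (S5 b) (Sigma5 b)].

Record problem_data (R : realType) := ProblemData {
  body_force : 'I_3 -> field R;
  free_charge : field R;
  heat_supply : field R;
  u_init : 'I_3 -> space R -> R;
  v_init : 'I_3 -> space R -> R;
  theta_init : space R -> R;
  eta_init : space R -> R;
  u_hat : 'I_3 -> field R;
  P_hat : 'I_3 -> field R;
  d_hat : 'I_3 -> field R;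
  R_hat : 'I_3 -> field R;
  theta_hat : field R;
  q_hat : field R;
  phi_hat : field R;
  Lambda_hat : field R;
  xi_hat : field R;
  H_hat : field R }.

(* C^4 for u and phi, C^3 for theta: the least orders for which every
   derivative occurring in the problem is a continuous function. *)
Definition regular_state (R : realType) (B : set (space R)) (t0 : \bar R)
    (s : state R) : Prop :=
  [/\ forall i, class_C_upto 4 (closure B) (interval_I t0) (disp s i),
      class_C_upto 3 (closure B) (interval_I t0) (temp s)
    & class_C_upto 4 (closure B) (interval_I t0) (pot s)].

Definition balance_equations (R : realType) (B : set (space R)) (t0 : \bar R)
    (m : material R) (d : problem_data R) (s : state R) : Prop :=
  forall p, (B `*` interval_I t0) p ->
  [/\ forall i,
        \sum_(j < 3) dx j (tau m s j i) p
        - \sum_(k < 3) \sum_(j < 3) dx j (dx k (mu m s k j i)) p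
        + rho m * body_force d i p = rho m * dt (dt (disp s i)) p,
      \sum_(i < 3) dx i (sigma m s i) p
        - \sum_(j < 3) \sum_(i < 3) dx i (dx j (quad m s j i)) p
        = free_charge d p
    & rho m * T0 m * dt (entropy m s) p
        + \sum_(i < 3) dx i (heat_flux m s i) p
        - rho m * heat_supply d p = 0].

Definition initial_conditions (R : realType) (B : set (space R))
    (m : material R) (d : problem_data R) (s : state R) : Prop :=
  forall x, closure B x ->
  [/\ forall i, disp s i (x, 0) = u_init d i x,
      forall i, dt (disp s i) (x, 0) = v_init d i x,
      temp s (x, 0) = theta_init d x
    & entropy m s (x, 0) = eta_init d x].

Definition equal_on (R : realType) (A : set (space R)) (t0 : \bar R)
    (f g : field R) : Prop :=
  forall p, (A `*` interval_I t0) p -> f p = g p.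

Record boundary_conditions (R : realType) (t0 : \bar R)
    (n : 'I_3 -> space R -> R) (b : boundary_parts R) (m : material R)
    (d : problem_data R) (s : state R) : Prop := {
  bc_u : forall i, equal_on (S1 b) t0 (disp s i) (u_hat d i);
  bc_P : forall i, equal_on (Sigma1 b) t0 (surf_P m n s i) (P_hat d i);
  bc_Du : forall i,
    equal_on (S2 b) t0 (normal_deriv n (disp s i)) (d_hat d i);
  bc_R : forall i, equal_on (Sigma2 b) t0 (surf_R m n s i) (R_hat d i);
  bc_theta : equal_on (S3 b) t0 (temp s) (theta_hat d);
  bc_q : equal_on (Sigma3 b) t0
    (fun p => \sum_(i < 3) heat_flux m s i p * n i p.1) (q_hat d);
  bc_phi : equal_on (S4 b) t0 (pot s) (phi_hat d);
  bc_Lambda : equal_on (Sigma4 b) t0 (surf_Lambda m n s) (Lambda_hat d);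
  bc_Dphi : equal_on (S5 b) t0 (normal_deriv n (pot s)) (xi_hat d);
  bc_H : equal_on (Sigma5 b) t0 (surf_H m n s) (H_hat d) }.

Definition solution_of_Pi (R : realType) (B : set (space R))
    (n : 'I_3 -> space R -> R) (t0 : \bar R) (b : boundary_parts R)
    (m : material R) (d : problem_data R) (s : state R) : Prop :=
  [/\ regular_state B t0 s, balance_equations B t0 m d s,
      initial_conditions B m d s & boundary_conditions t0 n b m d s].

(* States are total functions, but only their values on closure B `*` I are
   part of a solution. *)
Definition same_state (R : realType) (B : set (space R)) (t0 : \bar R)
    (s s' : state R) : Prop :=
  [/\ forall i, equal_on (closure B) t0 (disp s i) (disp s' i),
      equal_on (closure B) t0 (temp s) (temp s')
    & equal_on (closure B) t0 (pot s) (pot s')].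

(* Main.v *)
Require Import Defs.
From mathcomp Require Import all_boot all_order all_algebra.
From mathcomp Require Import all_classical all_reals all_analysis.
From mathcomp Require Import ring lra zify.

(** The difference of two solutions solves the same problem with all the data
equal to zero, except that its entropy is initially - alpha4 / rho, because
the entropy is an affine function of the state. Collect the strains in one
vector X = (e, kappa, E, V, Theta), with Theta = theta + beta theta', so that
the constitutive law reads: conjugate of X = A X with a symmetric matrix A
(lemma [stiffness_sym]). The stored energy is
  S = X . A X / 2 - Theta (A X)_Theta + rho |u'|^2 / 2 + (terms in theta).
By the balance equations (lemma [energy_rate]), S' + P(theta', grad theta) is
the power of the stresses on u' and on phi' plus a divergence, and these
integrate to zero over B because of the boundary conditions; as P is
nonnegative, the integral of S does not increase. The electric work
sigma . E + Q . V has integral zero at every time by the equation of charge,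
and S plus this work is, thanks to the signs in the Legendre transform with
respect to E, V and Theta (lemmas [legendre_free_energy], [energy_split]),
  rho |u'|^2 / 2 + W + G + (beta / 2) P (- theta / beta, grad theta),
a sum of nonnegative terms. At time zero the initial conditions on theta and
on the entropy give S = - (sigma . E + Q . V) / 2 (lemma [stored_initial]),
whose integral is zero as well. Hence the sum of nonnegative terms has
integral zero at every time and vanishes: u' = 0, and by positivity of G also
grad phi = 0 and Theta = 0 (theorem [energy_vanishes]). So u stays 0, theta
solves theta + beta theta' = 0 and stays 0, and phi is constant in space; it
is zero at the points of S4, hence zero.

No integral is constructed. The only integrals in the argument are integrals
over B of functions continuous up to the boundary, and only three of their
properties matter: a divergence with zero normal component integrates to
zero, a nonnegative continuous function of integral zero vanishes, and the
integral is differentiated in time under the sign. All three hold for the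
mean of a function over the points of a cubic grid of a box containing B, in
the limit of a vanishing mesh: [null_mean] says that this limit is zero.
The mean of a partial derivative of a function vanishing on the boundary
telescopes along the grid lines ([null_mean_derive]); a tangential field is
reduced to this case by a cutoff that vanishes in a layer of width eps along
the boundary: the gradient of the cutoff is of order 1 / eps, but it is normal
to the boundary, and the number of grid points in the layer is of order eps
([local_null_divergence]). A partition of unity concludes
([null_mean_divergence]).

The second-gradient boundary operators require one more integration by parts,
along the surface: the integral over the boundary of the surface divergence
of a field Y, minus the mean curvature term, is zero. This follows from the
divergence theorem alone, since that quantity is the normal component of the
divergence-free field C_j = d_k (r (n_j Y_k - n_k Y_j)), where r equals
1 / |n| up to the first order on the boundary ([normal_curl],
[null_mean_green]). *)

Set Implicit Arguments.
Unset Strict Implicit.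
Unset Printing Implicit Defensive.

Local Open Scope classical_set_scope.
Local Open Scope ring_scope.

(** * Functions of class C^k *)

Section ClassC.
Context {R : realType} {V : normedModType R}.
Implicit Types (O U : set V) (f g : V -> R) (k : nat) (x v w : V).

(** The expansion of f at x is one of g, since differentiability only involves
a neighbourhood. *)
Lemma differentiable_near f g x : (\forall y \near x, f y = g y) ->
  differentiable f x -> differentiable g x.
Proof.
move=> fg /diff_locallyP[cdf df]; have fgx : f x = g x by exact: (nbhs_singleton fg).
have E : g \o shift x = cst (g x) + 'd f x +o_ 0 id.
  apply/eqaddoP => _/posnumP[e].
  move/eqaddoP: df => /(_ e%:num) /= /(_ [gt0 of e%:num]) df.
  have fg0 : \forall y \near 0, f (y + x) = g (y + x) :> R.
    by move: fg; rewrite (near_shift 0) /= subr0.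
  by near=> y; rewrite !fctE /= -fgx -(near fg0 y)//; near: y.
have dE := diff_unique cdf E.
apply/diff_locallyP; split; rewrite dE //.
Unshelve. all: by end_near. Qed.

Lemma open_near O x (P : V -> Prop) : open O -> O x -> (forall y, O y -> P y) ->
  \forall y \near x, P y.
Proof. by move=> oO Ox OP; move: (open_nbhs_nbhs (conj oO Ox)); exact: filterS. Qed.

Lemma class_C_sub k O U f : U `<=` O -> class_C k O f -> class_C k U f.
Proof.
elim: k f => [|k IH] f UO /=; first by move=> cf x /UO/cf.
by move=> [df cf]; split=> [x /UO/df//|v]; exact: IH.
Qed.

Lemma class_C_ext k O f g : open O -> (forall x, O x -> f x = g x) ->
  class_C k O f -> class_C k O g.
Proof.
move=> oO; elim: k f g => [|k IH] f g fg /=.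
  move=> cf x Ox; have fgx : \forall y \near x, f y = g y by exact: (open_near oO).
  have := cf x Ox; rewrite /prop_for /continuous_at (fg _ Ox) => cfx.
  by apply: cvg_trans cfx; exact: near_eq_cvg.
move=> [df cf]; split=> [x Ox|v].
  apply: differentiable_near (df _ Ox); exact: (open_near oO).
apply: IH (cf v) => x Ox; apply: near_eq_derive; exact: (open_near oO).
Qed.

(** Used for fields that are glued from two expressions, one near the boundary
and one, usually zero, elsewhere. *)
Lemma class_C_local k O f :
  (forall x, O x -> exists U, [/\ open U, U x & class_C k U f]) ->
  class_C k O f.
Proof.
elim: k f => [|k IH] f H /=.
  by move=> x /H[U [_ Ux cU]]; exact: cU.
split=> [x /H[U [_ Ux [dU _]]]|v]; first exact: dU.
by apply: IH => x /H[U [oU Ux [_ cU]]]; exists U; split=> //; exact: cU.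
Qed.

Lemma class_C_lt k O f : class_C k.+1 O f -> class_C k O f.
Proof.
elim: k f => [|k IH] f [df cf] /=.
  by move=> x /df; exact: differentiable_continuous.
by split=> // v; exact: IH.
Qed.

Lemma class_C_le k l O f : (k <= l)%N -> class_C l O f -> class_C k O f.
Proof.
move/subnK<-; elim: (l - k)%N => [//|p IH]; rewrite addSn => /class_C_lt.
exact: IH.
Qed.

Lemma class_C_cst k O (c : R) : class_C k O (fun=> c).
Proof.
elim: k c => [|k IH] c /=; first by move=> x _; exact: cst_continuous.
split=> [x _|v]; first exact: differentiable_cst.
rewrite (_ : 'D_v _ = fun=> 0); first exact: IH.
by apply/funext => x; exact: derive_cst.
Qed.

Lemma class_C_add k O f g : open O -> class_C k O f -> class_C k O g ->
  class_C k O (fun x => f x + g x).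
Proof.
move=> oO; elim: k f g => [|k IH] f g /=.
  by move=> cf cg x Ox; apply: continuousD; [exact: cf|exact: cg].
move=> [df cf] [dg cg]; split=> [x Ox|v].
  by apply: differentiableD; [exact: df|exact: dg].
apply: class_C_ext (IH _ _ (cf v) (cg v)) => // x Ox.
by rewrite deriveD//; apply: diff_derivable; [exact: df|exact: dg].
Qed.

Lemma class_C_mul k O f g : open O -> class_C k O f -> class_C k O g ->
  class_C k O (fun x => f x * g x).
Proof.
move=> oO; elim: k f g => [|k IH] f g.
  by move=> cf cg x Ox; apply: continuousM; [exact: cf|exact: cg].
move=> Cf Cg; have [[df cf] [dg cg]] := (Cf, Cg); split=> [x Ox|v].
  by apply: differentiableM; [exact: df|exact: dg].
have C := class_C_add oO (IH _ _ (class_C_lt Cf) (cg v))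
                          (IH _ _ (class_C_lt Cg) (cf v)).
apply: class_C_ext C => // x Ox.
by rewrite deriveM//; apply: diff_derivable; [exact: df|exact: dg].
Qed.

Lemma class_C_scale k O (c : R) f : open O -> class_C k O f ->
  class_C k O (fun x => c * f x).
Proof. by move=> oO; apply: class_C_mul => //; exact: class_C_cst. Qed.

Lemma class_C_opp k O f : open O -> class_C k O f -> class_C k O (fun x => - f x).
Proof.
move=> oO /(class_C_scale (-1) oO); apply: class_C_ext => // x _.
by rewrite mulN1r.
Qed.

Lemma class_C_sub_fun k O f g : open O -> class_C k O f -> class_C k O g ->
  class_C k O (fun x => f x - g x).
Proof. by move=> oO cf cg; apply: class_C_add => //; exact: class_C_opp. Qed.

Lemma class_C_sum k O (I : Type) (r : seq I) (P : pred I) (F : I -> V -> R) :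
  open O -> (forall i, P i -> class_C k O (F i)) ->
  class_C k O (fun x => \sum_(i <- r | P i) F i x).
Proof.
move=> oO CF; elim: r => [|i r IH].
  rewrite (_ : (fun _ => _) = fun=> 0); first exact: class_C_cst.
  by apply/funext => x; rewrite big_nil.
have E x : \sum_(j <- i :: r | P j) F j x =
    if P i then F i x + \sum_(j <- r | P j) F j x else \sum_(j <- r | P j) F j x.
  by rewrite big_cons.
rewrite (funext E); case: (boolP (P i)) => // Pi.
by apply: class_C_add => //; exact: CF.
Qed.

Lemma derive_comp_fun (h : R -> R) f x v : differentiable f x ->
  differentiable h (f x) -> 'D_v (fun y => h (f y)) x = 'D_v f x * 'D_1 h (f x).
Proof.
move=> dfx dhx; rewrite deriveE; last exact: differentiable_comp.
rewrite diff_comp//= [in RHS]deriveE// [in RHS]deriveE//.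
have L (r : R) : 'd h (f x) r = r * 'd h (f x) 1.
  by rewrite -{1}[r]mulr1 -[r * 1]/(r *: (1 : R)) linearZ.
exact: L.
Qed.

Lemma class_C_comp k O (h : R -> R) f : open O -> class_C k setT h ->
  class_C k O f -> class_C k O (fun x => h (f x)).
Proof.
move=> oO; elim: k h f => [|k IH] h f.
  by move=> ch cf x Ox; apply: continuous_comp; [exact: cf|exact: ch].
move=> [dh ch] Cf; have [df cf] := Cf; split=> [x Ox|v].
  by apply: differentiable_comp; [exact: df|exact: dh].
have C := class_C_mul oO (cf v) (IH _ _ (ch 1) (class_C_lt Cf)).
apply: class_C_ext C => // x Ox.
by rewrite derive_comp_fun//; [exact: df|exact: dh].
Qed.

End ClassC.

Lemma derive_mul (R : realType) (V : normedModType R) (f g : V -> R) x v :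
  differentiable f x -> differentiable g x ->
  'D_v (fun y => f y * g y) x = f x * 'D_v g x + g x * 'D_v f x.
Proof. by move=> df dg; rewrite deriveM//; exact: diff_derivable. Qed.

Lemma derive_affine (R : realType) (V : normedModType R) (f : V -> R) (a b : R) x v :
  differentiable f x -> 'D_v (fun y => a * f y + b) x = a * 'D_v f x.
Proof.
move=> /(@diff_derivable _ _ _ _ _ v) df.
have D := is_deriveD (is_deriveZ a (derivableP df)) (is_derive_cst b x v).
by rewrite [LHS](@derive_val _ _ _ _ _ _ _ D) addr0.
Qed.

Section DeriveRules.
Context {R : realType} {V : normedModType R}.
Implicit Types (f g : V -> R) (x v : V).

Lemma derive_add f g x v : differentiable f x -> differentiable g x ->
  'D_v (fun y => f y + g y) x = 'D_v f x + 'D_v g x.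
Proof. by move=> df dg; rewrite -deriveD//; exact: diff_derivable. Qed.

Lemma derive_sub f g x v : differentiable f x -> differentiable g x ->
  'D_v (fun y => f y - g y) x = 'D_v f x - 'D_v g x.
Proof. by move=> df dg; rewrite -deriveB//; exact: diff_derivable. Qed.

Lemma derive_scale (c : R) f x v : differentiable f x ->
  'D_v (fun y => c * f y) x = c * 'D_v f x.
Proof.
by move=> df; rewrite derive_mul// derive_cst mulr0 addr0.
Qed.

Lemma derive_sumf (I : Type) (r : seq I) (F : I -> V -> R) x v :
  (forall i, differentiable (F i) x) ->
  differentiable (fun y => \sum_(i <- r) F i y) x /\
  'D_v (fun y => \sum_(i <- r) F i y) x = \sum_(i <- r) 'D_v (F i) x.
Proof.
move=> dF; elim: r => [|i r [dr Dr]].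
  rewrite (_ : (fun y => _) = fun=> 0); last by apply/funext => y; rewrite big_nil.
  by split; [exact: differentiable_cst|rewrite derive_cst big_nil].
rewrite (_ : (fun y => _) = fun y => F i y + \sum_(j <- r) F j y); last first.
  by apply/funext => y; rewrite big_cons.
by split; [exact: differentiableD|rewrite derive_add// Dr big_cons].
Qed.

End DeriveRules.

(** * Lines and the symmetry of second derivatives *)

Lemma subr_swap (R : realType) (a b c d : R) : a - b - (c - d) = a - c - (b - d).
Proof. by ring. Qed.

Lemma mulf_cancel (R : realType) (a b c : R) : 0 < a -> a * b = a * c -> b = c.
Proof. by move=> a0; apply: mulfI; rewrite gt_eqF. Qed.

Lemma dist_le_half (R : realType) (a b c e : R) :
  `|a - c| < e / 2 -> `|b - c| < e / 2 -> `|a - b| <= e.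
Proof.
by have := ler_distD c a b; rewrite [`|c - b|]distrC; lra.
Qed.

Section Lines.
Context {R : realType} {V : normedModType R}.
Implicit Types (O U : set V) (f g : V -> R) (k : nat) (x v w : V).

Lemma is_derive_line f x v (s : R) : differentiable f (x + s *: v) ->
  is_derive s 1 (fun r => f (x + r *: v)) ('D_v f (x + s *: v)).
Proof.
move=> df.
have E : (fun h : R => h^-1 *: (((fun r => f (x + r *: v)) \o shift s) (h *: (1 : R))
                 - f (x + s *: v))) =
         (fun h : R => h^-1 *: ((f \o shift (x + s *: v)) (h *: v) - f (x + s *: v))).
  apply/funext => h /=; congr (_ *: (f _ - _)).
  by rewrite -[h *: (1 : R)]/(h * 1) mulr1 scalerDl addrCA.
have dfv : derivable f (x + s *: v) v by exact: diff_derivable.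
by apply: DeriveDef; rewrite /derivable /derive E.
Qed.

Lemma MVT_line f x v (h : R) : 0 < h ->
  (forall s, 0 <= s <= h -> differentiable f (x + s *: v)) ->
  exists s, 0 <= s <= h /\ f (x + h *: v) - f x = h * 'D_v f (x + s *: v).
Proof.
move=> h0 df.
have [||s] := @MVT R (fun r => f (x + r *: v)) (fun r => 'D_v f (x + r *: v)) 0 h h0.
- move=> s /[!in_itv]/= /andP[s0 sh]; apply: is_derive_line; apply: df.
  by rewrite !ltW.
- apply: derivable_within_continuous => s /[!in_itv]/= sh.
  by have /is_derive_line[] := df _ sh.
rewrite in_itv/= => /andP[s0 sh]; rewrite scale0r addr0 subr0 mulrC => E.
by exists s; rewrite !ltW.
Qed.

(** Two applications of the mean value theorem, first in the direction v to the
increment of f along w, then in the direction w. *)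
Lemma second_difference O f x v w (h : R) : 0 < h -> class_C 2 O f ->
  (forall c c', 0 <= c <= h -> 0 <= c' <= h -> O (x + c *: v + c' *: w)) ->
  exists c c', [/\ 0 <= c <= h, 0 <= c' <= h &
    f (x + h *: v + h *: w) - f (x + h *: v) - (f (x + h *: w) - f x)
    = h * h * 'D_w ('D_v f) (x + c *: v + c' *: w)].
Proof.
move=> h0 [df /(_ v)[dvf _]] xO.
have z0 : (0 : R) <= 0 <= h by apply/andP; split=> //; exact: ltW.
have dA s : 0 <= s <= h -> is_derive s 1 (fun r => f (x + h *: w + r *: v) - f (x + r *: v))
   ('D_v f (x + h *: w + s *: v) - 'D_v f (x + s *: v)).
  move=> sh.
  have D1 : is_derive s 1 (fun r => f (x + h *: w + r *: v)) ('D_v f (x + h *: w + s *: v)).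
    apply: is_derive_line; apply: df; rewrite addrAC; apply: xO => //.
    by rewrite lexx ltW.
  have D2 : is_derive s 1 (fun r => f (x + r *: v)) ('D_v f (x + s *: v)).
    by apply: is_derive_line; apply: df; have := xO _ _ sh z0; rewrite scale0r addr0.
  exact: (is_deriveB D1 D2).
have [||c] := @MVT R (fun r => f (x + h *: w + r *: v) - f (x + r *: v))
   (fun s => 'D_v f (x + h *: w + s *: v) - 'D_v f (x + s *: v)) 0 h h0.
- by move=> s /[!in_itv]/= /andP[s0 sh]; apply: dA; rewrite !ltW.
- apply: derivable_within_continuous => s /[!in_itv]/= sh.
  by have [] := dA _ sh.
rewrite in_itv/= => /andP[/ltW c0 /ltW ch].
have ch0 : 0 <= c <= h by rewrite c0.
rewrite !scale0r !addr0 subr0.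
have [s sh|c' [c'h]] := @MVT_line ('D_v f) (x + c *: v) w h h0.
  by apply: dvf; exact: xO.
move=> E' E; exists c, c'; split=> //.
by rewrite [x + h *: v + _]addrAC E [x + h *: w + _]addrAC E'; ring.
Qed.

(** Both mixed derivatives are, at nearby points, equal to the same second
difference divided by h^2. *)
Theorem schwarz O f x v w : open O -> class_C 2 O f -> O x ->
  'D_v ('D_w f) x = 'D_w ('D_v f) x.
Proof.
move=> oO Cf Ox; apply/eqP; rewrite -subr_eq0 -normr_le0; apply/ler_addgt0Pr => e e0; rewrite add0r.
have e20 : 0 < e / 2 by rewrite divr_gt0.
have cvw : {for x, continuous ('D_v ('D_w f))} by apply: (Cf.2 w).2.
have cwv : {for x, continuous ('D_w ('D_v f))} by apply: (Cf.2 v).2.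
have /nbhs_ballP[r /= r0 rP] : \forall y \near x, O y /\
   (`|'D_v ('D_w f) x - 'D_v ('D_w f) y| < e / 2 /\
    `|'D_w ('D_v f) x - 'D_w ('D_v f) y| < e / 2).
  have N1 : \forall y \near x, `|'D_v ('D_w f) x - 'D_v ('D_w f) y| < e / 2.
    by move/cvgrPdist_lt : cvw => /(_ _ e20).
  have N2 : \forall y \near x, `|'D_w ('D_v f) x - 'D_w ('D_v f) y| < e / 2.
    by move/cvgrPdist_lt : cwv => /(_ _ e20).
  exact: (filterI (open_nbhs_nbhs (conj oO Ox)) (filterI N1 N2)).
(* the parallelogram spanned by h v and h w then lies in the ball of radius r *)
pose h := r / 2 / (`|v| + `|w| + 1).
have n0 : 0 < `|v| + `|w| + 1 by rewrite ltr_wpDl// addr_ge0.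
have h0 : 0 < h by rewrite !divr_gt0.
have inb c c' : 0 <= c <= h -> 0 <= c' <= h -> ball x r (x + c *: v + c' *: w).
  move=> /andP[c0 ch] /andP[c'0 c'h].
  rewrite -ball_normE /ball_/= -addrA opprD addrA subrr sub0r normrN.
  apply: (@le_lt_trans _ _ (r / 2)); last by rewrite ltr_pdivrMr// mulr2n; lra.
  rewrite (le_trans (ler_normD _ _))// !normrZ !ger0_norm//.
  have -> : r / 2 = h * (`|v| + `|w| + 1) by rewrite /h divfK// gt_eqF.
  by rewrite 2!mulrDr -addrA lerD ?ler_wpM2r// ler_wpDr ?ler_wpM2r// mulr1 ltW.
have inO c c' ch c'h := (rP _ (inb c c' ch c'h)).1.
have [c [c' [ch c'h E1]]] := second_difference h0 Cf inO.
have inO' c1 c1' : 0 <= c1 <= h -> 0 <= c1' <= h -> O (x + c1 *: w + c1' *: v).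
  by move=> *; rewrite addrAC; apply: inO.
have [d' [d [d'h dh E2]]] := second_difference h0 Cf inO'.
have D : f (x + h *: w + h *: v) - f (x + h *: w) - (f (x + h *: v) - f x) =
         f (x + h *: v + h *: w) - f (x + h *: v) - (f (x + h *: w) - f x).
  by rewrite [x + h *: w + _]addrAC subr_swap.
rewrite {}E1 {}E2 [x + d' *: w + _]addrAC in D.
have {}E2 := mulf_cancel (mulr_gt0 h0 h0) D.
have [_ [A1 _]] := rP _ (inb _ _ dh d'h).
have [_ [_ A2]] := rP _ (inb _ _ ch c'h).
rewrite -E2 in A2.
exact: (dist_le_half A1 A2).
Qed.

End Lines.

(** * A step function of class C^2 *)

Section Pos.
Context {R : realType}.

Definition pos (t : R) : R := Num.max t 0.

Lemma pos_le0 t : t <= 0 -> pos t = 0. Proof. by move=> ?; exact: max_r. Qed.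
Lemma pos_ge0 t : 0 <= pos t. Proof. by rewrite /pos le_max lexx orbT. Qed.
Lemma pos_id t : 0 <= t -> pos t = t. Proof. by move=> ?; exact: max_l. Qed.

Lemma continuous_pos : continuous pos.
Proof. by move=> t; apply: continuous_max => //; exact: cst_continuous. Qed.

(** The power k + 2 makes the right and the left difference quotients at 0
agree. *)
Lemma is_derive_posX k (t : R) :
  is_derive t 1 (fun s => pos s ^+ k.+2) (k.+2%:R * pos t ^+ k.+1).
Proof.
have [t0|t0|->] := ltgtP t 0.
- rewrite (pos_le0 (ltW t0)) expr0n/= mulr0.
  apply: (@near_eq_is_derive _ _ _ (cst 0)).
  near=> s; rewrite pos_le0 ?expr0n//=; apply: ltW; near: s.
  exact: lt_nbhsl.
- rewrite (pos_id (ltW t0)).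
  apply: (@near_eq_is_derive _ _ _ (fun s : R => s ^+ k.+2)).
    near=> s; rewrite pos_id//; apply: ltW; near: s.
    exact: lt_nbhsr.
  have := is_deriveX k.+2 (is_derive_id t (1 : R)).
  by rewrite -[_ *: (1 : R)]/(_ * 1) mulr1 exprfctE.
- rewrite pos_le0// expr0n/= mulr0.
  have H : (fun h : R => h^-1 *: (((fun s => pos s ^+ k.+2) \o shift 0) (h *: (1 : R))
      - pos 0 ^+ k.+2)) @ 0^' --> (0 : R).
    apply/cvgr0Pnorm_le => e e0; near=> h.
    have h0 : h != 0 by near: h; exact: nbhs_dnbhs_neq.
    rewrite /= addr0 -[h *: (1 : R)]/(h * 1) mulr1 (pos_le0 (lexx _)) expr0n subr0.
    rewrite -[_ *: _]/(_ * _) normrM normfV ler_pdivrMl ?normr_gt0//.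
    have hp : `|pos h| <= `|h|.
      by rewrite (ger0_norm (pos_ge0 h)) /pos ge_max normr_ge0 ler_norm.
    rewrite normrX exprS ler_pM//.
    have h1 : `|h| <= 1 by near: h; apply: nbhs_dnbhs; apply: nbhs0_le.
    have he : `|h| <= e by near: h; apply: nbhs_dnbhs; apply: nbhs0_le.
    rewrite exprS (le_trans _ he)// (le_trans _ hp)// ler_piMr// exprn_ile1//.
    exact: le_trans h1.
  by apply: DeriveDef; [exact: cvgP H|exact: cvg_lim H].
Unshelve. all: by end_near. Qed.

Lemma deriveR (f : R -> R) (t v : R) : differentiable f t ->
  'D_v f t = v * 'D_1 f t.
Proof.
move=> df; rewrite !deriveE//.
by rewrite -{1}[v]mulr1 -[v * 1]/(v *: (1 : R)) linearZ.
Qed.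

Lemma class_C_posX k O : class_C k O (fun s : R => pos s ^+ k.+1).
Proof.
apply: (@class_C_sub _ _ _ setT) => //.
elim: k => [|k IH].
  by move=> t _; rewrite (_ : (fun _ => _) = pos)//; exact: continuous_pos.
have df t : differentiable (fun s => pos s ^+ k.+2) t.
  by apply/derivable1_diffP; case: (is_derive_posX k t).
split=> // v; apply: class_C_ext (class_C_scale (v * k.+2%:R) openT IH) => [|t _].
  exact: openT.
by rewrite deriveR//= (@derive_val _ _ _ _ _ _ _ (is_derive_posX k t)) mulrA.
Qed.

(** From 0 on the left of 0 to 1 on the right of 1; the cube of the
positive part is of class C^2. *)
Definition step (t : R) : R := 1 - pos (1 - pos t ^+ 3) ^+ 3.

Lemma class_C_step : class_C 2 setT step.
Proof.
have C := class_C_posX 2 setT.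
have C1 := class_C_sub_fun openT (class_C_cst 2 setT (1 : R)) C.
exact: (class_C_sub_fun openT (class_C_cst 2 setT (1 : R)) (class_C_comp openT C C1)).
Qed.

Lemma step_le0 t : t <= 0 -> step t = 0.
Proof.
by move=> t0; rewrite /step (pos_le0 t0) expr0n subr0 pos_id// expr1n subrr.
Qed.

Lemma step_ge1 t : 1 <= t -> step t = 1.
Proof.
move=> t1; have t0 : 0 <= t by apply: le_trans t1.
by rewrite /step (pos_id t0) [pos _]pos_le0 ?expr0n ?subr0// subr_le0 exprn_ege1.
Qed.

Lemma step_itv t : 0 <= step t <= 1.
Proof.
have p : pos (1 - pos t ^+ 3) <= 1.
  by rewrite /pos ge_max ler01 andbT gerBl exprn_ge0// pos_ge0.
by rewrite /step subr_ge0 exprn_ile1 ?pos_ge0//= gerBl exprn_ge0// pos_ge0.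
Qed.

Lemma derive_step t : 'D_1 step t = 9 * (pos (1 - pos t ^+ 3) * pos t) ^+ 2.
Proof.
have D1 := is_derive_posX 1 t.
have D2 : is_derive t 1 (fun s => 1 - pos s ^+ 3) (0 - 3 * pos t ^+ 2).
  exact: (is_deriveB (is_derive_cst (1 : R) t 1) D1).
have d2 : differentiable (fun s => 1 - pos s ^+ 3) t.
  by apply/derivable1_diffP; case: D2.
have D3 := is_derive_posX 1 (1 - pos t ^+ 3).
have d3 : differentiable (fun s => pos s ^+ 3) (1 - pos t ^+ 3).
  by apply/derivable1_diffP; case: D3.
have D4 : is_derive t 1 (fun s => pos (1 - pos s ^+ 3) ^+ 3)
    ('D_1 (fun s => pos (1 - pos s ^+ 3) ^+ 3) t).
  by apply/derivableP/diff_derivable; exact: (differentiable_comp d2 d3).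
have D5 := is_deriveB (is_derive_cst (1 : R) t 1) D4.
rewrite (@derive_val _ _ _ _ _ _ _ D5) (derive_comp_fun _ d2 d3).
rewrite (@derive_val _ _ _ _ _ _ _ D2) (@derive_val _ _ _ _ _ _ _ D3).
by ring.
Qed.

Lemma derive_step_out t : t <= 0 \/ 1 <= t -> 'D_1 step t = 0.
Proof.
rewrite derive_step => -[t0|t1]; first by rewrite (pos_le0 t0) mulr0 expr0n/= mulr0.
have t0 : 0 <= t by apply: le_trans t1.
rewrite (pos_id t0) [pos _]pos_le0 ?mul0r ?expr0n ?mulr0//.
by rewrite subr_le0 exprn_ege1.
Qed.

Lemma derive_step_le t : `|'D_1 step t| <= 9.
Proof.
have [t0|t0] := lerP t 0; first by rewrite derive_step_out ?normr0//; left.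
have [t1|t1] := lerP 1 t; first by rewrite derive_step_out ?normr0//; right.
have t3 : 0 <= 1 - t ^+ 3 <= 1.
  apply/andP; split; first by rewrite subr_ge0; apply: exprn_ile1; exact: ltW.
  by rewrite gerBl exprn_ge0// ltW.
rewrite derive_step (pos_id (ltW t0)) pos_id; last by case/andP: t3.
rewrite ger0_norm; last by rewrite mulr_ge0// sqr_ge0.
rewrite ler_piMr// exprn_ile1//; case/andP: t3 => t3 t3'.
  by rewrite mulr_ge0// ltW.
by rewrite mulr_ile1// ltW.
Qed.

End Pos.

(** * Coordinates, bump functions and time slices *)

(** A finite subcover, as a sequence over which one can do induction. *)
Lemma compact_seq_cover (T : ptopologicalType) (K : set T) (N : T -> set T) :
  compact K -> (forall y, K y -> nbhs y (N y)) ->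
  exists s : seq T, (forall y, y \in s -> K y) /\
    forall x, K x -> exists2 y, y \in s & nbhs x (N y).
Proof.
rewrite compact_cover => cK KN.
have [|x Kx|D DK KD] := cK T K (fun y => (N y)°) _ _.
- by move=> y _; exact: open_interior.
- by exists x => //; exact: KN.
- exists (finmap.enum_fset D); split=> [y /DK|x /KD[y /= yD Ny]]; first by rewrite inE.
  by exists y.
Qed.

Section Coord.
Context {R : realType}.
Local Notation V := 'rV[R]_3.

Lemma derive_coord (i : 'I_3) (x v : V) : 'D_v (fun y : V => y 0 i) x = v 0 i.
Proof.
have D : derivable (id : V -> V) x v by exact: derivable_id.
by have /matrixP/(_ 0 i) := derive_mx D; rewrite derive_id mxE.
Qed.

Lemma class_C_coord k O (i : 'I_3) : class_C k O (fun y : V => y 0 i).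
Proof.
apply: (@class_C_sub _ _ _ setT) => //.
case: k => [|k] /=; first by move=> x _; exact: coord_continuous.
split=> [x _|v]; first exact: differentiable_coord.
apply: class_C_ext (class_C_cst k setT (v 0 i)) => [|x _]; first exact: openT.
by rewrite derive_coord.
Qed.

(** The square of the Euclidean distance is smooth, while the norm of 'rV[R]_3 is
a maximum. *)
Definition dist2 (y x : V) : R := \sum_(i < 3) (x 0 i - y 0 i) ^+ 2.

Lemma class_C_dist2 k y : class_C k setT (dist2 y).
Proof.
apply: class_C_sum => [|i _]; first exact: openT.
have C := class_C_sub_fun openT (class_C_coord k setT i) (class_C_cst k setT (y 0 i)).
exact: (class_C_mul openT C C).
Qed.

Lemma coord_le_norm (x : V) i : `|x 0 i| <= `|x|.
Proof.
rewrite [leRHS]/Num.norm /= mx_normrE.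
by apply: (@le_bigmax _ _ _ _ (fun ij => `|x ij.1 ij.2|) (0, i)).
Qed.

Lemma norm_le_coord (x : V) e : 0 <= e -> (forall i, `|x 0 i| <= e) -> `|x| <= e.
Proof.
move=> e0 xe; rewrite [leLHS]/Num.norm /= mx_normrE.
by apply/bigmax_leP; split=> // -[i j] _ /=; rewrite ord1.
Qed.

Lemma continuous_dist y : continuous (fun x : V => `|x - y|).
Proof.
move=> x; apply: (@continuous_comp _ _ _ (fun z : V => z - y) Num.norm).
  exact: (cvgB (@cvg_id _ (nbhs x)) (@cvg_cst _ y _ (nbhs x) _)).
exact: norm_continuous.
Qed.

Lemma norm_sqr_le_dist2 y x : `|x - y| ^+ 2 <= dist2 y x.
Proof.
rewrite -[leRHS]sqr_sqrtr ?sumr_ge0//; last by move=> *; exact: sqr_ge0.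
rewrite ler_pXn2r ?nnegrE ?sqrtr_ge0//.
apply: norm_le_coord => [|j]; first by rewrite sqrtr_ge0.
rewrite !mxE -sqrtr_sqr ler_sqrt; last first.
  by apply: sumr_ge0 => *; exact: sqr_ge0.
rewrite /dist2 (bigD1 j)//= lerDl sumr_ge0// => *; exact: sqr_ge0.
Qed.

(** 1 on the Euclidean ball of radius r, and 0 outside the ball of radius
sqrt 2 r, which is contained in the cube of radius 2 r. *)
Definition plateau (y : V) (r : R) (x : V) : R := step (2 - dist2 y x / r ^+ 2).

Lemma class_C_plateau y r : class_C 2 setT (plateau y r).
Proof.
apply: class_C_comp class_C_step _; first exact: openT.
apply: class_C_sub_fun; [exact: openT|exact: class_C_cst|].
apply: class_C_mul; [exact: openT|exact: class_C_dist2|exact: class_C_cst].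
Qed.

Lemma plateau_itv y r x : 0 <= plateau y r x <= 1. Proof. exact: step_itv. Qed.

Lemma plateau_near1 y r : 0 < r -> \forall x \near y, plateau y r x = 1.
Proof.
move=> r0; have c : {for y, continuous (dist2 y)} by exact: (class_C_dist2 0).
have d0 : dist2 y y = 0 by rewrite /dist2 big1// => i _; rewrite subrr expr0n.
have r20 : 0 < r ^+ 2 by rewrite exprn_gt0.
have : \forall x \near y, dist2 y x < r ^+ 2.
  move: c => /(_ [set z | z < r ^+ 2]); apply.
  by rewrite d0; apply: lt_nbhsl.
apply: filterS => x xr; apply: step_ge1.
have : dist2 y x / r ^+ 2 < 1 by rewrite ltr_pdivrMr// mul1r.
by move: (_ / _) => z; lra.
Qed.

Lemma plateau_out y r x : 0 < r -> 2 * r < `|x - y| -> \forall z \near x, plateau y r z = 0.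
Proof.
move=> r0 rx.
have : \forall z \near x, 2 * r < `|z - y|.
  have c := @continuous_dist y x.
  move: c => /(_ [set z | 2 * r < z]); apply.
  exact: lt_nbhsr.
apply: filterS => z zr; apply: step_le0; rewrite subr_le0.
rewrite ler_pdivlMr ?exprn_gt0//; apply: le_trans (norm_sqr_le_dist2 y z).
apply: (@le_trans _ _ ((2 * r) ^+ 2)).
  by rewrite exprMn; have := exprn_gt0 2 r0; lra.
by rewrite ler_pXn2r ?nnegrE ?mulr_ge0 ?(ltW r0)// ltW.
Qed.

End Coord.

Section Slice.
Context {R : realType} {V : normedModType R}.
Implicit Types (O : set (V * R)) (f : V * R -> R).

Lemma derive_slice f x t v :
  'D_v (fun y => f (y, t)) x = 'D_((v, 0) : V * R) f (x, t).
Proof.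
have E : (fun h : R => h^-1 *: (((fun y => f (y, t)) \o shift x) (h *: v) - f (x, t))) =
  (fun h : R => h^-1 *: ((f \o shift (x, t)) (h *: ((v, 0) : V * R)) - f (x, t))).
  apply/funext => h /=; congr (_ *: (f _ - _)); apply/pair_equal_spec; split=> //=.
  by rewrite -[h *: (0 : R)]/(h * 0) mulr0 add0r.
by rewrite /derive E.
Qed.

Lemma continuous_slice (t : R) : continuous (fun y : V => (y, t)).
Proof. move=> y; apply: (@cvg_pair _ _ _ _ (nbhs y) (nbhs t)); first exact: cvg_id.
exact: cvg_cst. Qed.

Lemma open_slice O t : open O -> open [set x | O (x, t)].
Proof. by move=> oO; have /continuousP := @continuous_slice t; apply. Qed.

Lemma class_C_slice k O f t : class_C k O f ->
  class_C k [set x | O (x, t)] (fun x => f (x, t)).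
Proof.
elim: k f => [|k IH] f /=.
  move=> cf x Ox; apply: (@continuous_comp _ _ _ (fun y : V => (y, t)) f).
    exact: continuous_slice.
  exact: cf.
move=> [df cf]; split=> [x Ox|v].
  apply: (@differentiable_comp _ _ _ _ (fun y : V => (y, t)) f); last exact: df.
  by apply: differentiable_pair.
rewrite (_ : 'D_v _ = fun x => 'D_((v, 0) : V * R) f (x, t)); first exact: (IH _ (cf _)).
by apply/funext => x; exact: derive_slice.
Qed.

Lemma is_derive_time f x t : differentiable f (x, t) ->
  is_derive t 1 (fun s => f (x, s)) ('D_((0, 1) : V * R) f (x, t)).
Proof.
have E s : (x, 0) + s *: ((0, 1) : V * R) = (x, s).
  apply/pair_equal_spec; split=> /=; first by rewrite scaler0 addr0.
  by rewrite add0r -[s *: _]/(s * 1) mulr1.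
rewrite -E => /is_derive_line; rewrite (_ : (fun r => f _) = fun s => f (x, s))//.
by apply/funext => s; rewrite E.
Qed.

End Slice.

(** * Means over finer and finer grids *)

Section Grid.
Context {R : realType} (M : R).
Local Notation V := 'rV[R]_3.
Implicit Types (f g : V -> R) (n : nat) (a : 'I_3).

Definition mesh n : R := 2 * M / n.+1%:R.

(** The grid is closed on the left only: along a line, the increments of a
function over the n + 1 cells telescope to the difference of its values on
two opposite faces of the box [-M, M]^3. *)
Definition grid n (k : {ffun 'I_3 -> 'I_n.+1}) : V :=
  \row_i (- M + mesh n * (k i)%:R).

Definition mean n f : R :=
  (n.+1%:R ^+ 3)^-1 * \sum_(k : {ffun 'I_3 -> 'I_n.+1}) f (grid k).

Lemma card3 n : #|{: {ffun 'I_3 -> 'I_n.+1}}|%:R = n.+1%:R ^+ 3 :> R.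
Proof. by rewrite card_ffun !card_ord natrX. Qed.

Lemma sum_cst3 n (c : R) :
  \sum_(k : {ffun 'I_3 -> 'I_n.+1}) c = n.+1%:R ^+ 3 * c.
Proof. by rewrite -card3 mulr_natl sumr_const; congr (_ *+ _); apply: eq_card. Qed.

Lemma card3_gt0 n : 0 < n.+1%:R ^+ 3 :> R.
Proof. by rewrite exprn_gt0. Qed.

Lemma mean_le n f g : (forall k, f (@grid n k) <= g (grid k)) -> mean n f <= mean n g.
Proof.
by move=> fg; rewrite ler_wpM2l ?invr_ge0 ?(ltW (card3_gt0 n))// ler_sum.
Qed.

Lemma mean_cst n c : mean n (fun=> c) = c.
Proof.
by rewrite /mean sum_cst3 mulKf// gt_eqF// card3_gt0.
Qed.

Lemma mean_add n f g : mean n (fun x => f x + g x) = mean n f + mean n g.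
Proof. by rewrite /mean big_split mulrDr. Qed.

Lemma mean_scale n c f : mean n (fun x => c * f x) = c * mean n f.
Proof. by rewrite /mean -mulr_sumr mulrCA. Qed.

Lemma mean_opp n f : mean n (fun x => - f x) = - mean n f.
Proof. by rewrite /mean sumrN mulrN. Qed.

Lemma mean_sub n f g : mean n (fun x => f x - g x) = mean n f - mean n g.
Proof. by rewrite mean_add mean_opp. Qed.

Lemma mean_eq n f g : f =1 g -> mean n f = mean n g.
Proof. by move=> fg; rewrite /mean; congr (_ * _); apply: eq_bigr => k _. Qed.

Lemma mean_norm_le n f g : (forall k, `|f (@grid n k)| <= g (grid k)) ->
  `|mean n f| <= mean n g.
Proof.
move=> fg; rewrite ler_norml -mean_opp; apply/andP.
by split; apply: mean_le => k; have := fg k; rewrite ler_norml => /andP[].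
Qed.

Definition null_mean f := forall e, 0 < e -> \forall n \near \oo, `|mean n f| <= e.

Lemma null_mean_ext f g : f =1 g -> null_mean f -> null_mean g.
Proof.
move=> fg nf e /nf; apply: filterS => n; rewrite (@mean_eq n f g)//.
Qed.

Lemma null_mean0 : null_mean (fun=> 0).
Proof. by move=> e e0; near=> n; rewrite mean_cst normr0 ltW. Unshelve. all: by end_near. Qed.

Lemma null_meanD f g : null_mean f -> null_mean g -> null_mean (fun x => f x + g x).
Proof.
move=> nf ng e e0; have e20 : 0 < e / 2 by rewrite divr_gt0.
apply: filterS2 (nf _ e20) (ng _ e20) => n fe ge.
by rewrite mean_add (le_trans (ler_normD _ _))//; lra.
Qed.

Lemma null_mean_scale c f : null_mean f -> null_mean (fun x => c * f x).
Proof.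
move=> nf e e0; have c0 : 0 < `|c| + 1 by rewrite ltr_wpDl.
apply: filterS (nf _ (divr_gt0 e0 c0)) => n fe.
rewrite mean_scale normrM (le_trans (ler_wpM2l _ fe))// mulrCA ler_piMr ?ltW//.
by rewrite ltr_pdivrMr// mul1r ltrDl.
Qed.

Lemma null_mean_sum (I : Type) (r : seq I) (F : I -> V -> R) :
  (forall i, null_mean (F i)) -> null_mean (fun x => \sum_(i <- r) F i x).
Proof.
move=> nF; elim: r => [|i r IH].
  by apply: null_mean_ext null_mean0 => x; rewrite big_nil.
by apply: null_mean_ext (null_meanD (nF i) IH) => x; rewrite big_cons.
Qed.

(** A grid line in the direction a is represented by any of its points k, with
upd k a j running over the line, rather than by the two other coordinates. *)
Definition upd n (k : {ffun 'I_3 -> 'I_n.+1}) a (j : 'I_n.+1) :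
  {ffun 'I_3 -> 'I_n.+1} := [ffun i => if i == a then j else k i].

(** Every point of the grid is reached from the n + 1 points of its line; the
involution exchanges the new and the old coordinate. *)
Lemma sum_upd n a (F : {ffun 'I_3 -> 'I_n.+1} -> R) :
  \sum_k \sum_j F (upd k a j) = n.+1%:R * \sum_k F k.
Proof.
pose s (p : {ffun 'I_3 -> 'I_n.+1} * 'I_n.+1) := (upd p.1 a p.2, p.1 a).
have sK : involutive s.
  move=> [k j]; rewrite /s /= ffunE eqxx; congr pair.
  by apply/ffunP => i; rewrite !ffunE; case: eqP => [->|].
rewrite pair_bigA /= (reindex_inj (inv_inj sK))/=.
under eq_bigr => p _.
  rewrite (_ : upd _ a _ = p.1); first over.
  by apply/ffunP => i; rewrite !ffunE; case: eqP => [->|].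
rewrite -(pair_bigA _ (fun k (j : 'I_n.+1) => F k)) /= mulr_sumr.
apply: eq_bigr => k _.
by rewrite sumr_const card_ord mulr_natl.
Qed.

Lemma mean_line_le n a f c :
  (forall k, \sum_j f (@grid n (upd k a j)) <= c * n.+1%:R) -> mean n f <= c.
Proof.
move=> H; have n0 : 0 < n.+1%:R :> R by [].
have : \sum_(k : {ffun 'I_3 -> 'I_n.+1}) \sum_j f (@grid n (upd k a j))
   <= \sum_(k : {ffun 'I_3 -> 'I_n.+1}) c * n.+1%:R by apply: ler_sum => k _; exact: H.
rewrite (sum_upd a (fun k => f (grid k))) sum_cst3 => H'.
rewrite /mean mulrC ler_pdivrMr ?card3_gt0// -(ler_pM2l n0) (le_trans H')//.
by rewrite le_eqVlt; apply/orP; left; apply/eqP; ring.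
Qed.

Lemma mean_line_norm_le n a f c :
  (forall k, `|\sum_j f (@grid n (upd k a j))| <= c * n.+1%:R) -> `|mean n f| <= c.
Proof.
move=> H; rewrite ler_norml lerNl -mean_opp; apply/andP; split;
  apply: (@mean_line_le _ a) => k; have := H k; rewrite ler_norml => /andP[H1 H2] //.
by rewrite sumrN lerNl.
Qed.

Lemma grid_line n k a (j : 'I_n.+1) :
  grid (upd k a j) = grid (upd k a ord0) + (mesh n * j%:R) *: (Defs.basis R a).
Proof.
apply/rowP => i; rewrite !mxE !ffunE eqxx /=.
by case: eqVneq => _; rewrite ?mulr0 ?addr0 ?mulr1.
Qed.

End Grid.

(** * The mean of a derivative *)

Section Telescope.
Context {R : realType} (M : R) (M0 : 0 < M).
Local Notation V := 'rV[R]_3.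
Local Notation e_ a := (Defs.basis R a).
Implicit Types (f g : V -> R) (n : nat) (a : 'I_3).

Lemma mesh_gt0 n : 0 < mesh M n.
Proof. by rewrite divr_gt0// mulr_gt0. Qed.

Lemma mesh_cvg0 r : 0 < r -> \forall n \near \oo, mesh M n < r.
Proof.
move=> r0; have : \forall n \near \oo, (2 * M / r : R) < n%:R.
  exact: nbhs_infty_gtr.
apply: filterS => n; rewrite ltr_pdivrMr// => H.
rewrite /mesh ltr_pdivrMr// (lt_le_trans H)// mulrC ler_wpM2l ?(ltW r0)//.
by rewrite ler_nat.
Qed.

Lemma norm_basis a : `|e_ a| <= 1.
Proof.
apply: norm_le_coord => // i; rewrite mxE eqxx/=.
by case: (i == a); rewrite ?normr1 ?normr0.
Qed.

Lemma closed_ball_compact (y : V) r : compact [set x | `|x - y| <= r].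
Proof.
apply: bounded_closed_compact.
  exists (`|y| + r); split; first exact: num_real.
  move=> z yz x /= xr; rewrite -[x](subrK y) (le_trans (ler_normD _ _))//.
  by rewrite ltW// (le_lt_trans _ yz)// addrC lerD2l.
have c := @continuous_dist R y.
move/continuous_closedP : c => /(_ [set z | z <= r]); apply; exact: closed_le.
Qed.

Lemma grid_norm n (k : {ffun 'I_3 -> 'I_n.+1}) : `|grid M k| <= M.
Proof.
apply: norm_le_coord => [|i]; first exact: ltW.
have h0 := mesh_gt0 n; rewrite mxE ler_norml lerDl mulr_ge0 ?(ltW h0)//=.
rewrite -lerBrDl opprK (@le_trans _ _ (mesh M n * n.+1%:R))//.
  by rewrite ler_wpM2l ?(ltW h0)// ler_nat ltnW.
by rewrite /mesh divfK// mulrDl mul1r.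
Qed.

Lemma line_norm n (k : {ffun 'I_3 -> 'I_n.+1}) a s : 0 <= s <= 2 * M ->
  `|grid M (upd k a ord0) + s *: e_ a| <= M.
Proof.
move=> /andP[s0 sM]; apply: norm_le_coord => [|i]; first exact: ltW.
rewrite !mxE ffunE eqxx /=; case: eqVneq => [_|ia].
  by rewrite mulr0 addr0 mulr1 ler_norml; apply/andP; split; lra.
by rewrite mulr0 addr0; have := coord_le_norm (grid M k) i; rewrite mxE => /le_trans; apply; exact: grid_norm.
Qed.

(** Uniform continuity on a compact set, in the form needed below: the
increment is along w, and the smallness of the mesh depends neither on the
point nor on the step. *)
Lemma uniform_increment (K : set V) (w : V) (D : V -> R) e :
  compact K -> continuous D -> 0 < e -> `|w| <= 1 ->
  \forall n \near \oo, forall x s, K x -> 0 <= s <= mesh M n ->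
    `|D (x + s *: w) - D x| <= e.
Proof.
move=> cK cD e0 w1.
pose P n (x : V) := forall s, 0 <= s <= mesh M n -> `|D (x + s *: w) - D x| <= e.
suff : \forall n \near \oo, K `<=` P n by apply: filterS => n KP x s Kx; exact: KP.
apply: ((compact_near_coveringP K).1 cK nat \oo P _) => x Kx.
have e20 : 0 < e / 2 by rewrite divr_gt0.
have /nbhs_ballP[r /= r0 rP] : \forall y \near x, `|D x - D y| < e / 2.
  by have /cvgrPdist_lt/(_ _ e20) := cD x.
have r20 : 0 < r / 2 by rewrite divr_gt0.
exists (ball x (r / 2), [set n | mesh M n < r / 2]).
  by split; [exact: nbhsx_ballx|exact: mesh_cvg0].
move=> [y n] /= [xy nr] s /andP[s0 sn].
have B1 : ball x r y by apply: le_ball xy; rewrite ler_pdivrMr//; lra.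
have B2 : ball x r (y + s *: w).
  move: xy; rewrite -ball_normE /ball_/= => xy.
  rewrite opprD addrA (le_lt_trans (ler_normB _ _))//.
  have : `|s *: w| <= r / 2.
    rewrite normrZ (ger0_norm s0) (le_trans _ (ltW nr))// (le_trans _ sn)//.
    by rewrite ler_piMr.
  by move: xy; move: `|_| `|_| => p q; lra.
by rewrite distrC; apply: (@dist_le_half _ _ _ (D x)); rewrite distrC; apply: rP.
Qed.

(** The derivative at a grid point is, up to e, the difference quotient over
the next cell by the mean value theorem. The quotients telescope along each
grid line, and the two end values are zero. *)
Lemma null_mean_derive f a : (forall x, differentiable f x) ->
  continuous ('D_(e_ a) f) -> (forall x, M <= `|x| -> f x = 0) ->
  null_mean M ('D_(e_ a) f).
Proof.
move=> df cf f0 e e0.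
have := uniform_increment (@closed_ball_compact 0 M) cf e0 (norm_basis a).
apply: filterS => n H; apply: (@mean_line_norm_le _ _ _ a) => k.
have h0 := mesh_gt0 n.
pose p (j : nat) := grid M (upd k a ord0) + (mesh M n * j%:R) *: e_ a.
have pS j : p j.+1 = p j + mesh M n *: e_ a.
  by rewrite /p -addrA -scalerDl -natr1 mulrDr mulr1.
have pM j : (j <= n.+1)%N -> `|p j| <= M.
  move=> jn; apply: line_norm; rewrite mulr_ge0 ?(ltW h0)//=.
  rewrite (@le_trans _ _ (mesh M n * n.+1%:R))//.
    by rewrite ler_wpM2l ?(ltW h0)// ler_nat.
  by rewrite /mesh divfK.
have pe (j : nat) : (j < n.+1)%N ->
    `|mesh M n * 'D_(e_ a) f (p j) - (f (p j.+1) - f (p j))| <= mesh M n * e.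
  move=> jn; have [s [sh]] := MVT_line (x := p j) (v := e_ a) h0 (fun s _ => df _).
  rewrite pS => ->; rewrite -mulrBr normrM (ger0_norm (ltW h0)) ler_wpM2l ?(ltW h0)//.
  by rewrite distrC; apply: H => //=; rewrite subr0; exact/pM/ltnW.
have -> : \sum_j 'D_(e_ a) f (grid M (upd k a j)) = \sum_(0 <= j < n.+1) 'D_(e_ a) f (p j).
  by rewrite big_mkord; apply: eq_bigr => j _; rewrite grid_line.
(* both ends of a grid line lie on faces of the box, where f is zero *)
have p0 : f (p 0%N) = 0.
  apply: f0; have := coord_le_norm (p 0%N) a.
  rewrite !mxE ffunE !eqxx /= !mulr0 mul0r !addr0 normrN (ger0_norm (ltW M0)).
  exact: le_trans.
have pn : f (p n.+1) = 0.
  apply: f0; have := coord_le_norm (p n.+1) a.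
  rewrite !mxE ffunE !eqxx /= mulr0 addr0 mulr1 /mesh divfK//.
  rewrite (_ : - M + 2 * M = M); last by ring.
  by rewrite (ger0_norm (ltW M0)) => /le_trans; exact.
have T : \sum_(0 <= j < n.+1) (f (p j.+1) - f (p j)) = 0.
  by rewrite telescope_sumr// p0 pn subrr.
rewrite -(ler_pM2l h0) -[X in X * `|_|](ger0_norm (ltW h0)) -normrM mulr_sumr.
have -> : \sum_(0 <= j < n.+1) mesh M n * 'D_(e_ a) f (p j) =
    \sum_(0 <= j < n.+1) (mesh M n * 'D_(e_ a) f (p j) - (f (p j.+1) - f (p j))).
  by rewrite sumrB T subr0.
rewrite (le_trans (ler_norm_sum _ _ _))//.
apply: (@le_trans _ _ (\sum_(0 <= j < n.+1) mesh M n * e)).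
  by rewrite !big_mkord; apply: ler_sum => j _; exact: pe.
by rewrite big_mkord sumr_const card_ord -[leLHS]mulr_natr mulrA.
Qed.

End Telescope.

(** * The region, thin slabs and fields vanishing near the boundary *)

Section Region.
Context {R : realType} (M : R) (M0 : 0 < M).
Local Notation V := 'rV[R]_3.
Local Notation e_ a := (Defs.basis R a).
Implicit Types (f g : V -> R) (n : nat) (a : 'I_3) (B : set V).

Lemma ind1 B x : B x -> \1_B x = 1 :> R.
Proof. by move=> Bx; rewrite indicE mem_set. Qed.

Lemma ind0 B x : ~ B x -> \1_B x = 0 :> R.
Proof. by move=> Bx; rewrite indicE memNset. Qed.

Lemma ind_ge0 B x : 0 <= \1_B x :> R.
Proof. by rewrite indicE. Qed.

Lemma bdP B x : open B -> ~ B x -> closure B x -> bd B x.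
Proof. by move=> oB Bx cx; split=> // /(@interior_subset _ B). Qed.

Lemma bd_notin B x : open B -> bd B x -> ~ B x.
Proof. by move=> oB [_ nB] Bx; apply: nB; exact: (open_nbhs_nbhs (conj oB Bx)). Qed.

(** Extended by zero, g is differentiable with continuous derivatives on the
whole space, because it already vanishes near the boundary. *)
Lemma null_mean_vanish B (g : V -> R) a : open B -> (forall x, B x -> `|x| < M) ->
  class_C 1 B g -> (forall y, bd B y -> \forall x \near y, g x = 0) ->
  null_mean M (fun x => \1_B x * 'D_(e_ a) g x).
Proof.
move=> oB BM Cg g0; pose f (x : V) : R := \1_B x * g x.
have fin x : B x -> \forall y \near x, g y = f y.
  by move=> Bx; apply: (open_near oB Bx) => y By; rewrite /f ind1// mul1r.
have fout x : ~ B x -> \forall y \near x, 0 = f y.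
  move=> Bx; have [cx|cx] := pselect (closure B x).
    by apply: filterS (g0 _ (bdP oB Bx cx)) => y gy; rewrite /f gy mulr0.
  have oc : open (~` closure B) by apply: closed_openC; exact: closed_closure.
  apply: (open_near oc cx) => y cy; rewrite /f ind0 ?mul0r// => By.
  by apply: cy; exact: subset_closure.
have [dg cg] := Cg.
have df x : differentiable f x.
  have [Bx|Bx] := pselect (B x); first exact: differentiable_near (fin _ Bx) (dg _ Bx).
  by apply: differentiable_near (fout _ Bx) _; exact: differentiable_cst.
have Df x : \1_B x * 'D_(e_ a) g x = 'D_(e_ a) f x.
  have [Bx|Bx] := pselect (B x).
    by rewrite ind1// mul1r; apply: near_eq_derive; exact: fin.
  by rewrite ind0// mul0r -(near_eq_derive _ (fout _ Bx)) derive_cst.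
have cDf : continuous ('D_(e_ a) f).
  suff : class_C 0 setT ('D_(e_ a) f) by move=> + x; apply.
  apply: class_C_local => x _; have [Bx|Bx] := pselect (B x).
    exists B; split=> //; apply: (@class_C_ext _ _ 0 B _ _ oB _ (cg (e_ a))) => y By.
    by rewrite -Df ind1// mul1r.
  have [U [oU Ux] U0] : exists2 U, open U /\ U x & forall y, U y -> 0 = f y.
    have : nbhs x [set y | 0 = f y] := fout _ Bx.
    by rewrite nbhsE => -[U [oU Ux] UP]; exists U.
  exists U; split=> //; apply: (@class_C_ext _ _ 0 U _ _ oU _ (class_C_cst 0 U 0)) => y Uy.
  by rewrite -(@near_eq_derive _ _ _ (fun=> 0) f) ?derive_cst//; exact: (open_near oU).
apply: null_mean_ext (@null_mean_derive _ _ M0 f a df cDf _) => [x|x xM].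
  by rewrite Df.
by rewrite /f ind0 ?mul0r// => /BM; rewrite ltNge xM.
Qed.

(** Indices whose extreme values differ by at most w / h are at most
w / h + 1 in number. *)
Lemma card_le_spread n (P : pred 'I_n.+1) (h w : R) : 0 < h -> 0 <= w ->
  (forall i j : 'I_n.+1, P i -> P j -> (i <= j)%N -> (j - i)%:R * h <= w) ->
  \sum_(i < n.+1) (P i)%:R <= w / h + 1.
Proof.
move=> h0 w0 H; have [i0 Pi0|P0] := pickP P; last first.
  rewrite big1 => [|i _]; last by rewrite P0.
  by rewrite addr_ge0// divr_ge0// ltW.
case: (@arg_minnP _ i0 P (fun i => nat_of_ord i) Pi0) => i Pi imin.
case: (@arg_maxnP _ i0 P (fun i => nat_of_ord i) Pi0) => j Pj jmax.
have ij : (i <= j)%N by apply: imin.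
have E : (\sum_(k < n.+1) (P k : nat) <= (j - i).+1)%N.
  apply: (@leq_trans (\sum_(k < n.+1 | (i <= k)%N && (k < j.+1)%N) 1)).
    rewrite [leqRHS]big_mkcond/=; apply: leq_sum => k _.
    by case: (boolP (P k)) => // Pk; rewrite imin// ltnS (jmax k Pk : (k <= j)%N).
  rewrite -(big_mkord (fun k => (i <= k)%N && (k < j.+1)%N) (fun=> 1%N)).
  rewrite -(big_nat_widen _ _ _ (fun k => (i <= k)%N) (fun=> 1%N))//.
  rewrite -(big_nat_widenl _ _ _ xpredT (fun=> 1%N))//.
  by rewrite sum_nat_const_nat muln1 subSn.
have -> : \sum_(k < n.+1) (P k)%:R = (\sum_(k < n.+1) (P k : nat))%N%:R :> R.
  by rewrite natr_sum.
apply: (@le_trans _ _ ((j - i).+1%:R)); first by rewrite ler_nat.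
by rewrite -natr1 lerD2r ler_pdivlMr// H.
Qed.

(** This is Fubini for a thin set: if every line in the direction a meets S in
a segment of length at most w / c, then the volume of S is at most w / c
times the area of a face of the box, up to the mesh. *)
Lemma slab_mean n a (S : set V) c w : 0 < c -> 0 <= w ->
  (forall x s, S x -> S (x + s *: e_ a) -> 0 <= s -> c * s <= w) ->
  mean M n \1_S <= w / c / (2 * M) + n.+1%:R^-1.
Proof.
move=> c0 w0 H; have h0 := mesh_gt0 M0 n; have n0 : 0 < n.+1%:R :> R by [].
apply: (@mean_line_le _ _ _ a) => k.
pose P (j : 'I_n.+1) := `[< S (grid M (upd k a j)) >].
have -> : \sum_j \1_S (grid M (upd k a j)) = \sum_j (P j)%:R :> R.
  by apply: eq_bigr => j _; rewrite indicE.
have -> : (w / c / (2 * M) + n.+1%:R^-1) * n.+1%:R = (w / c) / mesh M n + 1.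
  by rewrite /mesh; field; rewrite nat1r (gt_eqF n0) (gt_eqF M0) (gt_eqF c0).
apply: card_le_spread => //; first by rewrite divr_ge0// ltW.
move=> i j /asboolP Si /asboolP Sj ij.
rewrite ler_pdivlMr// mulrC; apply: H Si _ _; last by rewrite mulr_ge0// ltW.
rewrite (_ : grid M (upd k a i) + _ = grid M (upd k a j))//.
rewrite [LHS](congr1 (fun x => x + _) (grid_line M k a i)) [RHS]grid_line -addrA -scalerDl.
by rewrite natrB// [_ * mesh M n]mulrC mulrBr subrKC.
Qed.

Lemma compact_bound (K : set V) g : compact K ->
  (forall x, K x -> {for x, continuous g}) ->
  exists2 C, 0 <= C & forall x, K x -> `|g x| <= C.
Proof.
move=> cK cg; pose P n (x : V) := `|g x| <= n%:R.
suff : \forall n \near \oo, K `<=` P n.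
  by case=> n _ /(_ n) /= H; exists n%:R => // x Kx; apply: H => //=.
apply: ((compact_near_coveringP K).1 cK nat \oo P _) => x Kx.
have N1 : \forall y \near x, `|g x - g y| < 1.
  by have /cvgrPdist_lt/(_ _ ltr01) := cg x Kx.
have N2 : \forall n \near \oo, (`|g x| + 1 : R) < n%:R by exact: nbhs_infty_gtr.
exists ([set y | `|g x - g y| < 1], [set n | (`|g x| + 1 : R) < n%:R]) => //.
move=> [y n] /= [gy gn]; rewrite /P ltW// (le_lt_trans _ gn)//.
have := ler_normB (g x) (g x - g y); rewrite opprB addrC subrK.
by move: gy; move: `|g x| `|g y| `|_ - _| => p q r; lra.
Qed.

End Region.

(** * The divergence theorem near a boundary point *)

Lemma norm_le_sum (R : realType) (p q s1 s2 s3 e : R) : `|p - q| <= s1 ->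
  `|q| <= e / 4 -> s1 <= s2 + s3 -> s2 <= e / 2 -> s3 <= e / 4 -> `|p| <= e.
Proof.
by have := ler_normD (p - q) q; rewrite subrK; move: `|p| `|p - q| `|q| => x y z; lra.
Qed.

Lemma norm_ge_half (R : realType) (p q : R) : `|p - q| < `|p| / 2 -> `|p| / 2 <= `|q|.
Proof. by have := lerB_dist p q; move: `|p| `|q| `|p - q| => x y z; lra. Qed.

Section Local.
Context {R : realType} (M : R) (M0 : 0 < M).
Local Notation V := 'rV[R]_3.
Local Notation e_ a := (Defs.basis R a).
Implicit Types (f g : V -> R) (n : nat) (a : 'I_3).
Variable B : set V.
Hypotheses (oB : open B) (BM : forall x, B x -> `|x| < M) (cB : compact (closure B)).

(** By compactness, on K the layers { - eps0 < psi < 0 } shrink uniformly to the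
boundary, where g is zero. *)
Lemma small_near_boundary (U : set V) (psi g : V -> R) (K : set V) eta :
  0 < eta -> compact K -> K `<=` closure B `&` U -> open U ->
  (forall x, K x -> {for x, continuous g}) -> (forall x, U x -> {for x, continuous psi}) ->
  (forall x, U x -> (B x <-> psi x < 0)) ->
  (forall x, K x -> bd B x -> g x = 0) ->
  exists2 eps0, 0 < eps0 & forall x, K x -> B x -> - eps0 < psi x -> `|g x| <= eta.
Proof.
move=> eta0 cK KU oU cg cpsi Bpsi g0.
pose P (n : nat) (x : V) := U x -> B x -> - n.+1%:R^-1 < psi x -> `|g x| <= eta.
suff : \forall n \near \oo, K `<=` P n.
  case=> n _ /(_ n) /= H; exists n.+1%:R^-1; first by rewrite invr_gt0.
  by move=> x Kx; apply: H => //=; exact: (KU _ Kx).2.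
apply: ((compact_near_coveringP K).1 cK nat \oo P _) => x Kx.
have [cx Ux] := KU _ Kx.
have [Bx|Bx] := pselect (B x).
  have px : psi x < 0 by apply/Bpsi.
  have N1 : \forall y \near x, psi y < psi x / 2.
    have := cpsi _ Ux => /(_ [set z | z < psi x / 2]); apply.
    by apply: lt_nbhsl; lra.
  have N2 : \forall n \near \oo, n.+1%:R^-1 < - psi x / 2.
    have p0 : 0 < - psi x / 2 by lra.
    near=> n; rewrite -[X in _ < X]invrK ltf_pV2 ?posrE ?invr_gt0//.
    rewrite (@lt_trans _ _ n%:R)// ?ltr_nat//; near: n; exact: nbhs_infty_gtr.
  exists ([set y | psi y < psi x / 2], [set n : nat | n.+1%:R^-1 < - psi x / 2]) => //.
  by move=> [y n] /= [py pn] _ _ py2; exfalso; move: (n.+1%:R^-1) (psi x) (psi y) py pn py2 => u v w; lra.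
have gx : g x = 0 by apply: g0 => //; exact: bdP.
exists ([set y | `|g y| < eta], setT).
  split; last exact: filterT.
  have /cvgrPdist_lt/(_ _ eta0) := cg _ Kx.
  by apply: filterS => y /=; rewrite gx sub0r normrN.
by move=> [y n] /= [gy _] _ _ _; exact: ltW.
Unshelve. all: by end_near. Qed.

(** Near y, B is { psi < 0 } and psi is strictly monotonic in the direction a.
Let h = step (- psi / eps - 1): it is 0 where - eps <= psi and 1 where
psi <= - 2 eps. The field G = h phi F vanishes near the boundary, so that
its divergence has mean zero. Its divergence differs from that of phi F only
in the layer { - 2 eps < psi < 0 }, whose mean is of order eps since
psi has a slope of at least c in the direction a. There, the difference is
bounded by C1 + 9 eta / eps, where 9 bounds step' and eta bounds
F . grad psi, which is small near the boundary as F is tangential; the error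
is thus of order eta + eps. The function phi only depends on the region, not
on F, so that finitely many of them can be used in succession. *)
Lemma local_null_divergence (U : set V) (psi : V -> R) y a :
  open U -> U y -> class_C 1 U psi -> (forall x, U x -> (B x <-> psi x < 0)) ->
  'D_(e_ a) psi y != 0 ->
  exists phi : V -> R, [/\ class_C 2 setT phi, \forall x \near y, phi x = 1 &
    forall (O : set V) (F : 'I_3 -> V -> R), open O -> closure B `<=` O ->
      (forall i, class_C 1 O (F i)) ->
      (forall x, bd B x -> U x -> \sum_i F i x * 'D_(e_ i) psi x = 0) ->
    null_mean M (fun x => \1_B x * \sum_i 'D_(e_ i) (fun z => phi z * F i z) x)].
Proof.
move=> oU Uy Cpsi Bpsi Dy.
have [dpsi cDpsi] := Cpsi.
have cpsi x : U x -> {for x, continuous psi} by move/dpsi; exact: differentiable_continuous.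
pose c := `|'D_(e_ a) psi y| / 2.
have c0 : 0 < c by rewrite divr_gt0// normr_gt0.
have [r r0 rP] : exists2 r, 0 < r & forall x, `|x - y| <= 2 * r ->
    U x /\ c <= `|'D_(e_ a) psi x|.
  have N : \forall x \near y, U x /\ `|'D_(e_ a) psi y - 'D_(e_ a) psi x| < c.
    apply: filterI; first exact: (open_nbhs_nbhs (conj oU Uy)).
    by have /cvgrPdist_lt/(_ _ c0) := cDpsi (e_ a) y Uy.
  have /nbhs_ballP[r /= r0 rP] := N; exists (r / 4); first by rewrite divr_gt0.
  move=> x xy; have [] := rP x.
    by rewrite -ball_normE /ball_/= distrC (le_lt_trans xy)//; lra.
  by move=> Ux H; split=> //; exact: norm_ge_half.
pose phi := plateau y r.
have Cphi : class_C 2 setT phi by exact: class_C_plateau.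
exists phi; split=> //; first exact: plateau_near1.
move=> O F oO BO CF Fn.
pose Q := [set x : V | `|x - y| <= 2 * r].
have cQ : compact Q by exact: closed_ball_compact.
have QU x : Q x -> U x by move=> /rP[].
have phi0 x : ~ Q x -> \forall z \near x, phi z = 0.
  by move=> Qx; apply: plateau_out => //; rewrite ltNge; apply/negP => xr; exact: Qx.
have clBB x : B x -> closure B x by exact: subset_closure.
pose dv x := \sum_i 'D_(e_ i) (fun z => phi z * F i z) x.
pose g x := \sum_i F i x * 'D_(e_ i) psi x.
have CphiF i : class_C 1 O (fun z => phi z * F i z).
  exact: (class_C_mul oO (class_C_sub (@subsetT _ O) (class_C_lt Cphi)) (CF i)).
have cdv x : O x -> {for x, continuous dv}.
  exact: (class_C_sum (k := 0) (index_enum 'I_3) (P := xpredT) oO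
    (fun i _ => (CphiF i).2 (e_ i))).
have [C1 C10 C1P] : exists2 C, 0 <= C & forall x, closure B x -> `|dv x| <= C.
  by apply: compact_bound => // x /BO; exact: cdv.
have cg x : O x -> U x -> {for x, continuous g}.
  move=> Ox Ux; have oW := openI oO oU.
  have CW i : class_C 0 (O `&` U) (fun z => F i z * 'D_(e_ i) psi z).
    apply: class_C_mul => //.
      by apply: (class_C_sub (O := O)); [exact: subIsetl|exact: class_C_lt].
    by apply: (class_C_sub (O := U)); [exact: subIsetr|exact: cDpsi].
  exact: (class_C_sum (k := 0) (index_enum 'I_3) (P := xpredT) oW
    (fun i _ => CW i) x (conj Ox Ux)).
pose K := closure B `&` Q.
have cK : compact K by apply: compact_closedI => //; exact: compact_closed.
have KU : K `<=` closure B `&` U by move=> x [? /QU].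
move=> e e0.
(* 36 = 4 * 9, where 9 bounds the derivative of step: the two terms of the
error, of order eta and eps, are then at most e / 4 each, and the means of
div G and of the mesh term account for the other two quarters *)
pose eta := e * M * c / 36.
have emc : 0 < e * M * c := mulr_gt0 (mulr_gt0 e0 M0) c0.
have eta0 : 0 < eta by rewrite divr_gt0.
have cgK x : K x -> {for x, continuous g} by move=> [/BO Ox /QU Ux]; exact: cg.
have gK x : K x -> bd B x -> g x = 0 by move=> [_ /QU Ux] bx; exact: Fn.
have [eps0 eps00 eps0P] := small_near_boundary eta0 cK KU oU cgK cpsi Bpsi gK.
pose eps := Num.min (eps0 / 2) (e * M * c / 4 / (C1 + 1)).
have eps_gt0 : 0 < eps.
  by rewrite lt_min divr_gt0//= !divr_gt0// ltr_wpDl.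
have epsle : 2 * eps <= eps0.
  by have : eps <= eps0 / 2 by [rewrite ge_min lexx]; lra.
have epsC : C1 * eps <= e * M * c / 4.
  have C11 : 0 < C1 + 1 by rewrite ltr_wpDl.
  apply: (@le_trans _ _ ((C1 + 1) * eps)); first by rewrite ler_wpM2r ?lerDl ?(ltW eps_gt0).
  by rewrite mulrC -ler_pdivlMr// ge_min lexx orbT.
pose w x := - eps^-1 * psi x + (- 1).
pose h x := step (w x).
pose S := [set x | [/\ B x, Q x & - (2 * eps) < psi x]].
have Cw : class_C 1 U w.
  exact: (class_C_add oU (class_C_scale (- eps^-1) oU Cpsi) (class_C_cst 1 U (- 1))).
have Ch : class_C 1 U h by apply: (class_C_comp oU (class_C_lt (@class_C_step R))).
pose G i x := h x * (phi x * F i x).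
have G0 i x : ~ Q x -> \forall z \near x, G i z = 0.
  by move=> /phi0; apply: filterS => z z0; rewrite /G z0 mul0r mulr0.
have CG i : class_C 1 B (G i).
  apply: class_C_local => x Bx; have [Qx|Qx] := pselect (Q x).
    exists (U `&` O); split; [exact: openI|by split; [exact: QU|exact/BO/clBB]|].
    apply: class_C_mul; first exact: openI.
      by apply: (class_C_sub (O := U)) => //; exact: subIsetl.
    by apply: (class_C_sub (O := O)) => //; exact: subIsetr.
  have : nbhs x [set z | G i z = 0] := G0 i _ Qx.
  rewrite nbhsE => -[W [oW Wx] W0]; exists W; split=> //.
  by apply: (class_C_ext oW _ (class_C_cst 1 W 0)) => z /W0.
have Gbd i z : bd B z -> \forall x \near z, G i x = 0.
  move=> bz; have [Qz|/G0//] := pselect (Q z).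
  have Uz := QU _ Qz.
  have pz : 0 <= psi z.
    by rewrite leNgt; apply/negP => /(Bpsi _ Uz).2; exact: bd_notin.
  have N1 : \forall x \near z, - eps < psi x.
    have := cpsi _ Uz => /(_ [set t | - eps < t]); apply.
    by apply: lt_nbhsr; lra.
  apply: filterS N1 => x px; rewrite /G /h step_le0 ?mul0r// /w.
  by rewrite mulNr -mulrN subr_le0 ler_pdivrMl// mulr1 lerNl ltW.
have NG : null_mean M (fun x => \1_B x * \sum_i 'D_(e_ i) (G i) x).
  apply: null_mean_ext (null_mean_sum (index_enum 'I_3)
    (fun i => null_mean_vanish M0 i oB BM (CG i) (Gbd i))) => x.
  by rewrite mulr_sumr.
have Dh i x : U x -> 'D_(e_ i) h x = 'D_(e_ i) psi x * (- eps^-1 * 'D_1 step (w x)).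
  move=> Ux; have [dw _] := Cw.
  rewrite [LHS](derive_comp_fun _ (dw _ Ux)); last exact: (@class_C_step R).1.
  by rewrite derive_affine; [rewrite mulrA; congr (_ * _); exact: mulrC|exact: dpsi].
(* div (phi F) - div G = (1 - h) div (phi F) - phi F . grad h, and both terms
are zero outside the layer S *)
have key x : `|\1_B x * dv x - \1_B x * \sum_i 'D_(e_ i) (G i) x|
    <= (C1 + 9 * eta / eps) * \1_S x.
  have [Bx|Bx] := pselect (B x); last first.
    rewrite ind0// !mul0r subrr normr0 mulr_ge0 ?ind_ge0//.
    by rewrite addr_ge0// divr_ge0// ?mulr_ge0// ltW.
  rewrite ind1// !mul1r; have [Qx|Qx] := pselect (Q x); last first.
    have -> : dv x = 0.
      rewrite /dv big1// => i _; rewrite (@near_eq_derive _ _ _ _ (fun=> 0)) ?derive_cst//.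
      by apply: filterS (phi0 _ Qx) => z ->; rewrite mul0r.
    rewrite big1 ?subr0 ?normr0; last first.
      by move=> i _; rewrite (@near_eq_derive _ _ _ _ (fun=> 0)) ?derive_cst//; exact: G0.
    rewrite mulr_ge0 ?ind_ge0// addr_ge0// divr_ge0// ?mulr_ge0// ltW//.
  have Ux := QU _ Qx.
  have -> : \sum_i 'D_(e_ i) (G i) x = h x * dv x + phi x * (- eps^-1 * 'D_1 step (w x)) * g x.
    rewrite /dv /g !mulr_sumr -big_split /=; apply: eq_bigr => i _.
    have dh : differentiable h x := Ch.1 _ Ux.
    have dF : differentiable (fun z => phi z * F i z) x := (CphiF i).1 _ (BO _ (clBB _ Bx)).
    rewrite derive_mul// Dh//; congr (_ + _).
    by move: ('D_(e_ i) psi x) ('D_1 step (w x)) => p q; ring.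
  have dvC := C1P _ (clBB _ Bx).
  have [/andP[h0 h1] /andP[p0 p1]] := (step_itv (w x), plateau_itv y r x).
  have [px|px] := lerP (psi x) (- (2 * eps)).
    have w1 : 1 <= w x.
      rewrite /w mulNr -mulrN lerBrDr -[1 + 1]/(2 : R) ler_pdivlMl//.
      by rewrite mulrC lerNr.
    rewrite /h step_ge1// derive_step_out; last by right.
    rewrite mul1r mulr0 mulr0 mul0r addr0 subrr normr0 mulr_ge0 ?ind_ge0//.
    by rewrite addr_ge0// divr_ge0// ?mulr_ge0// ltW.
  have Sx : S x by split.
  rewrite ind1// mulr1.
  have gx : `|g x| <= eta.
    apply: eps0P => //; first by split => //; exact: clBB.
    by rewrite (le_lt_trans _ px)// lerN2.
  have sx := derive_step_le (w x).
  rewrite -/(h x) in h0 h1; rewrite -/(phi x) in p0 p1.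
  move: (dv x) (h x) (phi x) (g x) ('D_1 step (w x)) dvC h0 h1 p0 p1 gx sx.
  move=> d hh p q s dC h0 h1 p0 p1 qe s9.
  rewrite (_ : _ - _ = (1 - hh) * d + p * (eps^-1 * s) * q); last by ring.
  rewrite (le_trans (ler_normD _ _))// lerD//.
    by rewrite normrM ger0_norm ?subr_ge0// -[C1]mul1r ler_pM// ?subr_ge0// gerBl.
  rewrite !normrM (ger0_norm p0) (ger0_norm (_ : 0 <= eps^-1)) ?invr_ge0 ?(ltW eps_gt0)//.
  rewrite [9 * eta / eps](_ : _ = 1 * (eps^-1 * 9) * eta); last by ring.
  have i0 : 0 <= eps^-1 by rewrite invr_ge0 ltW.
  by rewrite ler_pM// ?mulr_ge0// ler_pM// ?mulr_ge0// ler_wpM2l.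
(* the mean value theorem along the direction a: two points of S on the same
line are at distance at most 2 eps / c *)
have slab n : mean M n \1_S <= (2 * eps) / c / (2 * M) + n.+1%:R^-1.
  apply: (slab_mean M0 n (a := a) c0); first by rewrite mulr_ge0// ltW.
  move=> x s [Bx Qx px] [By Qy py] s0.
  have [->|s_neq0] := eqVneq s 0; first by rewrite mulr0 mulr_ge0// ltW.
  have s_gt0 : 0 < s by rewrite lt_neqAle eq_sym s_neq0.
  have Qt t : 0 <= t <= s -> Q (x + t *: e_ a).
    move=> /andP[t0 ts]; rewrite /Q/=; apply: norm_le_coord => [|i].
      by rewrite mulr_ge0// ltW.
    have := le_trans (coord_le_norm _ i) Qx; have := le_trans (coord_le_norm _ i) Qy.
    rewrite !mxE /=; case: (i == a); rewrite ?mulr1 ?mulr0 ?addr0//.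
    by rewrite !ler_norml; move: (x 0 i) (y 0 i) => p q; lra.
  have [t [ts E]] := MVT_line (x := x) (v := e_ a) s_gt0 (fun t ht => dpsi _ (QU _ (Qt _ ht))).
  have cD := (rP _ (Qt _ ts)).2.
  have pB : psi x < 0 by apply/Bpsi => //; exact: QU.
  have pB' : psi (x + s *: e_ a) < 0 by apply/Bpsi => //; exact: QU.
  have : `|psi (x + s *: e_ a) - psi x| <= 2 * eps by rewrite ler_norml; apply/andP; split; lra.
  rewrite E normrM (gtr0_norm s_gt0); apply: le_trans.
  by rewrite mulrC ler_wpM2l// ltW.
pose C2 := C1 + 9 * eta / eps.
have C20 : 0 <= C2 by rewrite addr_ge0// divr_ge0// ?mulr_ge0// ltW.
have e40 : 0 < e / 4 by rewrite divr_gt0.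
have main : C2 * ((2 * eps) / c / (2 * M)) <= e / 2.
  rewrite (_ : _ * _ = (C1 * eps + 9 * eta) / (c * M)); last first.
    by rewrite /C2; field; rewrite (gt_eqF c0) (gt_eqF M0) (gt_eqF eps_gt0).
  have E1 : 9 * eta = e * M * c / 4 by rewrite /eta; field.
  have E2 : e / 2 * (c * M) = e * M * c / 4 + e * M * c / 4 by field.
  rewrite ler_pdivrMr; last exact: mulr_gt0.
  by rewrite E2; apply: lerD => //; rewrite -E1.
have N3 : \forall n \near \oo, C2 * n.+1%:R^-1 <= e / 4.
  have : \forall n \near \oo, (C2 / (e / 4) : R) < n%:R by exact: nbhs_infty_gtr.
  apply: filterS => n; rewrite ltr_pdivrMr// => H.
  rewrite ler_pdivrMr// (le_trans (ltW H))// mulrC ler_wpM2l ?(ltW e40)//.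
  by rewrite ler_nat.
apply: filterS2 (NG _ e40) N3 => n NGn N3n.
have KM : `|mean M n (fun x => \1_B x * dv x - \1_B x * \sum_i 'D_(e_ i) (G i) x)|
    <= C2 * mean M n \1_S.
  by rewrite -mean_scale; apply: mean_norm_le => k; exact: key.
rewrite mean_sub in KM.
have sl := ler_wpM2l C20 (slab n); rewrite mulrDr in sl.
exact: (norm_le_sum KM NGn sl main N3n).
Qed.

End Local.

(** * The divergence theorem *)

(** The product of the functions 1 - plateau over a finite cover of K vanishes
near K and is 1 outside W; chi is its complement to 1. *)
Lemma cutoff (R : realType) (K W : set 'rV[R]_3) : compact K -> open W -> K `<=` W ->
  exists chi : 'rV[R]_3 -> R, [/\ class_C 2 setT chi,
    forall x, K x -> \forall z \near x, chi z = 1 &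
    forall x, ~ W x -> \forall z \near x, chi z = 0].
Proof.
move=> cK oW KW.
have /choice[r rP] : forall y, exists r : R, K y ->
    0 < r /\ forall x, `|x - y| <= 2 * r -> W x.
  move=> y; have [Ky|nKy] := pselect (K y); last by exists 0.
  have /nbhs_ballP[r /= r0 rP] := open_nbhs_nbhs (conj oW (KW _ Ky)).
  exists (r / 4) => _; split; first by rewrite divr_gt0.
  move=> x xy; apply: rP; rewrite -ball_normE /ball_/= distrC (le_lt_trans xy)//; lra.
have [|s [sK Ks]] := compact_seq_cover (N := fun y => [set x | plateau y (r y) x = 1]) cK.
  by move=> y /rP[r0 _]; exact: (plateau_near1 y r0).
(* psi = 1 - chi is built by induction on the sequence of centres *)
suff : exists psi : 'rV[R]_3 -> R, [/\ class_C 2 setT psi,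
    forall x y : 'rV[R]_3, y \in s -> (\forall z \near x, plateau y (r y) z = 1) ->
      \forall z \near x, psi z = 0 &
    forall x, ~ W x -> \forall z \near x, psi z = 1].
  move=> [psi [Cpsi psi1 psi0]].
  exists (fun x => 1 - psi x); split.
  - exact: (class_C_sub_fun openT (class_C_cst 2 setT 1) Cpsi).
  - by move=> x /Ks[y ys xy]; apply: filterS (psi1 x y ys xy) => z ->; rewrite subr0.
  - by move=> x /psi0; apply: filterS => z ->; rewrite subrr.
elim: s sK {Ks} => [|y s IH] sK.
  exists (fun=> 1); split=> //; first exact: class_C_cst.
  by move=> x _; near=> z.
have [|psi [Cpsi psi1 psi0]] := IH; first by move=> z zs; apply: sK; rewrite inE zs orbT.
exists (fun x => (1 - plateau y (r y) x) * psi x); split.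
- apply: class_C_mul openT _ Cpsi.
  exact: (class_C_sub_fun openT (class_C_cst 2 setT 1) (@class_C_plateau R y (r y))).
- move=> x z; rewrite inE => /predU1P[->|zs] xz.
    by apply: filterS xz => t ->; rewrite subrr mul0r.
  by apply: filterS (psi1 x z zs xz) => t ->; rewrite mulr0.
- move=> x Wx; have [ry yP] := rP _ (sK y (mem_head _ _)).
  have : \forall z \near x, plateau y (r y) z = 0.
    by apply: plateau_out => //; rewrite ltNge; apply/negP => /yP.
  by apply: filterS2 (psi0 _ Wx) => z -> ->; rewrite subr0 mulr1.
Unshelve. all: by end_near. Qed.

Section Divergence.
Context {R : realType} (M : R) (M0 : 0 < M).
Local Notation V := 'rV[R]_3.
Local Notation e_ a := (Defs.basis R a).
Implicit Types (f g : V -> R) (a : 'I_3).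
Variables (B : set V) (n : 'I_3 -> V -> R).
Hypotheses (oB : open B) (BM : forall x, B x -> `|x| < M) (cB : compact (closure B)).
Hypothesis Bsmooth : forall x, bd B x -> exists U psi, U x /\ local_defining_function B U psi.
Hypothesis nP : forall U psi x, local_defining_function B U psi -> bd B x -> U x ->
     forall i, n i x = 'D_(e_ i) psi x /
                       Num.sqrt (\sum_(j < 3) 'D_(e_ j) psi x ^+ 2).

Lemma compact_bd : compact (bd B).
Proof.
apply: (@subclosed_compact _ _ (closure B)) => //; last by move=> x [].
apply: closedI; first exact: closed_closure.
by apply: open_closedC; exact: open_interior.
Qed.

(** Cover the boundary by finitely many functions phi_y given by
[local_null_divergence]. Writing F = phi_y F + (1 - phi_y) F, the first part
has null mean divergence and the second is still tangential, but vanishes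
wherever phi_y = 1; after all the phi_y have been used, the remaining field
vanishes near the whole boundary. *)
Theorem null_mean_divergence (O : set V) (F : 'I_3 -> V -> R) :
  open O -> closure B `<=` O -> (forall i, class_C 1 O (F i)) ->
  (forall x, bd B x -> \sum_i F i x * n i x = 0) ->
  null_mean M (fun x => \1_B x * \sum_i 'D_(e_ i) (F i) x).
Proof.
move=> oO BO.
have OB x : B x -> O x by move=> Bx; apply: BO; exact: subset_closure.
pose tangent (F : 'I_3 -> V -> R) := forall x, bd B x -> \sum_i F i x * n i x = 0.
have /choice[phi phiP] : forall y, exists phi : V -> R, bd B y ->
  [/\ class_C 2 setT phi, \forall x \near y, phi x = 1 &
    forall F, (forall i, class_C 1 O (F i)) -> tangent F ->
    null_mean M (fun x => \1_B x * \sum_i 'D_(e_ i) (fun z => phi z * F i z) x)].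
  move=> y; have [by_|] := pselect (bd B y); last by exists (fun=> 0).
  have [U [psi [Uy H]]] := Bsmooth by_; have [oU Cpsi psi0 Bpsi] := H.
  have [a Da] := psi0 _ Uy.
  have [phi [phi1 phi2 phi3]] := local_null_divergence M0 oB BM cB oU Uy (Cpsi 1) Bpsi Da.
  exists phi => _; split=> // G CG tG; apply: (phi3 O G oO BO CG) => x bx Ux.
  have := tG _ bx; under eq_bigr => i _ do rewrite (nP H bx Ux) mulrA.
  rewrite -mulr_suml => /eqP; rewrite mulf_eq0 => /orP[/eqP//|].
  (* the normalizing factor of n is invertible, as grad psi does not vanish *)
  rewrite invr_eq0 sqrtr_eq0 => N0; exfalso.
  have [i /negP] := psi0 _ Ux; apply; rewrite -sqrf_eq0.
  have := psumr_eq0P (fun j _ => sqr_ge0 ('D_(e_ j) psi x)) => /(_ xpredT) H0.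
  rewrite H0//; apply/eqP; rewrite eq_le N0/=.
  by apply: sumr_ge0 => j _; exact: sqr_ge0.
move=> CF tF.
have [|s [sb bs]] := compact_seq_cover (N := fun y => [set x | phi y x = 1]) compact_bd.
  by move=> y /phiP[].
(* the induction hypothesis: every boundary point is covered by a remaining
phi_y, or F is already zero near it *)
have {}bs x : bd B x -> (exists2 y, y \in s & \forall z \near x, phi y z = 1) \/
    (\forall z \near x, forall i, F i z = 0).
  by move=> /bs[y ys xy]; left; exists y.
elim: s F CF tF sb bs => [|y s IH] F CF tF sb bs.
  have F0 x : bd B x -> \forall z \near x, forall i, F i z = 0.
    by move=> /bs[[y]|].
  have Fi0 i z : bd B z -> \forall x \near z, F i x = 0.
    by move=> bz; apply: filterS (F0 _ bz) => x.
  apply: null_mean_ext (null_mean_sum (index_enum 'I_3) (fun i =>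
    null_mean_vanish M0 i oB BM (class_C_sub OB (CF i)) (Fi0 i))) => x.
  by rewrite mulr_sumr.
have [Cphi phi1 phiN] := phiP _ (sb y (mem_head _ _)).
pose G i x := (1 - phi y x) * F i x.
have CphiO : class_C 1 O (phi y) by exact: (class_C_sub (@subsetT _ O) (class_C_lt Cphi)).
have C1phi : class_C 1 O (fun x => 1 - phi y x).
  exact: (class_C_sub_fun oO (class_C_cst 1 O 1) CphiO).
have CG i : class_C 1 O (G i) by exact: (class_C_mul oO C1phi (CF i)).
have NG : null_mean M (fun x => \1_B x * \sum_i 'D_(e_ i) (G i) x).
  apply: IH => //.
  - move=> x bx; rewrite /G; under eq_bigr => i _ do rewrite -mulrA.
    by rewrite -mulr_sumr tF// mulr0.
  - by move=> z zs; apply: sb; rewrite inE zs orbT.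
  - move=> x /bs[[z]|xF]; last first.
      by right; apply: filterS xF => z zF i; rewrite /G zF mulr0.
    rewrite inE => /predU1P[->|zs] xz; last by left; exists z.
    by right; apply: filterS xz => t t1 i; rewrite /G t1 subrr mul0r.
apply: null_mean_ext (null_meanD NG (phiN F CF tF)) => x.
rewrite -mulrDr -big_split/=; have [Bx|Bx] := pselect (B x); last by rewrite ind0// !mul0r.
congr (_ * _); apply: eq_bigr => i _.
have dG := (CG i).1 _ (OB _ Bx); have dpF := (class_C_mul oO CphiO (CF i)).1 _ (OB _ Bx).
rewrite -[LHS]deriveD; [|exact: diff_derivable|exact: diff_derivable].
by congr ('D_(e_ i) _ x); apply/funext => z; rewrite /G fctE -mulrDl subrK mul1r.
Qed.

End Divergence.

(** * The surface divergence as a normal component *)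

Section PointwiseAlgebra.
Context {R : realType}.
Implicit Types (n Z dw : 'I_3 -> R) (dn dZ : 'I_3 -> 'I_3 -> R) (w : R).

Lemma sum_delta (j : 'I_3) (a f : 'I_3 -> R) :
  \sum_i ((j == i)%:R - a i) * f i = f j - \sum_i a i * f i.
Proof.
under eq_bigr => i _ do rewrite mulrBl.
rewrite sumrB; congr (_ - _); rewrite (bigD1 j)//= eqxx mul1r big1 ?addr0// => i ij.
by rewrite eq_sym (negbTE ij) mul0r.
Qed.

(** The left-hand side is n . C for C_j = d_k (r (n_j Y_k - n_k Y_j)) at a
point where r = 1, |n| = 1 and d_k r = - n_i d_k n_i; the right-hand side is
D_j Y_j - (D_l n_l) (Y . n), the surface divergence of the tangential part of
Y. Here dn k j stands for d_k n_j and dY i j for d_i Y_j, the matrix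
(j == i) - n_j n_i being the tangential projection. The difference of the two
sides has the factor |n|^2 - 1. *)
Lemma normal_curl n dn Y dY : \sum_i n i ^+ 2 = 1 ->
  \sum_j n j * (\sum_k (- (\sum_i n i * dn k i) * (n j * Y k - n k * Y j)
     + (dn k j * Y k + n j * dY k k - (dn k k * Y j + n k * dY k j))))
  = \sum_j \sum_i ((j == i)%:R - n j * n i) * dY i j
    - (\sum_l \sum_i ((l == i)%:R - n l * n i) * dn i l) * \sum_k Y k * n k.
Proof.
move=> n1; under [X in _ = X - _]eq_bigr => j _ do rewrite sum_delta.
under [X in _ = _ - X * _]eq_bigr => j _ do rewrite sum_delta.
apply/eqP; rewrite -subr_eq0; apply/eqP.
transitivity ((\sum_i n i ^+ 2 - 1) *
    (\sum_k dY k k - \sum_k (\sum_i n i * dn k i) * Y k)).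
  by rewrite !big_ord_recl !big_ord0 /=; ring.
by rewrite n1 subrr mul0r.
Qed.

End PointwiseAlgebra.

Section GreenAlgebra.
Context {R : realType}.
Implicit Types (n s dw : 'I_3 -> R) (dn m : 'I_3 -> 'I_3 -> R) (w : R).

(** If the surface operators of the theory do no work on w, then the flux
F_j = s_j w + m_jk w_,k has the same normal component as the divergence-free
field of [normal_curl] for Y = w Z, with Z_j = m_kj n_k: split grad w into its
normal part, which pairs with m_kj n_k n_j, and its tangential part, for which
Z . grad w is D_j (w Z_j) - w D_j Z_j. Here dmn i k j stands for
d_i (m_kj n_k) and dw i for d_i w. *)
Lemma green_boundary n s dw dn m (dmn : 'I_3 -> 'I_3 -> 'I_3 -> R) w :
  \sum_i n i ^+ 2 = 1 ->
  (\sum_j s j * n j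
   - \sum_j \sum_k \sum_i ((j == i)%:R - n j * n i) * dmn i k j
   + (\sum_l \sum_i ((l == i)%:R - n l * n i) * dn i l) *
       \sum_k \sum_j m k j * n k * n j) * w
   + (\sum_k \sum_j m k j * n k * n j) * (\sum_i n i * dw i) = 0 ->
  let Z j := \sum_k m k j * n k in
  let dY i j := w * (\sum_k dmn i k j) + Z j * dw i in
  \sum_j (s j * w + \sum_k m j k * dw k) * n j =
  \sum_j n j * (\sum_k (- (\sum_i n i * dn k i) * (n j * (w * Z k) - n k * (w * Z j))
     + (dn k j * (w * Z k) + n j * dY k k - (dn k k * (w * Z j) + n k * dY k j)))).
Proof.
move=> n1 BC Z dY; rewrite (normal_curl dn (fun k => w * Z k) dY n1).
set K := \sum_l \sum_i ((l == i)%:R - n l * n i) * dn i l in BC *.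
have ZE : \sum_k \sum_j m k j * n k * n j = \sum_j Z j * n j.
  by rewrite exchange_big/=; apply: eq_bigr => j _; rewrite mulr_suml.
rewrite ZE in BC.
have sE : \sum_j \sum_k \sum_i ((j == i)%:R - n j * n i) * dmn i k j =
          \sum_j \sum_i ((j == i)%:R - n j * n i) * (\sum_k dmn i k j).
  by apply: eq_bigr => j _; rewrite exchange_big/=; apply: eq_bigr => i _; rewrite mulr_sumr.
rewrite {}sE in BC.
have lE : \sum_j (s j * w + \sum_k m j k * dw k) * n j =
          (\sum_j s j * n j) * w + \sum_k Z k * dw k.
  under eq_bigr => j _ do rewrite mulrDl.
  rewrite big_split/= mulr_suml; congr (_ + _).
    by apply: eq_bigr => j _; rewrite mulrAC.
  under eq_bigr => j _ do rewrite mulr_suml.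
  rewrite exchange_big/=; apply: eq_bigr => k _; rewrite mulr_suml.
  by apply: eq_bigr => j _; rewrite mulrAC.
have dE : \sum_j \sum_i ((j == i)%:R - n j * n i) * dY i j =
   w * (\sum_j \sum_i ((j == i)%:R - n j * n i) * (\sum_k dmn i k j))
   + (\sum_k Z k * dw k - (\sum_j Z j * n j) * (\sum_i n i * dw i)).
  rewrite [w * _]mulr_sumr [(\sum_j Z j * n j) * _]mulr_suml -sumrB -big_split/=.
  apply: eq_bigr => j _.
  have S : \sum_i n j * n i * dY i j =
      w * (\sum_i n j * n i * \sum_k dmn i k j) + Z j * n j * (\sum_i n i * dw i).
    rewrite [w * _]mulr_sumr [Z j * n j * _]mulr_sumr -big_split/=.
    by apply: eq_bigr => i _; rewrite /dY; move: (Z j) (\sum_(k < 3) _) => z d; ring.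
  rewrite !sum_delta S /dY; move: (Z j) (\sum_k dmn j k j) => z d.
  by move: (\sum_(i < 3) n j * n i * _) (\sum_(i < 3) n i * dw i) => a b; ring.
rewrite lE dE; under [X in _ - K * X]eq_bigr => k _ do rewrite -mulrA.
rewrite -mulr_sumr.
move: (\sum_j \sum_i _ * _) (\sum_k Z k * dw k) (\sum_j Z j * n j) BC => X1 X2 X3 BC.
apply/eqP; rewrite -subr_eq0 -[X in _ == X]BC; apply/eqP; ring.
Qed.

End GreenAlgebra.

(** * Integration by parts for second-gradient stresses *)

Lemma green_expand (R : realType) (dS S dw : 'I_3 -> R) (ddm dm m ddw : 'I_3 -> 'I_3 -> R)
    (w : R) : (forall j k, ddw j k = ddw k j) ->
  \sum_j ((dS j - \sum_k ddm j k) * w + (S j - \sum_k dm k j) * dw j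
     + (\sum_k dm j k * dw k + \sum_k m j k * ddw j k))
  = (\sum_j dS j - \sum_k \sum_j ddm j k) * w + \sum_j S j * dw j
    + \sum_k \sum_j m k j * ddw j k.
Proof.
move=> sym; rewrite !big_split/= -mulr_suml sumrB -!addrA.
rewrite [in RHS](exchange_big_dep xpredT)//=; congr (_ + _).
under eq_bigr => j _ do rewrite mulrBl.
rewrite sumrB -!addrA; congr (_ + _).
rewrite addrA [X in X + _ = _](_ : _ = 0) ?add0r.
  by apply: eq_bigr => k _; apply: eq_bigr => j _; rewrite sym.
rewrite addrC; apply/eqP; rewrite subr_eq0; apply/eqP.
by rewrite exchange_big/=; apply: eq_bigr => k _; rewrite mulr_suml.
Qed.

Section Green.
Context {R : realType} (M : R) (M0 : 0 < M).
Local Notation V := 'rV[R]_3.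
Local Notation e_ a := (Defs.basis R a).
Implicit Types (f g : V -> R) (a : 'I_3).
Variables (B : set V) (n : 'I_3 -> V -> R).
Hypotheses (oB : open B) (BM : forall x, B x -> `|x| < M) (cB : compact (closure B)).
Hypothesis Bsmooth : forall x, bd B x -> exists U psi, U x /\ local_defining_function B U psi.
Hypothesis nP : outward_unit_normal B n.

Lemma normal_unit x : bd B x -> \sum_i n i x ^+ 2 = 1.
Proof.
move=> bx; have [U [psi [Ux H]]] := Bsmooth bx; have [_ _ psi0 _] := H.
under eq_bigr => i _ do rewrite (nP.2 _ _ _ H bx Ux) expr_div_n.
set N := \sum_(j < 3) 'D_(e_ j) psi x ^+ 2.
rewrite -mulr_suml sqr_sqrtr; last by apply: sumr_ge0 => *; exact: sqr_ge0.
rewrite mulfV//; have [i Di] := psi0 _ Ux; rewrite gt_eqF//.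
rewrite (bigD1 i)//= ltr_pwDl ?sumr_ge0// => [|*]; last exact: sqr_ge0.
by rewrite lt_neqAle eq_sym sqr_ge0 sqrf_eq0 Di.
Qed.

(** The divergence theorem for F - C, where F_j = s_j w + m_jk w_,k with
s_j = S_j - m_kj,k, and C is the divergence-free field of [normal_curl]. The
boundary condition says that F - C is tangential ([green_boundary]), and the
divergence of F is the integrand. *)
Theorem null_mean_green (O : set V) (S : 'I_3 -> V -> R) (m : 'I_3 -> 'I_3 -> V -> R)
    (w : V -> R) :
  open O -> closure B `<=` O ->
  (forall j, class_C 1 O (S j)) -> (forall k j, class_C 2 O (m k j)) -> class_C 2 O w ->
  (forall x, bd B x ->
    (\sum_j (S j x - \sum_k 'D_(e_ k) (m k j) x) * n j x
     - \sum_j \sum_k \sum_i ((j == i)%:R - n j x * n i x)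
         * 'D_(e_ i) (fun y => m k j y * n k y) x
     + (\sum_l \sum_i ((l == i)%:R - n l x * n i x) * 'D_(e_ i) (n l) x) *
         \sum_k \sum_j m k j x * n k x * n j x) * w x
     + (\sum_k \sum_j m k j x * n k x * n j x) * (\sum_i n i x * 'D_(e_ i) w x) = 0) ->
  null_mean M (fun x => \1_B x *
    ((\sum_j 'D_(e_ j) (S j) x - \sum_k \sum_j 'D_(e_ j) ('D_(e_ k) (m k j)) x) * w x
     + \sum_j S j x * 'D_(e_ j) w x
     + \sum_k \sum_j m k j x * 'D_(e_ j) ('D_(e_ k) w) x)).
Proof.
move=> oO BO CS Cm Cw BC.
have OB x : B x -> O x by move=> Bx; apply: BO; exact: subset_closure.
have [[N [oN bN Cn]] nP2] := nP.
have {}Cn i : class_C 2 N (n i) := Cn i 2.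
(* n only exists near the boundary; the cutoff extends the potential A of C
to all of O without changing it near the boundary *)
have [chi [Cchi chi1 chi0]] := cutoff (compact_bd cB) oN bN.
have oON : open (O `&` N) by exact: openI.
have cON k f : class_C k O f -> class_C k (O `&` N) f by apply: class_C_sub; exact: subIsetl.
have cNO k f : class_C k N f -> class_C k (O `&` N) f by apply: class_C_sub; exact: subIsetr.
pose Z k x := \sum_l m l k x * n l x.
pose Y k x := w x * Z k x.
(* r is 1 / |n| to the first order in |n|^2 - 1: the extension of n has norm 1
on the boundary only, and r removes the normal derivative of |n| *)
pose r x := 2^-1 * (3 - \sum_i n i x * n i x).
pose a j k x := r x * (n j x * Y k x - n k x * Y j x).
pose A j k x := chi x * a j k x.
have CZ k : class_C 2 (O `&` N) (Z k).
  apply: class_C_sum => // l _; exact: (class_C_mul oON (cON _ _ (Cm l k)) (cNO _ _ (Cn l))).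
have CY k : class_C 2 (O `&` N) (Y k) by exact: (class_C_mul oON (cON _ _ Cw) (CZ k)).
have Cr : class_C 2 (O `&` N) r.
  apply: (class_C_scale _ oON); apply: (class_C_sub_fun oON (class_C_cst 2 _ 3)).
  apply: class_C_sum => // i _.
  exact: (class_C_mul oON (cNO _ _ (Cn i)) (cNO _ _ (Cn i))).
have Cb j k : class_C 2 (O `&` N) (fun x => n j x * Y k x - n k x * Y j x).
  apply: (class_C_sub_fun oON); first exact: (class_C_mul oON (cNO _ _ (Cn j)) (CY k)).
  exact: (class_C_mul oON (cNO _ _ (Cn k)) (CY j)).
have Ca j k : class_C 2 (O `&` N) (a j k) by exact: (class_C_mul oON Cr (Cb j k)).
have CA j k : class_C 2 O (A j k).
  apply: class_C_local => x Ox; have [Nx|Nx] := pselect (N x).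
    exists (O `&` N); split; [exact: oON|by split|].
    exact: (class_C_mul oON (class_C_sub (@subsetT _ _) Cchi) (Ca j k)).
  have : nbhs x [set z | chi z = 0] := chi0 _ Nx.
  rewrite nbhsE => -[W [oW Wx] W0]; exists W; split; [exact: oW|exact: Wx|].
  by apply: (class_C_ext oW _ (class_C_cst 2 W 0)) => z /W0 z0; rewrite /A z0 mul0r.
pose s j x := S j x - \sum_k 'D_(e_ k) (m k j) x.
have Cs j : class_C 1 O (s j).
  apply: (class_C_sub_fun oO (CS j)); apply: class_C_sum => // k _; exact: (Cm k j).2.
pose F j x := s j x * w x + \sum_k m j k x * 'D_(e_ k) w x.
have CmD j k : class_C 1 O (fun x => m j k x * 'D_(e_ k) w x).
  exact: (class_C_mul oO (class_C_lt (Cm j k)) (Cw.2 (e_ k))).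
have CF j : class_C 1 O (F j).
  apply: (class_C_add oO (class_C_mul oO (Cs j) (class_C_lt Cw))).
  by apply: class_C_sum => // k _; exact: CmD.
pose C j x := \sum_k 'D_(e_ k) (A j k) x.
have CC j : class_C 1 O (C j).
  by apply: class_C_sum => // k _; exact: (CA j k).2.
have tangent x : bd B x -> \sum_j (F j x - C j x) * n j x = 0.
  move=> bx; have ONx : (O `&` N) x by split; [exact: BO bx.1|exact: bN].
  have n1 := normal_unit bx.
  have dn j : differentiable (n j) x := (Cn j).1 _ ONx.2.
  have dm k j : differentiable (m k j) x := (Cm k j).1 _ ONx.1.
  have dw : differentiable w x := Cw.1 _ ONx.1.
  have dZ k : differentiable (Z k) x := (CZ k).1 _ ONx.
  have dY k : differentiable (Y k) x := (CY k).1 _ ONx.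
  have dr : differentiable r x := Cr.1 _ ONx.
  have db j k : differentiable (fun x => n j x * Y k x - n k x * Y j x) x.
    exact: (Cb j k).1 _ ONx.
  have DZ i k : 'D_(e_ i) (Z k) x = \sum_l 'D_(e_ i) (fun y => m l k y * n l y) x.
    by apply: (derive_sumf _ _ _).2 => l; exact: differentiableM.
  have DY i k : 'D_(e_ i) (Y k) x = w x * (\sum_l 'D_(e_ i) (fun y => m l k y * n l y) x)
      + Z k x * 'D_(e_ i) w x by rewrite derive_mul// DZ.
  have r1 : r x = 1.
    by rewrite /r -[\sum_i _](eq_bigr _ (fun i _ => expr2 (n i x))) n1; lra.
  have Dr k : 'D_(e_ k) r x = - \sum_i n i x * 'D_(e_ k) (n i) x.
    have [d1 D1] := derive_sumf (index_enum 'I_3) (F := fun i y => n i y * n i y) (e_ k)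
       (fun i => differentiableM (dn i) (dn i)).
    rewrite /r derive_scale; last by apply: differentiableB.
    rewrite derive_sub// derive_cst sub0r D1 mulrN mulr_sumr; congr (- _).
    apply: eq_bigr => i _; rewrite derive_mul//.
    by move: (n i x) ('D_(e_ k) (n i) x) => p q; lra.
  have DA j k : 'D_(e_ k) (A j k) x =
     - (\sum_i n i x * 'D_(e_ k) (n i) x) * (n j x * (w x * Z k x) - n k x * (w x * Z j x))
     + ('D_(e_ k) (n j) x * (w x * Z k x) + n j x * 'D_(e_ k) (Y k) x
        - ('D_(e_ k) (n k) x * (w x * Z j x) + n k x * 'D_(e_ k) (Y j) x)).
    have -> : 'D_(e_ k) (A j k) x = 'D_(e_ k) (a j k) x.
      by apply: near_eq_derive; apply: filterS (chi1 _ bx) => z z1; rewrite /A z1 mul1r.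
    rewrite /a derive_mul// r1 Dr derive_sub; [|exact: differentiableM|exact: differentiableM].
    rewrite !derive_mul// /Y.
    by move: ('D_(e_ k) _ x) ('D_(e_ k) _ x) ('D_(e_ k) _ x) ('D_(e_ k) _ x) => p1 p2 p3 p4; ring.
  have G := green_boundary n1 (BC _ bx).
  under eq_bigr => j _ do rewrite mulrBl.
  rewrite sumrB; apply/eqP; rewrite subr_eq0; apply/eqP.
  rewrite [LHS]G; apply: eq_bigr => j _; rewrite mulrC; congr (_ * _).
  by apply: eq_bigr => k _; rewrite DA !DY.
(* C is a divergence of the antisymmetric field A *)
have divC x : B x -> \sum_j 'D_(e_ j) (C j) x = 0.
  move=> /OB Ox.
  have -> : \sum_j 'D_(e_ j) (C j) x = \sum_j \sum_k 'D_(e_ j) ('D_(e_ k) (A j k)) x.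
    apply: eq_bigr => j _; apply: (derive_sumf _ _ _).2 => k.
    exact: ((CA j k).2 (e_ k)).1.
  set X := \sum_j _; suff : X = - X by lra.
  rewrite {2}/X exchange_big/= -sumrN; apply: eq_bigr => j _.
  rewrite -sumrN; apply: eq_bigr => k _.
  rewrite [in RHS](schwarz (e_ k) (e_ j) oO (CA k j) Ox).
  have E : A j k =1 (fun y => - A k j y) by move=> y; rewrite /A /a; move: (n j y * _) (n k y * _) => p q; ring.
  rewrite (funext E).
  have E2 : \forall y \near x, 'D_(e_ k) (fun y => - A k j y) y = - 'D_(e_ k) (A k j) y.
    apply: (open_near oO Ox) => y Oy; rewrite deriveN//; apply: diff_derivable.
    exact: (CA k j).1.
  rewrite (near_eq_derive _ E2) deriveN//; apply: diff_derivable.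
  exact: ((CA k j).2 (e_ k)).1.
have Nul := null_mean_divergence M0 oB BM cB Bsmooth nP2 oO BO
  (fun j => class_C_sub_fun oO (CF j) (CC j)) tangent.
apply: null_mean_ext Nul => x; have [Bx|Bx] := pselect (B x); last by rewrite ind0// !mul0r.
congr (_ * _); have Ox := OB _ Bx.
under eq_bigr => j _ do rewrite (derive_sub _ ((CF j).1 _ Ox) ((CC j).1 _ Ox)).
rewrite sumrB divC// subr0.
have dw : differentiable w x := Cw.1 _ Ox.
have DF j : 'D_(e_ j) (F j) x = 'D_(e_ j) (s j) x * w x + s j x * 'D_(e_ j) w x +
   (\sum_k 'D_(e_ j) (m j k) x * 'D_(e_ k) w x + \sum_k m j k x * 'D_(e_ j) ('D_(e_ k) w) x).
  have ds : differentiable (s j) x := (Cs j).1 _ Ox.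
  have [d1 D1] := derive_sumf (index_enum 'I_3) (F := fun k y => m j k y * 'D_(e_ k) w y) (e_ j)
       (fun k => (CmD j k).1 _ Ox).
  rewrite /F derive_add//; last exact: differentiableM.
  rewrite derive_mul// D1; congr (_ + _); first by rewrite addrC [w x * _]mulrC.
  rewrite -big_split/=; apply: eq_bigr => k _; rewrite derive_mul.
  - by rewrite addrC; congr (_ + _); exact: mulrC.
  - exact: (Cm j k).1.
  - exact: (Cw.2 (e_ k)).1.
have Ds j : 'D_(e_ j) (s j) x = 'D_(e_ j) (S j) x - \sum_k 'D_(e_ j) ('D_(e_ k) (m k j)) x.
  have [d1 D1] := derive_sumf (index_enum 'I_3) (F := fun k y => 'D_(e_ k) (m k j) y) (e_ j)
       (fun k => ((Cm k j).2 (e_ k)).1 _ Ox).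
  by rewrite /s derive_sub// ?D1//; exact: (CS j).1.
have ddw j k : 'D_(e_ j) ('D_(e_ k) w) x = 'D_(e_ k) ('D_(e_ j) w) x.
  exact: (schwarz (e_ j) (e_ k) oO Cw Ox).
under eq_bigr => j _ do rewrite DF Ds.
exact: (green_expand (fun j => 'D_(e_ j) (S j) x) (fun j => S j x)
  (fun j => 'D_(e_ j) w x) (fun j k => 'D_(e_ j) ('D_(e_ k) (m k j)) x)
  (fun k j => 'D_(e_ k) (m k j) x) (fun k j => m k j x) (w x) ddw).
Qed.

End Green.

(** * Positivity, and uniformity in time, of null means *)

Lemma sub1_le_sum (R : realType) (x p a b : R) :
  x < p + 1 -> 0 <= a -> 0 <= b -> x - 1 <= a + (p + b).
Proof. lra. Qed.

Lemma norm_le_split (R : realType) (p q e : R) :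
  `|p - q| <= e / 2 -> `|q| <= e / 2 -> `|p| <= e.
Proof.
by have := ler_normD (p - q) q; rewrite subrK; move: `|p| `|p - q| `|q| => a b c; lra.
Qed.

Section Positive.
Context {R : realType} (M : R) (M0 : 0 < M).
Local Notation V := 'rV[R]_3.
Implicit Types (f g : V -> R) (n : nat).

(** Between s and s + r, the multiples of h = mesh start at the index after the
integer part of s / h, and there are at least as many of them as the integer
part of r / h. *)
Lemma count_interval n (s r : R) : 0 <= s -> 0 < r -> s + r < 2 * M ->
  r / mesh M n - 1 <=
  \sum_(j < n.+1) ((s < mesh M n * j%:R) && (mesh M n * j%:R <= s + r))%:R.
Proof.
move=> s0 r0 sr; have h0 := mesh_gt0 M0 n; set h := mesh M n in h0 *.
pose j0 := (Num.truncn (s / h)).+1; pose p := Num.truncn (r / h).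
have sh : 0 <= s / h by rewrite divr_ge0// ltW.
have rh : 0 <= r / h by rewrite divr_ge0// ltW.
have /andP[js1 js2] := truncn_itv sh; have /andP[pr1 pr2] := truncn_itv rh.
have inI j : (j0 <= j < j0 + p)%N -> s < h * j%:R /\ h * j%:R <= s + r.
  move=> /andP[j1 j2]; split.
    rewrite mulrC -ltr_pdivrMr// (lt_le_trans js2)// ler_nat//.
  have : h * j%:R <= h * ((Num.truncn (s / h))%:R + p%:R).
    rewrite ler_wpM2l ?(ltW h0)// -natrD ler_nat.
    by move: j2; rewrite /j0 addSn ltnS.
  move=> /le_trans; apply; rewrite mulrDr lerD//.
    by rewrite mulrC -ler_pdivlMr.
  by rewrite mulrC -ler_pdivlMr.
have jn j : (j0 <= j < j0 + p)%N -> (j < n.+1)%N.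
  move=> /inI[_ jr]; rewrite -(ltr_nat R) -(ltr_pM2l h0) (le_lt_trans jr)//.
  by rewrite /h /mesh divfK.
have [p0|p0] := posnP p.
  apply: (@le_trans _ _ 0); last by apply: sumr_ge0.
  by rewrite lerBlDr add0r; move: pr2; rewrite -/p p0 => /ltW.
have jpn : (j0 + p <= n.+1)%N.
  have H : (j0 <= (j0 + p).-1 < j0 + p)%N by move: p0; clear; move: j0 p => a b; lia.
  by have := jn _ H; move: p0; clear; move: j0 p => a b; lia.
pose F (j : nat) : R := ((s < h * j%:R) && (h * j%:R <= s + r))%:R.
rewrite -(big_mkord xpredT F) (@big_cat_nat _ _ _ j0)//=; last by apply: leq_trans jpn; exact: leq_addr.
rewrite (@big_cat_nat _ _ _ (j0 + p) j0 n.+1)//= ?leq_addr//.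
have -> : \sum_(j0 <= j < j0 + p) F j = p%:R.
  rewrite (eq_big_nat _ _ (F2 := fun=> 1)).
    by rewrite sumr_const_nat addKn.
  by move=> j /inI[a b]; rewrite /F a b.
have A1 : 0 <= \sum_(0 <= j < j0) F j by apply: sumr_ge0 => j _; exact: ler0n.
have A2 : 0 <= \sum_(j0 + p <= j < n.+1) F j by apply: sumr_ge0 => j _; exact: ler0n.
by rewrite -natr1 in pr2; exact: sub1_le_sum pr2 A1 A2.
Qed.

(** Distributivity, the grid being a product of three one-dimensional grids. *)
Lemma mean_box n (b : 'I_3 -> R -> bool) :
  mean M n (fun x => \prod_i (b i (x 0 i))%:R) =
  \prod_i (n.+1%:R^-1 * \sum_(j < n.+1) (b i (- M + mesh M n * j%:R))%:R).
Proof.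
rewrite big_split/= prodr_const card_ord exprVn; congr (_ * _).
rewrite bigA_distr_bigA/=; apply: eq_bigr => k _; apply: eq_bigr => i _.
by rewrite mxE.
Qed.

(** If f x > 0, then f is at least c = f x / 2 on a cube of side r with a vertex
at x. On a fine grid, the cube contains at least the fraction k^3 of the grid
points, with k = r / (4 M), half of the ratio of the sides of the cube and of
the box; the mean is thus at least c k^3. *)
Theorem null_mean_nonneg (B : set V) f : open B -> (forall x, B x -> `|x| < M) ->
  (forall x, B x -> {for x, continuous f}) -> (forall x, B x -> 0 <= f x) ->
  null_mean M (fun x => \1_B x * f x) -> forall x, B x -> f x = 0.
Proof.
move=> oB BM cf f0 Nf x Bx; apply/eqP; rewrite eq_le f0// andbT leNgt; apply/negP => fx.
pose c := f x / 2; have c0 : 0 < c by rewrite divr_gt0.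
have /nbhs_ballP[r0 /= r00 rP] : \forall y \near x, B y /\ c < f y.
  apply: filterI; first exact: (open_nbhs_nbhs (conj oB Bx)).
  have := cf _ Bx => /(_ [set t | c < t]); apply; apply: lt_nbhsr; rewrite /c; lra.
have xM := BM _ Bx.
pose r := Num.min (r0 / 2) ((M - `|x|) / 2).
have r_gt0 : 0 < r by rewrite lt_min !divr_gt0// subr_gt0.
have rr0 : r < r0.
  by have : r <= r0 / 2 by [rewrite ge_min lexx]; lra.
have rM : r < M - `|x|.
  by have : r <= (M - `|x|) / 2 by [rewrite ge_min lexx orbT]; lra.
pose b i t := (x 0 i < t) && (t <= x 0 i + r).
have fb (y : V) : c * \prod_i (b i (y 0 i))%:R <= \1_B y * f y.
  have [/forallP H|/forallPn[i /negbTE bi]] := boolP [forall i, b i (y 0 i)].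
    rewrite big1 ?mulr1 => [|i _]; last by rewrite H.
    have [By cy] : B y /\ c < f y.
      apply: rP; rewrite -ball_normE /ball_/= (le_lt_trans _ rr0)//.
      apply: norm_le_coord => [|i]; first exact: ltW.
      rewrite !mxE; have := H i; rewrite /b => /andP[].
      by rewrite ler_norml; move: (x 0 i) (y 0 i) => p q; lra.
    by rewrite ind1// mul1r ltW.
  rewrite (bigD1 i)//= bi mul0r mulr0.
  have [By|By] := pselect (B y); first by rewrite ind1// mul1r f0.
  by rewrite ind0// mul0r.
pose k := r / (4 * M); have k0 : 0 < k by rewrite divr_gt0// mulr_gt0.
have Nk : \forall n \near \oo, forall i, k <= n.+1%:R^-1 *
     \sum_(j < n.+1) (b i (- M + mesh M n * j%:R))%:R.
  have : \forall n \near \oo, (k^-1 : R) < n%:R by exact: nbhs_infty_gtr.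
  apply: filterS => n nk i; have n0 : 0 < n.+1%:R :> R by [].
  have nk1 : 1 <= k * n.+1%:R.
    rewrite mulrC -ler_pdivrMr// mul1r (le_trans (ltW nk))// ler_nat//.
  have xi : `|x 0 i| <= `|x| := coord_le_norm x i.
  have xi2 : - `|x| <= x 0 i <= `|x| by rewrite -ler_norml.
  have E : \sum_(j < n.+1) (b i (- M + mesh M n * j%:R))%:R =
      \sum_(j < n.+1) ((x 0 i + M < mesh M n * j%:R) &&
         (mesh M n * j%:R <= x 0 i + M + r))%:R :> R.
    apply: eq_bigr => j _; rewrite /b; move: (mesh M n * _) (x 0 i) => p q.
    by congr ((_ && _)%:R); apply/idP/idP; lra.
  have : r / mesh M n - 1 <= \sum_(j < n.+1) (b i (- M + mesh M n * j%:R))%:R.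
    by case/andP: xi2 => x1 x2; rewrite E; apply: count_interval => //; lra.
  have -> : r / mesh M n = 2 * (k * n.+1%:R).
    by rewrite /k /mesh; field; rewrite nat1r (gt_eqF n0) (gt_eqF M0).
  move=> Hc; rewrite ler_pdivlMl// mulrC (le_trans _ Hc)//.
  by move: nk1; move: (k * _) => p; lra.
have k30 : 0 < c * k ^+ 3 by rewrite mulr_gt0// exprn_gt0.
have e0 : 0 < c * k ^+ 3 / 2 by rewrite divr_gt0.
have [n _ /(_ n (leqnn n)) [H1 H2]] : \forall n \near \oo,
    `|mean M n (fun x => \1_B x * f x)| <= c * k ^+ 3 / 2 /\
    forall i, k <= n.+1%:R^-1 * \sum_(j < n.+1) (b i (- M + mesh M n * j%:R))%:R.
  by apply: filterI; [exact: Nf|exact: Nk].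
have H3 : c * k ^+ 3 <= mean M n (fun x => \1_B x * f x).
  apply: (@le_trans _ _ (mean M n (fun y => c * \prod_i (b i (y 0 i))%:R))).
    rewrite mean_scale ler_wpM2l ?(ltW c0)// mean_box.
    rewrite (_ : k ^+ 3 = \prod_(i < 3) k); last by rewrite prodr_const card_ord.
    by apply: ler_prod => i _; rewrite (ltW k0) H2.
  by apply: mean_le => j; exact: fb.
have := le_trans H3 (le_trans (ler_norm _) H1).
by move: k30; move: (c * _) => z; lra.
Qed.

(** Compactness of [0, T] and of the closure of B: the mean at time s differs
from the mean at a nearby time t by at most the uniform distance on the
closure of B. This lets the mean value theorem in time be applied before the
mesh goes to zero. *)
Lemma null_mean_uniform (B : set V) (r : V * R -> R) (T : R) : compact (closure B) ->
  (forall x t, closure B x -> 0 <= t <= T -> {for (x, t), continuous r}) ->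
  (forall t, 0 <= t <= T -> null_mean M (fun x => \1_B x * r (x, t))) ->
  forall e, 0 < e -> \forall n \near \oo, forall t, 0 <= t <= T ->
    `|mean M n (fun x => \1_B x * r (x, t))| <= e.
Proof.
move=> cB cr Nr e e0.
pose P n (t : R) := `|mean M n (fun x => \1_B x * r (x, t))| <= e.
suff : \forall n \near \oo, `[0, T]%classic `<=` P n.
  by apply: filterS => n H t t0; apply: H; rewrite /= in_itv.
have cT : compact (`[0, T]%classic : set R) by exact: segment_compact.
apply: ((compact_near_coveringP _).1 cT nat \oo P _) => t; rewrite /= in_itv/= => tT.
have e20 : 0 < e / 2 by rewrite divr_gt0.
have e40 : 0 < e / 2 / 2 by rewrite divr_gt0.
pose Q (s : R) (x : V) := `|r (x, s) - r (x, t)| <= e / 2.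
have N1 : \forall s \near t, closure B `<=` Q s.
  apply: ((compact_near_coveringP _).1 cB R (nbhs t) Q _) => x Bx.
  have /cvgrPdist_lt/(_ _ e40) := cr x t Bx tT.
  move=> [[U W] /= [Ux Wt] UW]; exists (U, W) => // -[y s] /= [Uy Ws].
  have H1 := UW (y, s) (conj Uy Ws).
  have H2 := UW (y, t) (conj Uy (nbhs_singleton Wt)).
  by rewrite /Q; apply: (@dist_le_half _ _ _ (r (x, t))); rewrite distrC.
exists ([set s | closure B `<=` Q s], [set n | `|mean M n (fun x => \1_B x * r (x, t))| <= e / 2]).
  by split => //; exact: Nr.
move=> [s n] /= [sQ nt]; rewrite /P.
have D : `|mean M n (fun x => \1_B x * r (x, s) - \1_B x * r (x, t))| <= e / 2.
  rewrite -(mean_cst M n (e / 2)); apply: mean_norm_le => k.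
  have [Bk|Bk] := pselect (B (grid M k)); last by rewrite ind0// !mul0r subrr normr0 ltW.
  by rewrite ind1// !mul1r; apply: sQ; exact: subset_closure.
rewrite mean_sub in D.
exact: (norm_le_split D nt).
Qed.

End Positive.

(** * The constitutive law as a symmetric matrix *)

Notation I3 := 'I_3.

(** One index for all the components of (e, kappa, E, V, Theta), so that the
constitutive law is a single matrix. *)
Definition slot : finType :=
  ((I3 * I3) + (I3 * I3 * I3) + (I3 + (I3 * I3)) + unit)%type.

Definition se (i j : I3) : slot := inl (inl (inl (i, j))).
Definition sk (i j k : I3) : slot := inl (inl (inr (i, j, k))).
Definition sE (i : I3) : slot := inl (inr (inl i)).
Definition sV (i j : I3) : slot := inl (inr (inr (i, j))).
Definition sT : slot := inr tt.

Section Stiffness.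
Context {R : realType} (m : material R).

Definition stiffness (a b : slot) : R :=
  match a, b with
  | inl (inl (inl (i, j))), inl (inl (inl (k, l))) => a11 m i j k l
  | inl (inl (inl (i, j))), inl (inl (inr (k, l, h))) => a12 m i j k l h
  | inl (inl (inl (i, j))), inl (inr (inl k)) => a13 m i j k
  | inl (inl (inl (i, j))), inl (inr (inr (k, l))) => a17 m i j k l
  | inl (inl (inl (i, j))), inr _ => a14 m i j
  | inl (inl (inr (i, j, k))), inl (inl (inl (l, h))) => a12 m l h i j k
  | inl (inl (inr (i, j, k))), inl (inl (inr (l, h, q))) => a22 m i j k l h q
  | inl (inl (inr (i, j, k))), inl (inr (inl l)) => a23 m i j k l
  | inl (inl (inr (i, j, k))), inl (inr (inr (l, h))) => a27 m i j k l h
  | inl (inl (inr (i, j, k))), inr _ => a24 m i j k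
  | inl (inr (inl i)), inl (inl (inl (j, k))) => a13 m j k i
  | inl (inr (inl i)), inl (inl (inr (j, k, l))) => a23 m j k l i
  | inl (inr (inl i)), inl (inr (inl j)) => a33 m i j
  | inl (inr (inl i)), inl (inr (inr (j, k))) => a37 m i j k
  | inl (inr (inl i)), inr _ => a34 m i
  | inl (inr (inr (i, j))), inl (inl (inl (k, l))) => a17 m k l i j
  | inl (inr (inr (i, j))), inl (inl (inr (k, l, h))) => a27 m k l h i j
  | inl (inr (inr (i, j))), inl (inr (inl k)) => a37 m k i j
  | inl (inr (inr (i, j))), inl (inr (inr (k, l))) => a77 m i j k l
  | inl (inr (inr (i, j))), inr _ => a47 m i j
  | inr _, inl (inl (inl (i, j))) => a14 m i j
  | inr _, inl (inl (inr (i, j, k))) => a24 m i j k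
  | inr _, inl (inr (inl i)) => a34 m i
  | inr _, inl (inr (inr (i, j))) => a47 m i j
  | inr _, inr _ => a44 m
  end.

Lemma stiffness_sym : symmetry_relations m -> forall a b, stiffness a b = stiffness b a.
Proof.
move=> H [[[[i j]|[[i j] k]]|[i|[i j]]]|u] [[[[i' j']|[[i' j'] k']]|[i'|[i' j']]]|u'] //=.
- by have [_] := sym11 H i j i' j'.
- by have [_] := sym22 H i j k i' j' k'.
- by rewrite (sym33 H).
- by have [_] := sym77 H i j i' j'.
Qed.

(** According to the slot: tau, mu, - sigma, - Q, and the part of - rho eta that
is linear in the strains and Theta. *)
Definition conjugate (X : slot -> R) (a : slot) : R := \sum_b stiffness a b * X b.

Lemma sum_slot (F : slot -> R) : \sum_a F a =
  \sum_i \sum_j F (se i j) + \sum_i \sum_j \sum_k F (sk i j k)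
  + (\sum_i F (sE i) + \sum_i \sum_j F (sV i j)) + F sT.
Proof.
rewrite !big_sumType/=; congr (_ + _ + (_ + _) + _).
- by rewrite pair_bigA/=; apply: eq_bigr => -[i j].
- by rewrite !pair_bigA/=; apply: eq_bigr => -[[i j] k].
- by rewrite pair_bigA/=; apply: eq_bigr => -[i j].
- by rewrite (bigD1 tt)//= big1 ?addr0// => -[].
Qed.

Definition bundle (e : I3 -> I3 -> R) (k : I3 -> I3 -> I3 -> R) (E : I3 -> R)
    (V : I3 -> I3 -> R) (T : R) (a : slot) : R :=
  match a with
  | inl (inl (inl (i, j))) => e i j
  | inl (inl (inr (i, j, l))) => k i j l
  | inl (inr (inl i)) => E i
  | inl (inr (inr (i, j))) => V i j
  | inr _ => T
  end.

Definition strain_slots (s : state R) (p : 'rV[R]_3 * R) : slot -> R :=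
  bundle (fun i j => strain s i j p) (fun i j k => kap s i j k p)
    (fun i => efield s i p) (fun i j => egrad s i j p) (vartheta m s p).

Lemma tauE s i j p : tau m s i j p = conjugate (strain_slots s p) (se i j).
Proof. by rewrite /conjugate sum_slot /tau /=; ring. Qed.

Lemma muE s i j k p : mu m s i j k p = conjugate (strain_slots s p) (sk i j k).
Proof. by rewrite /conjugate sum_slot /mu /=; ring. Qed.

Lemma sigmaE s i p : sigma m s i p = - conjugate (strain_slots s p) (sE i).
Proof. by rewrite /conjugate sum_slot /sigma /=; ring. Qed.

Lemma quadE s i j p : quad m s i j p = - conjugate (strain_slots s p) (sV i j).
Proof. by rewrite /conjugate sum_slot /quad /=; ring. Qed.

Lemma entropyE s p : entropy m s p = - (rho m)^-1 *
  (conjugate (strain_slots s p) sT + (beta m)^-1 * (gamma m * dt (temp s) p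
                   + \sum_(i < 3) a56 m i * dx i (temp s) p) + alpha4 m).
Proof. by rewrite /conjugate sum_slot /entropy /=; congr (_ * _); ring. Qed.

Definition free_energy (X : slot -> R) : R := 2^-1 * \sum_a X a * conjugate X a.

Definition pairing (X Y : slot -> R) : R := \sum_a X a * conjugate Y a.

Lemma pairing_sym X Y : symmetry_relations m -> pairing X Y = pairing Y X.
Proof.
move=> H; rewrite /pairing /conjugate.
under eq_bigr => a _ do rewrite mulr_sumr.
rewrite exchange_big/=; apply: eq_bigr => b _; rewrite mulr_sumr; apply: eq_bigr => a _.
by rewrite (stiffness_sym H) mulrCA mulrA mulrC mulrA.
Qed.

Lemma pairingDl X Y Z : pairing (fun a => X a + Y a) Z = pairing X Z + pairing Y Z.
Proof. by rewrite -big_split/=; apply: eq_bigr => a _; rewrite mulrDl. Qed.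

Lemma sum0l (F : I3 -> R) : \sum_i 0 * F i = 0.
Proof. by rewrite big1// => i _; rewrite mul0r. Qed.
Lemma sum0r (F : I3 -> R) : \sum_i F i * 0 = 0.
Proof. by rewrite big1// => i _; rewrite mulr0. Qed.
Lemma sum0l2 (F : I3 -> I3 -> R) : \sum_i \sum_j 0 * F i j = 0.
Proof. by rewrite big1// => i _; rewrite sum0l. Qed.
Lemma sum0r2 (F : I3 -> I3 -> R) : \sum_i \sum_j F i j * 0 = 0.
Proof. by rewrite big1// => i _; rewrite sum0r. Qed.
Lemma sum0l3 (F : I3 -> I3 -> I3 -> R) : \sum_i \sum_j \sum_k 0 * F i j k = 0.
Proof. by rewrite big1// => i _; rewrite sum0l2. Qed.
Lemma sum0r3 (F : I3 -> I3 -> I3 -> R) : \sum_i \sum_j \sum_k F i j k * 0 = 0.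
Proof. by rewrite big1// => i _; rewrite sum0r2. Qed.

Let Z1 : I3 -> R := fun=> 0.
Let Z2 : I3 -> I3 -> R := fun=> Z1.
Let Z3 : I3 -> I3 -> I3 -> R := fun=> Z2.

(** A partial Legendre transform, with respect to E, V and Theta: the diagonal
blocks in E, V, Theta change sign, which produces G, while the coupling of
these variables with e and kappa cancels, which leaves W. *)
Lemma legendre_free_energy e k E V T : symmetry_relations m ->
  let X := bundle e k E V T in
  free_energy X - \sum_i E i * conjugate X (sE i)
    - \sum_i \sum_j V i j * conjugate X (sV i j) - T * conjugate X sT
  = form_W m e k + form_G m E V T + 2^-1 * (gamma m / beta m ^+ 2) * T ^+ 2.
Proof.
move=> H X.
(* the five blocks of X; the quadratic form is expanded into their pairings *)
pose Xe := bundle e Z3 Z1 Z2 0; pose Xk := bundle Z2 k Z1 Z2 0.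
pose XE := bundle Z2 Z3 E Z2 0; pose XV := bundle Z2 Z3 Z1 V 0.
pose XT := bundle Z2 Z3 Z1 Z2 T.
have XD : X = fun a => Xe a + (Xk a + (XE a + (XV a + XT a))).
  apply/funext => -[[[[i j]|[[i j] l]]|[i|[i j]]]|u] /=; rewrite /Z3 /Z2 /Z1;
  by rewrite ?addr0 ?add0r.
have DX Y : pairing X Y = pairing Xe Y + (pairing Xk Y + (pairing XE Y + (pairing XV Y + pairing XT Y))).
  by rewrite XD !pairingDl.
have pE Y : \sum_i E i * conjugate Y (sE i) = pairing XE Y.
  by rewrite /pairing sum_slot /= /Z2 /Z1 sum0l2 sum0l3 sum0l2 mul0r !addr0 !add0r.
have pV Y : \sum_i \sum_j V i j * conjugate Y (sV i j) = pairing XV Y.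
  by rewrite /pairing sum_slot /= /Z2 /Z1 sum0l2 sum0l3 sum0l mul0r !addr0 !add0r.
have pT Y : T * conjugate Y sT = pairing XT Y.
  by rewrite /pairing sum_slot /= /Z2 /Z1 !sum0l2 sum0l3 sum0l !addr0 !add0r.
have pe Y : pairing Xe Y = \sum_i \sum_j e i j * conjugate Y (se i j).
  by rewrite /pairing sum_slot /= /Z2 /Z1 !sum0l2 sum0l3 sum0l mul0r !addr0.
have pk Y : pairing Xk Y = \sum_i \sum_j \sum_l k i j l * conjugate Y (sk i j l).
  by rewrite /pairing sum_slot /= /Z2 /Z1 !sum0l2 sum0l mul0r !addr0 !add0r.
rewrite pE pV pT /free_energy -/(pairing X X).
rewrite (pairing_sym XE X H) (pairing_sym XV X H) (pairing_sym XT X H).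
rewrite !DX !(pairing_sym _ X H) !DX.
rewrite (pairing_sym Xk Xe H) (pairing_sym XE Xe H) (pairing_sym XV Xe H) (pairing_sym XT Xe H).
rewrite (pairing_sym XE Xk H) (pairing_sym XV Xk H) (pairing_sym XT Xk H).
rewrite (pairing_sym XV XE H) (pairing_sym XT XE H) (pairing_sym XT XV H).
have ee : pairing Xe Xe = \sum_(i < 3) \sum_(j < 3) \sum_(k < 3) \sum_(l < 3)
            a11 m i j k l * e i j * e k l.
  rewrite pe; apply: eq_bigr => i _; apply: eq_bigr => j _.
  rewrite /conjugate sum_slot /= /Z2 /Z1 !sum0r2 sum0r3 sum0r mulr0 !addr0 !mulr_sumr.
  apply: eq_bigr => a _; rewrite mulr_sumr; apply: eq_bigr => c _; ring.
have kk : pairing Xk Xk = \sum_(i < 3) \sum_(j < 3) \sum_(l < 3)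
            \sum_(a < 3) \sum_(h < 3) \sum_(p < 3)
            a22 m i j l a h p * k i j l * k a h p.
  rewrite pk; apply: eq_bigr => i _; apply: eq_bigr => j _; apply: eq_bigr => l _.
  rewrite /conjugate sum_slot /= /Z2 /Z1 !sum0r2 sum0r mulr0 !addr0 add0r !mulr_sumr.
  apply: eq_bigr => a _; rewrite mulr_sumr; apply: eq_bigr => c _.
  rewrite mulr_sumr; apply: eq_bigr => d _; ring.
have ek : pairing Xe Xk = \sum_(i < 3) \sum_(j < 3) \sum_(a < 3) \sum_(l < 3) \sum_(h < 3)
      a12 m i j a l h * e i j * k a l h.
  rewrite pe; apply: eq_bigr => i _; apply: eq_bigr => j _.
  rewrite /conjugate sum_slot /= /Z2 /Z1 !sum0r2 sum0r mulr0 !addr0 add0r !mulr_sumr.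
  apply: eq_bigr => a _; rewrite mulr_sumr; apply: eq_bigr => c _.
  rewrite mulr_sumr; apply: eq_bigr => d _; ring.
have EE : pairing XE XE = \sum_(i < 3) \sum_(j < 3) a33 m i j * E i * E j.
  rewrite -pE; apply: eq_bigr => i _.
  rewrite /conjugate sum_slot /= /Z2 /Z1 !sum0r2 sum0r3 mulr0 !addr0 add0r !mulr_sumr.
  apply: eq_bigr => a _; ring.
have VV : pairing XV XV = \sum_(i < 3) \sum_(j < 3) \sum_(k < 3) \sum_(l < 3)
              a77 m i j k l * V i j * V k l.
  rewrite -pV; apply: eq_bigr => i _; apply: eq_bigr => j _.
  rewrite /conjugate sum_slot /= /Z2 /Z1 !sum0r2 sum0r3 sum0r mulr0 !addr0 !add0r !mulr_sumr.
  apply: eq_bigr => a _; rewrite mulr_sumr; apply: eq_bigr => c _; ring.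
have EV : pairing XE XV = \sum_(i < 3) \sum_(j < 3) \sum_(k < 3) a37 m i j k * E i * V j k.
  rewrite -pE; apply: eq_bigr => i _.
  rewrite /conjugate sum_slot /= /Z2 /Z1 !sum0r2 sum0r3 sum0r mulr0 !addr0 !add0r !mulr_sumr.
  apply: eq_bigr => a _; rewrite mulr_sumr; apply: eq_bigr => c _; ring.
have ET : pairing XE XT = \sum_(i < 3) a34 m i * E i * T.
  rewrite -pE; apply: eq_bigr => i _.
  rewrite /conjugate sum_slot /= /Z2 /Z1 !sum0r2 sum0r3 sum0r !add0r; ring.
have VT : pairing XV XT = \sum_(i < 3) \sum_(j < 3) a47 m i j * V i j * T.
  rewrite -pV; apply: eq_bigr => i _; apply: eq_bigr => j _.
  rewrite /conjugate sum_slot /= /Z2 /Z1 !sum0r2 sum0r3 sum0r !add0r; ring.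
have TT : pairing XT XT = a44 m * T ^+ 2.
  rewrite -pT /conjugate sum_slot /= /Z2 /Z1 !sum0r2 sum0r3 sum0r !add0r; ring.
rewrite ee kk ek EE VV EV ET VT TT /form_W /form_G.
move: (pairing _ _) (pairing _ _) (pairing _ _) (pairing _ _) (pairing _ _) (pairing _ _).
move=> x1 x2 x3 x4 x5 x6; move: (gamma m / _) => q.
by field.
Qed.

End Stiffness.

(** * Regularity and power of the stresses *)

Lemma sum3_rot (R : realType) (F G : I3 -> I3 -> I3 -> R) :
  (forall i j k, F i j k = G k i j) ->
  \sum_i \sum_j \sum_k F i j k = \sum_k \sum_i \sum_j G k i j.
Proof.
move=> FG; under eq_bigr => i _ do rewrite exchange_big/=; rewrite exchange_big/=.
by do 3 (apply: eq_bigr => ? _).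
Qed.

Lemma congr_parts (R : realType) (a a' b b' c c' d d' e : R) :
  a = a' -> b = b' -> c = c' -> d = d' ->
  a + b + (c + d) + e = a' + b' + (c' + d') + e.
Proof. by move=> -> -> -> ->. Qed.

Section Fields.
Context {R : realType}.
Local Notation W := ('rV[R]_3 * R)%type.
Implicit Types (f g : W -> R) (Om : set W) (p : W).

Lemma class_C_dx k Om f i : class_C k.+1 Om f -> class_C k Om (dx i f).
Proof. by move=> Cf; exact: Cf.2. Qed.

Lemma class_C_dt k Om f : class_C k.+1 Om f -> class_C k Om (dt f).
Proof. by move=> Cf; exact: Cf.2. Qed.

Lemma dt_dx Om f i p : open Om -> class_C 2 Om f -> Om p -> dt (dx i f) p = dx i (dt f) p.
Proof. by move=> oO Cf Op; exact: (schwarz _ _ oO Cf Op). Qed.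

Lemma dx_near Om f g i p : open Om -> Om p -> (forall q, Om q -> f q = g q) ->
  dx i f p = dx i g p.
Proof. by move=> oO Op fg; apply: near_eq_derive; exact: (open_near oO Op). Qed.

Lemma dt_near Om f g p : open Om -> Om p -> (forall q, Om q -> f q = g q) ->
  dt f p = dt g p.
Proof. by move=> oO Op fg; apply: near_eq_derive; exact: (open_near oO Op). Qed.

Variables (Om : set W) (oOm : open Om) (m : material R) (s : state R).
Hypotheses (Cu : forall i, class_C 4 Om (disp s i)) (Ct : class_C 3 Om (temp s))
  (Cp : class_C 4 Om (pot s)).

Local Notation sC := (class_C_scale _ oOm).
Local Notation sA := (class_C_add oOm).
Local Notation mC := (class_C_mul oOm).

Lemma class_C_strain i j : class_C 3 Om (strain s i j).
Proof. exact: (sC (sA (class_C_dx j (Cu i)) (class_C_dx i (Cu j)))). Qed.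

Lemma class_C_kap i j k : class_C 2 Om (kap s i j k).
Proof. exact: (class_C_dx j (class_C_dx i (Cu k))). Qed.

Lemma class_C_efield i : class_C 3 Om (efield s i).
Proof. exact: (class_C_opp oOm (class_C_dx i Cp)). Qed.

Lemma class_C_egrad i j : class_C 2 Om (egrad s i j).
Proof. exact: (class_C_dx j (class_C_efield i)). Qed.

Lemma class_C_vartheta : class_C 2 Om (vartheta m s).
Proof. exact: (sA (class_C_lt Ct) (sC (class_C_dt Ct))). Qed.

Definition slot_field a : W -> R := fun p => strain_slots m s p a.

Lemma class_C_slot a : class_C 2 Om (slot_field a).
Proof.
case: a => [[[[i j]|[[i j] k]]|[i|[i j]]]|u].
- exact: (class_C_lt (class_C_strain i j)).
- exact: (class_C_kap i j k).
- exact: (class_C_lt (class_C_efield i)).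
- exact: (class_C_egrad i j).
- exact: class_C_vartheta.
Qed.

Definition conj_field a : W -> R := fun p => conjugate m (strain_slots m s p) a.

Lemma class_C_conj a : class_C 2 Om (conj_field a).
Proof. by apply: class_C_sum => // b _; exact: (sC (class_C_slot b)). Qed.

Lemma tau_conj i j : tau m s i j = conj_field (se i j).
Proof. by apply/funext => p; exact: tauE. Qed.
Lemma mu_conj i j k : mu m s i j k = conj_field (sk i j k).
Proof. by apply/funext => p; exact: muE. Qed.
Lemma sigma_conj i : sigma m s i = fun p => - conj_field (sE i) p.
Proof. by apply/funext => p; exact: sigmaE. Qed.
Lemma quad_conj i j : quad m s i j = fun p => - conj_field (sV i j) p.
Proof. by apply/funext => p; exact: quadE. Qed.

Lemma class_C_tau i j : class_C 2 Om (tau m s i j).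
Proof. by rewrite tau_conj; exact: class_C_conj. Qed.
Lemma class_C_mu i j k : class_C 2 Om (mu m s i j k).
Proof. by rewrite mu_conj; exact: class_C_conj. Qed.
Lemma class_C_sigma i : class_C 2 Om (sigma m s i).
Proof. by rewrite sigma_conj; exact: (class_C_opp oOm (class_C_conj _)). Qed.
Lemma class_C_quad i j : class_C 2 Om (quad m s i j).
Proof. by rewrite quad_conj; exact: (class_C_opp oOm (class_C_conj _)). Qed.

Lemma class_C_heat_flux i : class_C 2 Om (heat_flux m s i).
Proof.
apply: sC; apply: sC; apply: sA; first exact: (sC (class_C_dt Ct)).
by apply: class_C_sum => // j _; exact: (sC (class_C_dx j Ct)).
Qed.

Definition heat_part : W -> R := fun p =>
  gamma m * dt (temp s) p + \sum_(i < 3) a56 m i * dx i (temp s) p.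

Lemma class_C_heat_part : class_C 2 Om heat_part.
Proof.
apply: sA; first exact: (sC (class_C_dt Ct)).
by apply: class_C_sum => // j _; exact: (sC (class_C_dx j Ct)).
Qed.

(** Chosen so that its rate compensates the heat terms of the entropy balance
up to - P(theta', grad theta) ([heat_dissipation]), and so that, added to
(gamma / beta^2) Theta^2 / 2, it is (beta / 2) P(- theta / beta, grad theta)
([energy_split]). *)
Definition thermal_energy : W -> R := fun p =>
  (- (gamma m / beta m) * (temp s p * dt (temp s) p)
   + - (2^-1 * gamma m) * (dt (temp s) p * dt (temp s) p))
  + (- (beta m)^-1 * (temp s p * \sum_(i < 3) a56 m i * dx i (temp s) p)
   + 2^-1 * \sum_(i < 3) \sum_(j < 3) a66 m i j * (dx i (temp s) p * dx j (temp s) p)).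

Definition kinetic_energy : W -> R := fun p =>
  2^-1 * rho m * \sum_(i < 3) dt (disp s i) p * dt (disp s i) p.

Definition free_energy_field : W -> R := fun p =>
  2^-1 * \sum_a slot_field a p * conj_field a p.

Definition stored : W -> R := fun p =>
  (free_energy_field p - vartheta m s p * conj_field sT p)
  + (kinetic_energy p + thermal_energy p).

Lemma class_C_thermal : class_C 2 Om thermal_energy.
Proof.
apply: sA; apply: sA; apply: sC.
- exact: (mC (class_C_lt Ct) (class_C_dt Ct)).
- exact: (mC (class_C_dt Ct) (class_C_dt Ct)).
- apply: (mC (class_C_lt Ct)).
  by apply: class_C_sum => // j _; exact: (sC (class_C_dx j Ct)).
- apply: class_C_sum => // i _; apply: class_C_sum => // j _; apply: sC.
  exact: (mC (class_C_dx i Ct) (class_C_dx j Ct)).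
Qed.

Lemma class_C_kinetic : class_C 2 Om kinetic_energy.
Proof.
apply: sC; apply: class_C_sum => // i _.
have C := class_C_lt (class_C_dt (Cu i)); exact: (mC C C).
Qed.

Lemma class_C_free_energy : class_C 2 Om free_energy_field.
Proof.
apply: sC; apply: class_C_sum => // a _; exact: (mC (class_C_slot a) (class_C_conj a)).
Qed.

Lemma class_C_stored : class_C 2 Om stored.
Proof.
exact: (sA (class_C_sub_fun oOm class_C_free_energy (mC class_C_vartheta (class_C_conj sT)))
  (sA class_C_kinetic class_C_thermal)).
Qed.

Section AtPoint.
Variables (p : W) (Op : Om p).

Let dif k f (C : class_C k.+1 Om f) : differentiable f p := C.1 _ Op.

Let v i := dt (disp s i).
Let psi := dt (pot s).

Lemma dt_strain i j : dt (strain s i j) p = 2^-1 * (dx j (v i) p + dx i (v j) p).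
Proof.
have Cj := class_C_dx j (Cu i); have Ci := class_C_dx i (Cu j).
rewrite [LHS](derive_scale _ _ (dif (sA Cj Ci))) (derive_add _ (dif Cj) (dif Ci)).
have E1 := dt_dx j oOm (class_C_lt (class_C_lt (Cu i))) Op.
have E2 := dt_dx i oOm (class_C_lt (class_C_lt (Cu j))) Op.
by rewrite -E1 -E2.
Qed.

Lemma dt_kap i j k : dt (kap s i j k) p = dx j (dx i (v k)) p.
Proof.
rewrite [LHS](dt_dx j oOm (class_C_lt (class_C_dx i (Cu k))) Op).
by apply: (dx_near j oOm Op) => q Oq; exact: (dt_dx i oOm (class_C_lt (class_C_lt (Cu k))) Oq).
Qed.

Lemma dt_efield i q : Om q -> dt (efield s i) q = - dx i psi q.
Proof.
move=> Oq; rewrite [LHS]deriveN; last exact/diff_derivable/((class_C_dx i Cp).1 _ Oq).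
by rewrite -(dt_dx i oOm (class_C_lt (class_C_lt Cp)) Oq).
Qed.

Lemma dt_egrad i j : dt (egrad s i j) p = - dx j (dx i psi) p.
Proof.
rewrite [LHS](dt_dx j oOm (class_C_lt (class_C_efield i)) Op).
rewrite (dx_near j oOm Op (g := fun q => - dx i psi q)); last exact: dt_efield.
rewrite [LHS]deriveN//; apply/diff_derivable; exact: (class_C_dx i (class_C_dt Cp)).1.
Qed.

Lemma dt_conj a : dt (conj_field a) p = conjugate m (fun b => dt (slot_field b) p) a.
Proof.
have [_ D1] := derive_sumf (index_enum slot) (F := fun b q => stiffness m a b * slot_field b q)
  ((0, 1) : W) (fun b => dif (class_C_lt (sC (class_C_slot b)))).
rewrite [LHS]D1.
by apply: eq_bigr => b _; rewrite derive_scale//; exact: (dif (class_C_lt (class_C_slot b))).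
Qed.

(** The symmetry of the constitutive coefficients gives the factor 2 which
cancels the 1/2 in front of the quadratic form. *)
Lemma dt_free_energy : symmetry_relations m ->
  dt free_energy_field p = \sum_a conj_field a p * dt (slot_field a) p.
Proof.
move=> H.
have dP a := dif (class_C_mul oOm (class_C_slot a) (class_C_conj a)).
have [d1 D1] := derive_sumf (index_enum slot) (F := fun a q => slot_field a q * conj_field a q)
  ((0, 1) : W) dP.
rewrite [LHS](derive_scale _ _ d1) D1.
under eq_bigr => a _.
  rewrite (derive_mul _ (dif (class_C_slot a)) (dif (class_C_conj a))).
  rewrite -[X in _ * X + _]/(dt (conj_field a) p) dt_conj; over.
rewrite big_split/= -/(pairing m _ _).
rewrite (pairing_sym (fun a => slot_field a p) (fun b => dt (slot_field b) p) H).
set Y := RHS; transitivity (2^-1 * (Y + Y)); last by field.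
by congr (_ * (_ + _)); apply: eq_bigr => a _; exact: mulrC.
Qed.

(** The strains are replaced by the gradients of u' and phi' : the tensor tau
is symmetric, so that it does not see the antisymmetric part of grad u'. *)
Lemma stress_power : symmetry_relations m ->
  \sum_a conj_field a p * dt (slot_field a) p =
  \sum_i (\sum_j tau m s j i p * dx j (v i) p
          + \sum_k \sum_j mu m s k j i p * dx j (dx k (v i)) p)
  + (\sum_j sigma m s j p * dx j psi p + \sum_k \sum_j quad m s k j p * dx j (dx k psi) p)
  + conj_field sT p * dt (vartheta m s) p.
Proof.
move=> H.
have Ts i j : conj_field (se i j) p = conj_field (se j i) p.
  apply: eq_bigr => b _; congr (_ * _); case: b => [[[[k l]|[[k l] h]]|[k|[k l]]]|u] /=.
  + by have [] := sym11 H i j k l.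
  + by have [] := sym12 H i j k l h.
  + by rewrite (sym13 H).
  + by have [] := sym17 H i j k l.
  + by rewrite (sym14 H).
have P1 : \sum_i \sum_j conj_field (se i j) p * dt (slot_field (se i j)) p =
    \sum_i \sum_j tau m s j i p * dx j (v i) p.
  have E i j : conj_field (se i j) p * dt (slot_field (se i j)) p =
     2^-1 * (tau m s i j p * dx j (v i) p) + 2^-1 * (tau m s i j p * dx i (v j) p).
    by rewrite tau_conj -mulrDr -mulrDr -[dt _ p]/(dt (strain s i j) p) dt_strain mulrCA.
  under eq_bigr => i _ do under eq_bigr => j _ do rewrite E.
  under eq_bigr => i _ do rewrite big_split/=.
  rewrite big_split/= [X in _ + X]exchange_big/= -big_split/=; apply: eq_bigr => i _.
  rewrite -big_split/=; apply: eq_bigr => j _.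
  by rewrite !tau_conj (Ts i j); move: (_ * dx j (v i) p) => z; field.
have P2 : \sum_i \sum_j \sum_k conj_field (sk i j k) p * dt (slot_field (sk i j k)) p =
    \sum_i \sum_k \sum_j mu m s k j i p * dx j (dx k (v i)) p.
  apply: (@sum3_rot _ (fun i j k => conj_field (sk i j k) p * dt (slot_field (sk i j k)) p)
    (fun i k j => mu m s k j i p * dx j (dx k (v i)) p)) => i j k.
  by rewrite mu_conj -[dt _ p]/(dt (kap s i j k) p) dt_kap.
have P3 : \sum_i conj_field (sE i) p * dt (slot_field (sE i)) p =
    \sum_j sigma m s j p * dx j psi p.
  apply: eq_bigr => i _.
  have D : dt (slot_field (sE i)) p = - dx i psi p := dt_efield i Op.
  by rewrite D sigma_conj mulrN mulNr.
have P4 : \sum_i \sum_j conj_field (sV i j) p * dt (slot_field (sV i j)) p =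
    \sum_k \sum_j quad m s k j p * dx j (dx k psi) p.
  apply: eq_bigr => i _; apply: eq_bigr => j _.
  have D : dt (slot_field (sV i j)) p = - dx j (dx i psi) p := dt_egrad i j.
  by rewrite D quad_conj mulrN mulNr.
rewrite (sum_slot (fun a => conj_field a p * dt (slot_field a) p)).
apply: etrans (congr_parts _ P1 P2 P3 P4) _.
by rewrite big_split.
Qed.

End AtPoint.
End Fields.

(** * Rate of the stored energy *)

Section HeatAlgebra.
Context {R : realType} (m : material R).
Implicit Types (g h q dq : I3 -> R) (th td tdd DF : R).

(** The heat equation multiplied by Theta / T0. Here th, td, tdd are the
temperature and its time derivatives, g and h the gradients of th and td, q
the heat flux, dq i stands for d_i q_i, and DF for the rate of the conjugate
of Theta. *)
Lemma heat_dissipation g h th td tdd DF (q := fun i =>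
    - T0 m * ((beta m)^-1 * (a56 m i * td + \sum_j a66 m i j * g j))) dq :
  symmetry_relations m -> beta m != 0 -> T0 m != 0 ->
  - T0 m * (DF + (beta m)^-1 * (gamma m * tdd + \sum_i a56 m i * h i)) + \sum_i dq i = 0 ->
  let Th := th + beta m * td in
  - (Th * DF)
  + ((- (gamma m / beta m) * (th * tdd + td * td) + - (2^-1 * gamma m) * (td * tdd + td * tdd))
    + (- (beta m)^-1 * (th * (\sum_i a56 m i * h i) + (\sum_i a56 m i * g i) * td)
      + 2^-1 * \sum_i \sum_j a66 m i j * (g i * h j + g j * h i)))
  + form_P m td g
  = - (T0 m)^-1 * \sum_i (q i * (g i + beta m * h i) + Th * dq i).
Proof.
move=> H b0 t0 b3 Th.
have S1 : \sum_i \sum_j a66 m i j * (g i * h j + g j * h i) =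
    2 * \sum_i \sum_j a66 m i j * h i * g j.
  under eq_bigr => i _ do under eq_bigr => j _ do rewrite mulrDr.
  under eq_bigr => i _ do rewrite big_split/=.
  rewrite big_split/= [X in X + _]exchange_big/= mulr2n mulrDl mul1r; congr (_ + _).
    apply: eq_bigr => i _; apply: eq_bigr => j _; rewrite (sym66 H); ring.
  by apply: eq_bigr => i _; apply: eq_bigr => j _; ring.
have S2 : \sum_i (q i * (g i + beta m * h i) + Th * dq i) =
    - T0 m * (beta m)^-1 * (td * (\sum_i a56 m i * g i) + beta m * td * (\sum_i a56 m i * h i)
     + \sum_i \sum_j a66 m i j * g i * g j + beta m * \sum_i \sum_j a66 m i j * h i * g j)
     + Th * \sum_i dq i.
  rewrite big_split/= -mulr_sumr; congr (_ + _).
  rewrite !mulr_sumr -!big_split/= mulr_sumr; apply: eq_bigr => i _.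
  have -> : \sum_j a66 m i j * g i * g j = g i * \sum_j a66 m i j * g j.
    by rewrite mulr_sumr; apply: eq_bigr => j _; ring.
  have -> : \sum_j a66 m i j * h i * g j = h i * \sum_j a66 m i j * g j.
    by rewrite mulr_sumr; apply: eq_bigr => j _; ring.
  by rewrite /q; move: (\sum_j _) => z; ring.
have S3 : \sum_i a56 m i * td * g i = td * \sum_i a56 m i * g i.
  by rewrite mulr_sumr; apply: eq_bigr => i _; ring.
have {}b3 : \sum_i dq i = T0 m * (DF + (beta m)^-1 * (gamma m * tdd + \sum_i a56 m i * h i)).
  by apply/eqP; rewrite -subr_eq0; apply/eqP; rewrite -[RHS]b3; ring.
rewrite S2 S1 /form_P S3 b3 /Th.
move: (\sum_i a56 m i * h i) (\sum_i a56 m i * g i) (\sum_i \sum_j _) (\sum_i \sum_j _).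
move=> z1 z2 z3 z4; move: (gamma m) => ga.
by field; rewrite b0 t0.
Qed.

End HeatAlgebra.

Lemma stored_rearrange (R : realType) (D f df g k l dk a b dfl c x y z : R) :
  D = f + g -> f = df - dfl -> dfl = y * z + c * x -> g = dk + l ->
  df = b -> b = a + c * x -> dk = k -> D = (a - y * z) + (k + l).
Proof. by move=> -> -> -> -> -> -> ->; ring. Qed.

Lemma linear_four (R : realType) (D u v u1 u2 v1 v2 a b c d x1 x2 x3 x4 y1 y2 y3 y4 : R) :
  D = u + v -> u = u1 + u2 -> v = v1 + v2 ->
  u1 = a * x1 -> u2 = b * x2 -> v1 = c * x3 -> v2 = d * x4 ->
  x1 = y1 -> x2 = y2 -> x3 = y3 -> x4 = y4 ->
  D = (a * y1 + b * y2) + (c * y3 + d * y4).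
Proof. by move=> -> -> -> -> -> -> -> -> -> -> ->. Qed.

Section Rate.
Context {R : realType}.
Local Notation W := ('rV[R]_3 * R)%type.
Variables (Om : set W) (oOm : open Om) (m : material R) (s : state R).
Hypotheses (Cu : forall i, class_C 4 Om (disp s i)) (Ct : class_C 3 Om (temp s))
  (Cp : class_C 4 Om (pot s)).
Local Notation sC := (class_C_scale _ oOm).
Local Notation sA := (class_C_add oOm).
Local Notation mC := (class_C_mul oOm).
Local Notation conjf := (conj_field m s).
Variables (p : W) (Op : Om p).

Let dif k (f : W -> R) (C : class_C k.+1 Om f) : differentiable f p := C.1 _ Op.

Lemma dt_kinetic : dt (kinetic_energy m s) p =
  rho m * \sum_(i < 3) dt (disp s i) p * dt (dt (disp s i)) p.
Proof.
have dv i := dif (class_C_dt (Cu i)).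
have [d1 D1] := derive_sumf (index_enum 'I_3)
  (F := fun i q => dt (disp s i) q * dt (disp s i) q) ((0, 1) : W)
  (fun i => differentiableM (dv i) (dv i)).
rewrite [LHS](derive_scale _ _ d1) D1 -mulrA mulrCA; congr (_ * _).
rewrite mulr_sumr; apply: eq_bigr => i _; rewrite (derive_mul _ (dv i) (dv i)).
rewrite -[X in X + _]/(dt (disp s i) p * dt (dt (disp s i)) p).
by move: (dt _ p * _) => z; field.
Qed.

Lemma dt_dx_temp i : dt (dx i (temp s)) p = dx i (dt (temp s)) p.
Proof. exact: (dt_dx i oOm (class_C_lt Ct) Op). Qed.

Lemma dt_a56 : dt (fun q => \sum_(i < 3) a56 m i * dx i (temp s) q) p =
  \sum_i a56 m i * dx i (dt (temp s)) p.
Proof.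
have dd i := dif (class_C_dx i Ct).
have [d1 D1] := derive_sumf (index_enum 'I_3)
  (F := fun i q => a56 m i * dx i (temp s) q) ((0, 1) : W)
  (fun i => dif (sC (class_C_dx i Ct))).
rewrite [LHS]D1; apply: eq_bigr => i _.
by rewrite (derive_scale _ _ (dd i)) -dt_dx_temp.
Qed.

Lemma dt_thermal : dt (thermal_energy m s) p =
  (- (gamma m / beta m) * (temp s p * dt (dt (temp s)) p + dt (temp s) p * dt (temp s) p)
   + - (2^-1 * gamma m) * (dt (temp s) p * dt (dt (temp s)) p + dt (temp s) p * dt (dt (temp s)) p))
  + (- (beta m)^-1 * (temp s p * (\sum_i a56 m i * dx i (dt (temp s)) p)
                     + (\sum_i a56 m i * dx i (temp s) p) * dt (temp s) p)
   + 2^-1 * \sum_i \sum_j a66 m i j * (dx i (temp s) p * dx j (dt (temp s)) p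
        + dx j (temp s) p * dx i (dt (temp s)) p)).
Proof.
have d0 := dif Ct; have d1 := dif (class_C_dt Ct).
have dg i := dif (class_C_dx i Ct).
have Csum : class_C 2 Om (fun q => \sum_(i < 3) a56 m i * dx i (temp s) q).
  by apply: class_C_sum => // i _; exact: (sC (class_C_dx i Ct)).
have dsum := dif Csum.
have C1 := mC (class_C_lt Ct) (class_C_dt Ct).
have C2 := mC (class_C_dt Ct) (class_C_dt Ct).
have C3 := mC (class_C_lt Ct) Csum.
have C4 i j : class_C 2 Om (fun q => a66 m i j * (dx i (temp s) q * dx j (temp s) q)).
  exact: (sC (mC (class_C_dx i Ct) (class_C_dx j Ct))).
have D4 i := derive_sumf (index_enum 'I_3)
  (F := fun j q => a66 m i j * (dx i (temp s) q * dx j (temp s) q)) ((0, 1) : W)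
  (fun j => dif (C4 i j)).
have [d5 D5] := derive_sumf (index_enum 'I_3)
  (F := fun i q => \sum_(j < 3) a66 m i j * (dx i (temp s) q * dx j (temp s) q)) ((0, 1) : W)
  (fun i => (D4 i).1).
have E1 : dt (fun q => temp s q * dt (temp s) q) p =
    temp s p * dt (dt (temp s)) p + dt (temp s) p * dt (temp s) p.
  exact: (derive_mul _ d0 d1).
have E2 : dt (fun q => dt (temp s) q * dt (temp s) q) p =
    dt (temp s) p * dt (dt (temp s)) p + dt (temp s) p * dt (dt (temp s)) p.
  exact: (derive_mul _ d1 d1).
have E3 : dt (fun q => temp s q * \sum_(i < 3) a56 m i * dx i (temp s) q) p =
    temp s p * (\sum_i a56 m i * dx i (dt (temp s)) p)
     + (\sum_i a56 m i * dx i (temp s) p) * dt (temp s) p.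
  by rewrite [LHS](derive_mul _ d0 dsum) -dt_a56.
have E4 : dt (fun q => \sum_i \sum_j a66 m i j * (dx i (temp s) q * dx j (temp s) q)) p =
    \sum_i \sum_j a66 m i j * (dx i (temp s) p * dx j (dt (temp s)) p
        + dx j (temp s) p * dx i (dt (temp s)) p).
  rewrite [LHS]D5; apply: eq_bigr => i _; rewrite (D4 i).2; apply: eq_bigr => j _.
  rewrite (derive_scale _ _ (differentiableM (dg i) (dg j))) (derive_mul _ (dg i) (dg j)).
  by rewrite -!dt_dx_temp.
have d4 : differentiable (fun q => 2^-1 * \sum_i \sum_j
    a66 m i j * (dx i (temp s) q * dx j (temp s) q)) p.
  exact: (differentiableM (differentiable_cst _ _) d5).
have S1 := derive_add ((0, 1) : W) (dif (sA (class_C_scale (- (gamma m / beta m)) oOm C1)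
  (class_C_scale (- (2^-1 * gamma m)) oOm C2)))
  (differentiableD (dif (class_C_scale (- (beta m)^-1) oOm C3)) d4).
have S2 := derive_add ((0, 1) : W) (dif (class_C_scale (- (gamma m / beta m)) oOm C1))
  (dif (class_C_scale (- (2^-1 * gamma m)) oOm C2)).
have S3 := derive_add ((0, 1) : W) (dif (class_C_scale (- (beta m)^-1) oOm C3)) d4.
have T1 := derive_scale (- (gamma m / beta m)) ((0, 1) : W) (dif C1).
have T2 := derive_scale (- (2^-1 * gamma m)) ((0, 1) : W) (dif C2).
have T3 := derive_scale (- (beta m)^-1) ((0, 1) : W) (dif C3).
have T4 := derive_scale 2^-1 ((0, 1) : W) d5.
exact: (linear_four S1 S2 S3 T1 T2 T3 T4 E1 E2 E3 E4).
Qed.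

Lemma dt_stored : symmetry_relations m -> dt (stored m s) p =
  (\sum_i (\sum_j tau m s j i p * dx j (dt (disp s i)) p
          + \sum_k \sum_j mu m s k j i p * dx j (dx k (dt (disp s i))) p)
  + (\sum_j sigma m s j p * dx j (dt (pot s)) p
     + \sum_k \sum_j quad m s k j p * dx j (dx k (dt (pot s))) p)
  - vartheta m s p * dt (conjf sT) p)
  + (rho m * \sum_(i < 3) dt (disp s i) p * dt (dt (disp s i)) p
     + dt (thermal_energy m s) p).
Proof.
move=> H.
have Cf := class_C_free_energy oOm m Cu Ct Cp.
have CT := class_C_vartheta oOm m Ct.
have Cc := class_C_conj oOm m Cu Ct Cp sT.
have Ck := class_C_kinetic oOm m Cu.
have CH := class_C_thermal oOm m Ct.
have S1 := derive_add ((0, 1) : W) (dif (class_C_sub_fun oOm Cf (mC CT Cc))) (dif (sA Ck CH)).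
have S2 := derive_sub ((0, 1) : W) (dif Cf) (dif (mC CT Cc)).
have S3 := derive_mul ((0, 1) : W) (dif CT) (dif Cc).
have S4 := derive_add ((0, 1) : W) (dif Ck) (dif CH).
have E1 := dt_free_energy oOm Cu Ct Cp Op H.
have E2 := stress_power oOm Cu Cp Op H.
exact: (stored_rearrange S1 S2 S3 S4 E1 E2 dt_kinetic).
Qed.

End Rate.

(** * The local energy identity *)

Lemma rate_rearrange (R : realType) (D d a b t r P g G x y gs gq z : R) :
  D = (a + (gs + gq) - y) + (r + d) -> d = t -> - y + t + P = g * G -> x = G ->
  b = r + a -> z = 0 -> forall w, D + P = b + (z * w + gs + gq) + g * x.
Proof.
move=> -> -> E -> -> -> w; rewrite -E; ring.
Qed.

Lemma split_rearrange (R : realType) (F a b c k th W G q P e1 e2 : R) :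
  F - a - b - c = W + G + q -> e1 = - a -> e2 = - b -> th + q = P ->
  (F - c) + (k + th) + e1 + e2 = k + W + G + P.
Proof.
move=> E -> -> <-; rewrite (_ : _ + - b = (F - a - b - c) + k + th); last by ring.
by rewrite E; ring.
Qed.

Section Balance.
Context {R : realType}.
Local Notation W := ('rV[R]_3 * R)%type.
Variables (Om : set W) (oOm : open Om) (m : material R) (s : state R).
Hypotheses (Cu : forall i, class_C 4 Om (disp s i)) (Ct : class_C 3 Om (temp s))
  (Cp : class_C 4 Om (pot s)).
Local Notation sC := (class_C_scale _ oOm).
Local Notation sA := (class_C_add oOm).
Local Notation mC := (class_C_mul oOm).
Local Notation conjf := (conj_field m s).
Variables (p : W) (Op : Om p).

Let dif k (f : W -> R) (C : class_C k.+1 Om f) : differentiable f p := C.1 _ Op.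

Lemma dt_entropy : dt (entropy m s) p = - (rho m)^-1 *
  (dt (conjf sT) p + (beta m)^-1 * (gamma m * dt (dt (temp s)) p
     + \sum_i a56 m i * dx i (dt (temp s)) p)).
Proof.
have Cc := class_C_conj oOm m Cu Ct Cp sT.
have Ch := class_C_heat_part oOm m Ct.
have E : entropy m s = fun q => - (rho m)^-1 *
    ((conjf sT q + (beta m)^-1 * heat_part m s q) + alpha4 m).
  by apply/funext => q; rewrite entropyE.
have C1 := class_C_add oOm Cc (class_C_scale (beta m)^-1 oOm Ch).
have C2 := class_C_add oOm C1 (class_C_cst 2 Om (alpha4 m)).
have S1 := derive_scale (- (rho m)^-1) ((0, 1) : W) (dif C2).
have S2 := derive_add ((0, 1) : W) (dif C1) (differentiable_cst (alpha4 m) p).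
have S3 := derive_add ((0, 1) : W) (dif Cc) (dif (class_C_scale (beta m)^-1 oOm Ch)).
have S4 := derive_scale (beta m)^-1 ((0, 1) : W) (dif Ch).
have Cs : class_C 2 Om (fun q => \sum_(i < 3) a56 m i * dx i (temp s) q).
  exact: (class_C_sum (index_enum 'I_3) (P := xpredT) oOm
    (fun i _ => class_C_scale (a56 m i) oOm (class_C_dx i Ct))).
have S5 := derive_add ((0, 1) : W) (dif (class_C_scale (gamma m) oOm (class_C_dt Ct))) (dif Cs).
have S6 := derive_scale (gamma m) ((0, 1) : W) (dif (class_C_dt Ct)).
have S7 := dt_a56 oOm m Ct Op.
rewrite {1}E [LHS]S1 S2 derive_cst addr0 S3 S4.
by rewrite [X in _ + _ * X]S5 S6 -S7.
Qed.

Lemma dx_heat_power i : dx i (fun q => heat_flux m s i q * vartheta m s q) p =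
  heat_flux m s i p * (dx i (temp s) p + beta m * dx i (dt (temp s)) p)
  + vartheta m s p * dx i (heat_flux m s i) p.
Proof.
have Cq := class_C_heat_flux oOm m Ct i; have CT := class_C_vartheta oOm m Ct.
have S1 := derive_mul (Defs.basis R i, 0) (dif Cq) (dif CT).
have S2 := derive_add (Defs.basis R i, 0) (dif Ct) (dif (class_C_scale (beta m) oOm (class_C_dt Ct))).
have S3 := derive_scale (beta m) (Defs.basis R i, 0) (dif (class_C_dt Ct)).
by rewrite [LHS]S1 [X in _ * X + _]S2 S3.
Qed.

(** On the right, the sum over i and the terms in phi have the form handled by
[null_mean_green], for w = u_i' and w = phi', and the rest is a divergence. *)
Lemma energy_rate : symmetry_relations m -> rho m != 0 -> beta m != 0 -> T0 m != 0 ->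
  (forall i, \sum_(j < 3) dx j (tau m s j i) p
        - \sum_(k < 3) \sum_(j < 3) dx j (dx k (mu m s k j i)) p
        = rho m * dt (dt (disp s i)) p) ->
  \sum_(i < 3) dx i (sigma m s i) p
        - \sum_(j < 3) \sum_(i < 3) dx i (dx j (quad m s j i)) p = 0 ->
  rho m * T0 m * dt (entropy m s) p + \sum_(i < 3) dx i (heat_flux m s i) p = 0 ->
  dt (stored m s) p + form_P m (dt (temp s) p) (fun i => dx i (temp s) p) =
  \sum_i ((\sum_j dx j (tau m s j i) p
           - \sum_k \sum_j dx j (dx k (mu m s k j i)) p) * dt (disp s i) p
          + \sum_j tau m s j i p * dx j (dt (disp s i)) p
          + \sum_k \sum_j mu m s k j i p * dx j (dx k (dt (disp s i))) p)
  + ((\sum_j dx j (sigma m s j) p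
       - \sum_k \sum_j dx j (dx k (quad m s k j)) p) * dt (pot s) p
     + \sum_j sigma m s j p * dx j (dt (pot s)) p
     + \sum_k \sum_j quad m s k j p * dx j (dx k (dt (pot s))) p)
  + - (T0 m)^-1 * \sum_i dx i (fun q => heat_flux m s i q * vartheta m s q) p.
Proof.
move=> H r0 b0 t0 b1 b2 b3.
have E1 := dt_stored oOm Cu Ct Cp Op H.
have E2 := dt_thermal oOm m Ct Op.
have b3' : - T0 m * (dt (conjf sT) p + (beta m)^-1 * (gamma m * dt (dt (temp s)) p
     + \sum_i a56 m i * dx i (dt (temp s)) p)) + \sum_i dx i (heat_flux m s i) p = 0.
  rewrite -[RHS]b3 dt_entropy; move: (dt (conjf sT) p + _) (\sum_i dx i _ p) => z y.
  by field.
have E3 := @heat_dissipation R m (fun i => dx i (temp s) p) (fun i => dx i (dt (temp s)) p)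
  (temp s p) (dt (temp s) p) (dt (dt (temp s)) p) (dt (conjf sT) p)
  (fun i => dx i (heat_flux m s i) p) H b0 t0 b3'.
have E4 : \sum_i dx i (fun q => heat_flux m s i q * vartheta m s q) p =
  \sum_i (heat_flux m s i p * (dx i (temp s) p + beta m * dx i (dt (temp s)) p)
  + vartheta m s p * dx i (heat_flux m s i) p).
  by apply: eq_bigr => i _; exact: dx_heat_power.
have E5 : \sum_i ((\sum_j dx j (tau m s j i) p
           - \sum_k \sum_j dx j (dx k (mu m s k j i)) p) * dt (disp s i) p
          + \sum_j tau m s j i p * dx j (dt (disp s i)) p
          + \sum_k \sum_j mu m s k j i p * dx j (dx k (dt (disp s i))) p) =
   rho m * (\sum_(i < 3) dt (disp s i) p * dt (dt (disp s i)) p) +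
   \sum_i (\sum_j tau m s j i p * dx j (dt (disp s i)) p
          + \sum_k \sum_j mu m s k j i p * dx j (dx k (dt (disp s i))) p).
  rewrite mulr_sumr -big_split/=; apply: eq_bigr => i _; rewrite b1 -addrA.
  by congr (_ + _); rewrite -mulrA; congr (_ * _); exact: mulrC.
exact: (rate_rearrange E1 E2 E3 E4 E5 b2).
Qed.

Lemma energy_split : symmetry_relations m -> beta m != 0 ->
  stored m s p + \sum_i sigma m s i p * efield s i p
    + \sum_i \sum_j quad m s i j p * egrad s i j p
  = kinetic_energy m s p
    + form_W m (fun i j => strain s i j p) (fun i j k => kap s i j k p)
    + form_G m (fun i => efield s i p) (fun i j => egrad s i j p) (vartheta m s p)
    + 2^-1 * beta m * form_P m (- (temp s p / beta m)) (fun i => dx i (temp s) p).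
Proof.
move=> H b0.
have L := legendre_free_energy (fun i j => strain s i j p) (fun i j k => kap s i j k p)
  (fun i => efield s i p) (fun i j => egrad s i j p) (vartheta m s p) H.
have E1 : \sum_i sigma m s i p * efield s i p =
    - \sum_i efield s i p * conjugate m (strain_slots m s p) (sE i).
  by rewrite -sumrN; apply: eq_bigr => i _; rewrite sigmaE mulNr mulrC.
have E2 : \sum_i \sum_j quad m s i j p * egrad s i j p =
    - \sum_i \sum_j egrad s i j p * conjugate m (strain_slots m s p) (sV i j).
  rewrite -sumrN; apply: eq_bigr => i _; rewrite -sumrN; apply: eq_bigr => j _.
  by rewrite quadE mulNr mulrC.
have E3 : thermal_energy m s p + 2^-1 * (gamma m / beta m ^+ 2) * vartheta m s p ^+ 2 =
    2^-1 * beta m * form_P m (- (temp s p / beta m)) (fun i => dx i (temp s) p).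
  rewrite /thermal_energy /form_P /vartheta.
  have -> : \sum_i a56 m i * - (temp s p / beta m) * dx i (temp s) p =
     - (temp s p / beta m) * \sum_i a56 m i * dx i (temp s) p.
    by rewrite mulr_sumr; apply: eq_bigr => i _; move: (dx i _ p) (temp s p / _) => x y; ring.
  have -> : \sum_i \sum_j a66 m i j * (dx i (temp s) p * dx j (temp s) p) =
     \sum_i \sum_j a66 m i j * dx i (temp s) p * dx j (temp s) p.
    by apply: eq_bigr => i _; apply: eq_bigr => j _; rewrite mulrA.
  move: (\sum_i \sum_j a66 m i j * dx i (temp s) p * dx j (temp s) p) => z1.
  move: (\sum_i a56 m i * dx i (temp s) p) => z2.
  move: (temp s p) (dt (temp s) p) (gamma m) => z3 z4 z5.
  by field.
have L' : free_energy_field m s p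
    - \sum_i efield s i p * conjugate m (strain_slots m s p) (sE i)
    - \sum_i \sum_j egrad s i j p * conjugate m (strain_slots m s p) (sV i j)
    - vartheta m s p * conj_field m s sT p =
    form_W m (fun i j => strain s i j p) (fun i j k => kap s i j k p)
    + form_G m (fun i => efield s i p) (fun i j => egrad s i j p) (vartheta m s p)
    + 2^-1 * (gamma m / beta m ^+ 2) * vartheta m s p ^+ 2 by exact: L.
rewrite /stored; exact: (split_rearrange _ L' E1 E2 E3).
Qed.

End Balance.

(** * Null means of fields at a fixed time *)

Lemma integrand_congr (R : realType) (i a a' b b' c c' d d' w : R) :
  a = a' -> b = b' -> c = c' -> d = d' ->
  i * ((a - b) * w + c + d) = i * ((a' - b') * w + c' + d').
Proof. by move=> -> -> -> ->. Qed.

Lemma boundary_congr (R : realType) (a a' b b' c c' d d' e e' w : R) :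
  a = a' -> b = b' -> c = c' -> d = d' -> e = e' ->
  (a - b + c * d) * w + d * e = (a' - b' + c' * d') * w + d' * e'.
Proof. by move=> -> -> -> -> ->. Qed.

Section SurfaceForce.
Context {R : realType}.
Local Notation V := 'rV[R]_3.
Local Notation W := ('rV[R]_3 * R)%type.
Implicit Types (sg : 'I_3 -> W -> R) (h : 'I_3 -> 'I_3 -> W -> R) (w : W -> R).

(** The common form of each component of surf_P, which acts on u, and of
surf_Lambda, which acts on phi. *)
Definition surface_force (n : 'I_3 -> V -> R) sg h : W -> R := fun p =>
  \sum_(j < 3) (sg j p - \sum_(k < 3) dx k (h k j) p) * n j p.1
  - \sum_(j < 3) \sum_(k < 3) surf_grad n j (fun q => h k j q * n k q.1) p
  + surf_div_normal n p * \sum_(k < 3) \sum_(j < 3) h k j p * n k p.1 * n j p.1.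

Definition surface_moment (n : 'I_3 -> V -> R) h : W -> R := fun p =>
  \sum_(k < 3) \sum_(j < 3) h k j p * n k p.1 * n j p.1.

Lemma derive_slice_fun (f : W -> R) (t : R) (k : 'I_3) :
  'D_(Defs.basis R k) (fun y => f (y, t)) = fun y => dx k f (y, t).
Proof. by apply/funext => y; exact: derive_slice. Qed.

Variables (M : R) (M0 : 0 < M) (B : set V) (n : 'I_3 -> V -> R).
Hypotheses (oB : open B) (BM : forall x, B x -> `|x| < M) (cB : compact (closure B)).
Hypothesis Bsmooth : forall x, bd B x -> exists U psi, U x /\ local_defining_function B U psi.
Hypothesis nP : outward_unit_normal B n.
Variables (Om : set W) (oOm : open Om).

Lemma null_mean_green_field sg h w t : (forall x, closure B x -> Om (x, t)) ->
  (forall j, class_C 1 Om (sg j)) -> (forall k j, class_C 2 Om (h k j)) -> class_C 2 Om w ->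
  (forall x, bd B x -> surface_force n sg h (x, t) * w (x, t)
     + surface_moment n h (x, t) * normal_deriv n w (x, t) = 0) ->
  null_mean M (fun x => \1_B x *
    ((\sum_j dx j (sg j) (x, t) - \sum_k \sum_j dx j (dx k (h k j)) (x, t)) * w (x, t)
     + \sum_j sg j (x, t) * dx j w (x, t)
     + \sum_k \sum_j h k j (x, t) * dx j (dx k w) (x, t))).
Proof.
move=> BOm Csg Ch Cw BC.
have G := @null_mean_green R M M0 B n oB BM cB Bsmooth nP [set x | Om (x, t)]
  (fun j x => sg j (x, t)) (fun k j x => h k j (x, t)) (fun x => w (x, t))
  (open_slice t oOm) BOm (fun j => class_C_slice t (Csg j))
  (fun k j => class_C_slice t (Ch k j)) (class_C_slice t Cw).
have D1 (f : W -> R) j x : 'D_(Defs.basis R j) (fun y => f (y, t)) x = dx j f (x, t).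
  exact: derive_slice.
have D2 (f : W -> R) j k x :
    'D_(Defs.basis R j) ('D_(Defs.basis R k) (fun y => f (y, t))) x = dx j (dx k f) (x, t).
  by rewrite derive_slice_fun; exact: D1.
apply: null_mean_ext (G _) => [x|{G} x bx].
  apply: integrand_congr.
  - by apply: eq_bigr => j _; exact: D1.
  - by apply: eq_bigr => k _; apply: eq_bigr => j _; exact: D2.
  - by apply: eq_bigr => j _; rewrite D1.
  - by apply: eq_bigr => k _; apply: eq_bigr => j _; rewrite D2.
apply: etrans (BC _ bx); apply: boundary_congr.
- by apply: eq_bigr => j _; rewrite (eq_bigr _ (fun k _ => D1 (h k j) k x)).
- apply: eq_bigr => j _; apply: eq_bigr => k _; apply: eq_bigr => i _.
  by rewrite (D1 (fun q => h k j q * n k q.1)).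
- apply: eq_bigr => l _; apply: eq_bigr => i _.
  by rewrite -(D1 (fun q => n l q.1)).
- by [].
- by apply: eq_bigr => i _; rewrite D1.
Qed.

(** Termwise, as the mean is a finite sum. *)
Lemma is_derive_mean N (f : W -> R) t : (forall x, B x -> differentiable f (x, t)) ->
  is_derive t 1 (fun r => mean M N (fun x => \1_B x * f (x, r)))
    (mean M N (fun x => \1_B x * dt f (x, t))).
Proof.
move=> df.
have H (x : V) : differentiable (fun r : R => \1_B x * f (x, r)) t /\
    'D_1 (fun r : R => \1_B x * f (x, r)) t = \1_B x * dt f (x, t).
  have [Bx|Bx] := pselect (B x).
    have D := is_derive_time (df _ Bx).
    have d : differentiable (fun r => f (x, r)) t by apply/derivable1_diffP; case: D.
    split; first exact: (differentiableM (differentiable_cst _ _) d).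
    by rewrite (derive_scale _ _ d) (@derive_val _ _ _ _ _ _ _ D).
  rewrite (_ : (fun r => _) = fun=> 0); last by apply/funext => r; rewrite ind0// mul0r.
  by split; [exact: differentiable_cst|rewrite derive_cst ind0// mul0r].
have [d1 D1] := derive_sumf (index_enum {ffun 'I_3 -> 'I_N.+1})
  (F := fun k r => \1_B (grid M k) * f (grid M k, r)) (1 : R) (fun k => (H (grid M k)).1).
have d2 := differentiableM (differentiable_cst ((N.+1%:R ^+ 3)^-1 : R) t) d1.
apply: DeriveDef; first by apply/derivable1_diffP; exact: d2.
rewrite [LHS](derive_scale _ _ d1) D1; congr (_ * _).
by apply: eq_bigr => k _; exact: (H _).2.
Qed.

End SurfaceForce.

(** * The energy of a process without data vanishes *)

Lemma ind_eq (R : realType) (T : Type) (B : set T) x (y z : R) :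
  (B x -> y = z) -> \1_B x * y = \1_B x * z.
Proof.
have [Bx|Bx] := pselect (B x); first by move=> ->.
by move=> _; rewrite (_ : \1_B x = 0 :> R) ?mul0r// indicE memNset.
Qed.

Lemma factor_sum (R : realType) (c g b d : R) (A : 'I_3 -> R) :
  \sum_i c * A i + c * b + g * (c * d) = c * (\sum_i A i + b + g * d).
Proof. by rewrite -mulr_sumr; ring. Qed.

Lemma electric_rearrange (R : realType) (a w e1 e2 x y : R) :
  a = 0 -> e1 = - x -> e2 = - y -> - 1 * (a * w + e1 + e2) = x + y.
Proof. by move=> -> -> ->; ring. Qed.

Lemma sum4_eq0 (R : realType) (a b c d : R) : 0 <= a -> 0 <= b -> 0 <= c -> 0 <= d ->
  a + b + c + d = 0 -> a = 0 /\ c = 0.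
Proof. by move=> a0 b0 c0 d0 E; split; lra. Qed.

Lemma mvt_bound (R : realType) (a b d e t : R) :
  a - b = d * t -> d <= e / 2 / t -> `|b| <= e / 2 -> 0 < t -> a <= e.
Proof.
move=> E; move=> dle be t0; have : d * t <= e / 2 by rewrite -ler_pdivlMr.
by have := ler_norm b; lra.
Qed.

Lemma sum_bound (R : realType) (a b e : R) :
  0 <= a + b -> a <= e / 2 -> `|b| <= e / 2 -> `|a + b| <= e.
Proof. by move=> ab a1 b1; rewrite ger0_norm//; have := ler_norm b; lra. Qed.

Section Homogeneous.
Context {R : realType}.
Local Notation V := 'rV[R]_3.
Local Notation W := ('rV[R]_3 * R)%type.
Variables (M : R) (M0 : 0 < M) (B : set V) (n : 'I_3 -> V -> R).
Hypotheses (oB : open B) (BM : forall x, B x -> `|x| < M) (cB : compact (closure B)).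
Hypothesis Bsmooth : forall x, bd B x -> exists U psi, U x /\ local_defining_function B U psi.
Hypothesis nP : outward_unit_normal B n.
Variables (m : material R) (s : state R) (Om : set W) (oOm : open Om).
Hypotheses (Cu : forall i, class_C 4 Om (disp s i)) (Ct : class_C 3 Om (temp s))
  (Cp : class_C 4 Om (pot s)).
Hypotheses (hP : P_nonnegative m) (hrho : 0 < rho m) (hbeta : 0 < beta m) (hT0 : 0 < T0 m)
  (H : symmetry_relations m) (hW : W_positive_semidefinite m) (hG : G_positive_definite m).
Variable T : R.
Hypothesis T_ge0 : 0 <= T.
Hypothesis BOm : forall x t, closure B x -> 0 <= t <= T -> Om (x, t).
Hypothesis bal : forall x t, B x -> 0 <= t <= T ->
  [/\ forall i, \sum_(j < 3) dx j (tau m s j i) (x, t)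
        - \sum_(k < 3) \sum_(j < 3) dx j (dx k (mu m s k j i)) (x, t)
        = rho m * dt (dt (disp s i)) (x, t),
      \sum_(i < 3) dx i (sigma m s i) (x, t)
        - \sum_(j < 3) \sum_(i < 3) dx i (dx j (quad m s j i)) (x, t) = 0
    & rho m * T0 m * dt (entropy m s) (x, t)
        + \sum_(i < 3) dx i (heat_flux m s i) (x, t) = 0].
Hypothesis init : forall x, B x ->
  [/\ forall i, disp s i (x, 0) = 0, forall i, dt (disp s i) (x, 0) = 0,
      temp s (x, 0) = 0 & entropy m s (x, 0) = - (rho m)^-1 * alpha4 m].
Hypothesis bc_disp : forall i x t, bd B x -> 0 <= t <= T ->
  surf_P m n s i (x, t) * dt (disp s i) (x, t)
  + surf_R m n s i (x, t) * normal_deriv n (dt (disp s i)) (x, t) = 0.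
Hypothesis bc_pot : forall x t, bd B x -> 0 <= t <= T ->
  surf_Lambda m n s (x, t) * pot s (x, t)
  + surf_H m n s (x, t) * normal_deriv n (pot s) (x, t) = 0.
Hypothesis bc_dpot : forall x t, bd B x -> 0 <= t <= T ->
  surf_Lambda m n s (x, t) * dt (pot s) (x, t)
  + surf_H m n s (x, t) * normal_deriv n (dt (pot s)) (x, t) = 0.
Hypothesis bc_heat : forall x t, bd B x -> 0 <= t <= T ->
  (\sum_(i < 3) heat_flux m s i (x, t) * n i x) * vartheta m s (x, t) = 0.

Let clB x : B x -> closure B x := @subset_closure _ B x.

(** The rate of the stored energy plus the dissipation P. Its mean tends to zero,
so that the stored energy cannot increase in the limit. *)
Definition rate_excess : W -> R := fun p =>
  dt (stored m s) p + form_P m (dt (temp s) p) (fun i => dx i (temp s) p).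

Definition electric_work : W -> R := fun p =>
  \sum_i sigma m s i p * efield s i p + \sum_i \sum_j quad m s i j p * egrad s i j p.

Lemma class_C_rate_excess : class_C 0 Om rate_excess.
Proof.
have C0 := class_C_lt (class_C_dt (class_C_stored oOm m Cu Ct Cp)).
have Cd := class_C_lt (class_C_lt (class_C_dt Ct)).
have Cg i := class_C_lt (class_C_lt (class_C_dx i Ct)).
have Ca := class_C_sum (index_enum 'I_3) (P := xpredT) oOm
  (fun i _ => class_C_mul oOm (class_C_scale (a56 m i) oOm Cd) (Cg i)).
have Cb := class_C_sum (index_enum 'I_3) (P := xpredT) oOm (fun i _ =>
  class_C_sum (index_enum 'I_3) (P := xpredT) oOm
  (fun j _ => class_C_mul oOm (class_C_scale (a66 m i j) oOm (Cg i)) (Cg j))).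
have Cc := class_C_scale (gamma m) oOm (class_C_mul oOm Cd Cd).
have C := class_C_add oOm C0 (class_C_scale (beta m)^-1 oOm
  (class_C_add oOm (class_C_add oOm Cc (class_C_scale 2 oOm Ca)) Cb)).
rewrite (_ : rate_excess = fun p => dt (stored m s) p + (beta m)^-1 *
  (gamma m * (dt (temp s) p * dt (temp s) p)
   + 2 * (\sum_i a56 m i * dt (temp s) p * dx i (temp s) p)
   + \sum_i \sum_j a66 m i j * dx i (temp s) p * dx j (temp s) p)); first exact: C.
by apply/funext => p; rewrite /rate_excess /form_P expr2.
Qed.

Lemma null_mean_rate_excess t : 0 <= t <= T ->
  null_mean M (fun x => \1_B x * rate_excess (x, t)).
Proof.
move=> tT; have BO x (bx : closure B x) := BOm bx tT.
have G1 i := null_mean_green_field M0 oB BM cB Bsmooth nP oOm (t := t)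
  (sg := fun j => tau m s j i) (h := fun k j => mu m s k j i) (w := dt (disp s i))
  BO (fun j => class_C_lt (class_C_tau oOm m Cu Ct Cp j i))
  (fun k j => class_C_mu oOm m Cu Ct Cp k j i) (class_C_lt (class_C_dt (Cu i)))
  (fun x bx => bc_disp i bx tT).
have G2 := null_mean_green_field M0 oB BM cB Bsmooth nP oOm (t := t)
  (sg := sigma m s) (h := quad m s) (w := dt (pot s))
  BO (fun j => class_C_lt (class_C_sigma oOm m Cu Ct Cp j))
  (fun k j => class_C_quad oOm m Cu Ct Cp k j) (class_C_lt (class_C_dt Cp))
  (fun x bx => bc_dpot bx tT).
have Cq i : class_C 1 Om (fun q => heat_flux m s i q * vartheta m s q).
  exact: (class_C_mul oOm (class_C_lt (class_C_heat_flux oOm m Ct i))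
    (class_C_lt (class_C_vartheta oOm m Ct))).
have G3 := null_mean_divergence M0 oB BM cB Bsmooth nP.2 (O := [set x | Om (x, t)])
  (F := fun i x => heat_flux m s i (x, t) * vartheta m s (x, t))
  (open_slice t oOm) BO (fun i => class_C_slice t (Cq i)).
have {}G3 : null_mean M (fun x => \1_B x *
    \sum_i dx i (fun q => heat_flux m s i q * vartheta m s q) (x, t)).
  apply: null_mean_ext (G3 _) => [x|x bx].
    apply: ind_eq => _; apply: eq_bigr => i _.
    exact: (derive_slice (fun q => heat_flux m s i q * vartheta m s q)).
  rewrite -[RHS](bc_heat bx tT) mulr_suml; apply: eq_bigr => i _; exact: mulrAC.
have N := null_meanD (null_meanD (null_mean_sum (index_enum 'I_3) G1) G2)
  (null_mean_scale (- (T0 m)^-1) G3).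
apply: null_mean_ext N => x; apply: etrans (factor_sum _ _ _ _ _) _.
apply: ind_eq => Bx; have [b1 b2 b3] := bal Bx tT.
exact: (esym (energy_rate oOm Cu Ct Cp (BO _ (clB Bx)) H (lt0r_neq0 hrho)
  (lt0r_neq0 hbeta) (lt0r_neq0 hT0) b1 b2 b3)).
Qed.

(** The equation of charge multiplied by phi. *)
Lemma null_mean_electric t : 0 <= t <= T ->
  null_mean M (fun x => \1_B x * electric_work (x, t)).
Proof.
move=> tT; have BO x (bx : closure B x) := BOm bx tT.
have G2 := null_mean_green_field M0 oB BM cB Bsmooth nP oOm (t := t)
  (sg := sigma m s) (h := quad m s) (w := pot s)
  BO (fun j => class_C_lt (class_C_sigma oOm m Cu Ct Cp j))
  (fun k j => class_C_quad oOm m Cu Ct Cp k j) (class_C_lt (class_C_lt Cp))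
  (fun x bx => bc_pot bx tT).
apply: null_mean_ext (null_mean_scale (- 1) G2) => x.
apply: etrans (mulrCA _ _ _) _; apply: ind_eq => Bx.
have [_ b2 _] := bal Bx tT; have Op := BO _ (clB Bx).
have E1 : \sum_j sigma m s j (x, t) * dx j (pot s) (x, t) =
    - \sum_i sigma m s i (x, t) * efield s i (x, t).
  by rewrite -sumrN; apply: eq_bigr => i _; rewrite /efield mulrN opprK.
have E2 : \sum_k \sum_j quad m s k j (x, t) * dx j (dx k (pot s)) (x, t) =
    - \sum_i \sum_j quad m s i j (x, t) * egrad s i j (x, t).
  rewrite -sumrN; apply: eq_bigr => i _; rewrite -sumrN; apply: eq_bigr => j _.
  have -> : egrad s i j (x, t) = - dx j (dx i (pot s)) (x, t).
    by rewrite [LHS]deriveN//; apply/diff_derivable; exact: (class_C_dx i Cp).1.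
  by rewrite mulrN opprK.
exact: (electric_rearrange _ b2 E1 E2).
Qed.

(** Only E, V and theta' may be nonzero at time 0. The value of the entropy
determines the conjugate of Theta, namely - gamma theta' / beta, which makes
the terms in theta' cancel. *)
Lemma stored_initial x : B x -> stored m s (x, 0) = - 2^-1 * electric_work (x, 0).
Proof.
move=> Bx; have [u0 v0 t0 n0] := init Bx.
have sl0 (f : W -> R) i : (forall y, B y -> f (y, 0) = 0) -> forall y, B y -> dx i f (y, 0) = 0.
  move=> f0 y By; rewrite /dx -derive_slice.
  rewrite (near_eq_derive _ (g := fun=> 0)) ?derive_cst//.
  by apply: (open_near oB By).
have e0 i j : strain s i j (x, 0) = 0.
  have Z k l : dx k (disp s l) (x, 0) = 0.
    by apply: sl0 => // y By; have [h _ _ _] := init By.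
  by rewrite /strain !Z addr0 mulr0.
have k0 i j k : kap s i j k (x, 0) = 0.
  by apply: (sl0 _ _ _ _ Bx) => y; apply: sl0 => z Bz; have [h _ _ _] := init Bz.
have g0 i : dx i (temp s) (x, 0) = 0.
  by apply: (sl0 _ _ _ _ Bx) => z Bz; have [_ _ h _] := init Bz.
have kin0 : kinetic_energy m s (x, 0) = 0.
  by rewrite /kinetic_energy big1 ?mulr0// => i _; rewrite v0 mul0r.
have S1 : \sum_i a56 m i * dx i (temp s) (x, 0) = 0.
  by rewrite big1// => i _; rewrite g0 mulr0.
have S2 : \sum_i \sum_j a66 m i j * (dx i (temp s) (x, 0) * dx j (temp s) (x, 0)) = 0.
  by rewrite big1// => i _; rewrite big1// => j _; rewrite g0 mul0r mulr0.
have cT : conj_field m s sT (x, 0) = - (beta m)^-1 * (gamma m * dt (temp s) (x, 0)).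
  move: n0; rewrite entropyE S1 addr0 -/(conj_field m s sT (x, 0)).
  move/(mulfI _) => /(_ _)/eqP; rewrite oppr_eq0 invr_eq0 (gt_eqF hrho) => /(_ isT).
  by move/eqP/(canRL (addrK _)); rewrite subrr => /eqP; rewrite addr_eq0 mulNr => /eqP.
have F : free_energy_field m s (x, 0) = 2^-1 * (- electric_work (x, 0)
    + vartheta m s (x, 0) * conj_field m s sT (x, 0)).
  congr (_ * _).
  apply: etrans (sum_slot (fun a => slot_field m s a (x, 0) * conj_field m s a (x, 0))) _.
  rewrite big1 ?add0r => [|i _]; last first.
    rewrite big1// => j _.
    by rewrite [X in X * _](_ : _ = 0) ?mul0r//; exact: e0.
  rewrite big1 ?add0r => [|i _]; last first.
    rewrite big1// => j _; rewrite big1// => k _.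
    by rewrite [X in X * _](_ : _ = 0) ?mul0r//; exact: k0.
  congr (_ + _); rewrite /electric_work opprD -!sumrN; congr (_ + _).
    apply: eq_bigr => i _.
    have -> : conj_field m s (sE i) (x, 0) = - sigma m s i (x, 0) by rewrite sigmaE opprK.
    by rewrite mulrN; congr (- _); exact: mulrC.
  apply: eq_bigr => i _; rewrite -sumrN; apply: eq_bigr => j _.
  have -> : conj_field m s (sV i j) (x, 0) = - quad m s i j (x, 0) by rewrite quadE opprK.
  by rewrite mulrN; congr (- _); exact: mulrC.
rewrite /stored kin0 F /thermal_energy S1 S2 cT /vartheta t0.
move: (electric_work _) (dt _ _) (gamma m) => w z g.
by field; rewrite gt_eqF.
Qed.

Definition total : W -> R := fun p => stored m s p + electric_work p.

Lemma total_split p : Om p -> total p = kinetic_energy m s p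
    + form_W m (fun i j => strain s i j p) (fun i j k => kap s i j k p)
    + form_G m (fun i => efield s i p) (fun i j => egrad s i j p) (vartheta m s p)
    + 2^-1 * beta m * form_P m (- (temp s p / beta m)) (fun i => dx i (temp s) p).
Proof.
move=> Op; apply: etrans (addrA _ _ _) _.
exact: (energy_split s p H (lt0r_neq0 hbeta)).
Qed.

Lemma kinetic_ge0 p : 0 <= kinetic_energy m s p.
Proof.
rewrite mulr_ge0 ?mulr_ge0 ?(ltW hrho)//; apply: sumr_ge0 => i _.
by rewrite -expr2 sqr_ge0.
Qed.

Lemma egrad_sym p i j : Om p -> egrad s i j p = egrad s j i p.
Proof.
have E k l : Om p -> egrad s k l p = - dx l (dx k (pot s)) p.
  by move=> Op; rewrite [LHS]deriveN//; apply/diff_derivable; exact: (class_C_dx k Cp).1.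
move=> Op; have S : dx j (dx i (pot s)) p = dx i (dx j (pot s)) p.
  exact: (schwarz _ _ oOm (class_C_lt (class_C_lt Cp)) Op).
exact: (etrans (E i j Op) (etrans (congr1 -%R S) (esym (E j i Op)))).
Qed.

Lemma form_W_ge0 p : Om p ->
  0 <= form_W m (fun i j => strain s i j p) (fun i j k => kap s i j k p).
Proof.
move=> Op; apply: hW => [i j|i j k]; first by rewrite /strain addrC.
exact: (schwarz _ _ oOm (class_C_lt (class_C_lt (Cu k))) Op).
Qed.

Lemma form_G_gt0 p : Om p ->
  ~ [/\ forall i, efield s i p = 0, forall i j, egrad s i j p = 0 & vartheta m s p = 0] ->
  0 < form_G m (fun i => efield s i p) (fun i j => egrad s i j p) (vartheta m s p).
Proof. by move=> Op; apply: hG => i j; exact: egrad_sym. Qed.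

Lemma form_G_ge0 p : Om p ->
  0 <= form_G m (fun i => efield s i p) (fun i j => egrad s i j p) (vartheta m s p).
Proof.
move=> Op; have [[E0 V0 T0]|/(form_G_gt0 Op)/ltW//] := pselect
  [/\ forall i, efield s i p = 0, forall i j, egrad s i j p = 0 & vartheta m s p = 0].
rewrite /form_G T0 !big1 ?mulr0 ?subr0 ?expr0n ?mulr0 ?subr0// => i _; rewrite ?mulr0//.
all: rewrite ?big1 ?mulr0// => j _; rewrite ?V0 ?E0 ?mulr0//.
all: rewrite ?big1// => k _; rewrite ?V0 ?mulr0//.
all: by rewrite ?big1// => l _; rewrite ?V0 ?mulr0.
Qed.

Lemma form_P_part_ge0 p :
  0 <= 2^-1 * beta m * form_P m (- (temp s p / beta m)) (fun i => dx i (temp s) p).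
Proof. by apply: mulr_ge0; [rewrite mulr_ge0// ltW|exact: hP]. Qed.

Lemma total_ge0 p : Om p -> 0 <= total p.
Proof.
move=> Op; rewrite total_split//; apply: addr_ge0 (form_P_part_ge0 p).
exact: addr_ge0 (addr_ge0 (kinetic_ge0 p) (form_W_ge0 Op)) (form_G_ge0 Op).
Qed.

(** Kinetic energy and G vanish separately; G is definite. *)
Lemma total_eq0 p : Om p -> total p = 0 ->
  [/\ forall i, dt (disp s i) p = 0, vartheta m s p = 0 & forall i, dx i (pot s) p = 0].
Proof.
move=> Op; rewrite total_split// => Z.
have [K0 G0] := sum4_eq0 (kinetic_ge0 p) (form_W_ge0 Op) (form_G_ge0 Op) (form_P_part_ge0 p) Z.
have [E0 _ T0] : [/\ forall i, efield s i p = 0, forall i j, egrad s i j p = 0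
    & vartheta m s p = 0].
  by apply: contrapT => /(form_G_gt0 Op); rewrite G0 ltxx.
split=> // i; last by have /eqP := E0 i; rewrite oppr_eq0 => /eqP.
have r0 : 2^-1 * rho m != 0 by rewrite mulf_neq0// gt_eqF.
move/eqP: K0; rewrite mulf_eq0 (negbTE r0)/= => /eqP K0.
have F0 (j : 'I_3) : true -> 0 <= dt (disp s j) p * dt (disp s j) p.
  by move=> _; rewrite -expr2 sqr_ge0.
have Z0 : dt (disp s i) p * dt (disp s i) p = 0 := psumr_eq0P F0 K0 (isT : true).
by apply/eqP; rewrite -sqrf_eq0 expr2 Z0.
Qed.

Lemma class_C_total : class_C 0 Om total.
Proof.
have C1 := class_C_sum (index_enum 'I_3) (P := xpredT) oOm (fun i _ =>
  class_C_mul oOm (class_C_sigma oOm m Cu Ct Cp i) (class_C_lt (class_C_efield oOm Cp i))).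
have C2 := class_C_sum (index_enum 'I_3) (P := xpredT) oOm (fun i _ =>
  class_C_sum (index_enum 'I_3) (P := xpredT) oOm (fun j _ =>
  class_C_mul oOm (class_C_quad oOm m Cu Ct Cp i j) (class_C_egrad oOm Cp i j))).
exact: (class_C_lt (class_C_lt (class_C_add oOm (class_C_stored oOm m Cu Ct Cp)
  (class_C_add oOm C1 C2)))).
Qed.

Lemma null_mean_stored0 : null_mean M (fun x => \1_B x * stored m s (x, 0)).
Proof.
have T0T : (0 : R) <= 0 <= T by rewrite lexx.
apply: null_mean_ext (null_mean_scale (- 2^-1) (null_mean_electric T0T)) => x.
apply: etrans (mulrCA _ _ _) _; apply: ind_eq => Bx; exact: esym (stored_initial Bx).
Qed.

(** The mean value theorem in time on a fixed grid, then the uniform bound on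
the means of [rate_excess]. *)
Lemma mean_stored_le e : 0 < e -> \forall N \near \oo,
  mean M N (fun x => \1_B x * stored m s (x, T)) <= e.
Proof.
move=> e0; have e20 : 0 < e / 2 by rewrite divr_gt0.
have [->|T_neq0] := eqVneq T 0.
  apply: filterS (null_mean_stored0 e0) => N; apply: le_trans; exact: ler_norm.
have T_gt0 : 0 < T by rewrite lt_neqAle eq_sym T_neq0.
have eT : 0 < e / 2 / T by rewrite divr_gt0.
have U := @null_mean_uniform R M B rate_excess T cB
  (fun x t cx tT => class_C_rate_excess (BOm cx tT)) null_mean_rate_excess _ eT.
apply: filterS2 U (null_mean_stored0 e20) => N UN S0.
have Cs := class_C_stored oOm m Cu Ct Cp.
have D t : 0 <= t <= T -> is_derive t 1 (fun r => mean M N (fun x => \1_B x * stored m s (x, r)))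
    (mean M N (fun x => \1_B x * dt (stored m s) (x, t))).
  by move=> tT; apply: is_derive_mean => x Bx; exact: (Cs.1 _ (BOm (clB Bx) tT)).
have [||c] := @MVT_segment R (fun t => mean M N (fun x => \1_B x * stored m s (x, t))) (fun t => mean M N (fun x => \1_B x * dt (stored m s) (x, t)))
  0 T T_ge0.
- by move=> t; rewrite in_itv/= => /andP[t0 tT]; apply: D; rewrite !ltW.
- apply: derivable_within_continuous => t; rewrite in_itv/= => tT.
  by have [] := D t tT.
rewrite in_itv/= => cT; rewrite subr0 => E.
have le1 : mean M N (fun x => \1_B x * dt (stored m s) (x, c)) <= e / 2 / T.
  apply: le_trans (le_trans (ler_norm _) (UN c cT)); apply: mean_le => k.
  by rewrite ler_wpM2l ?ind_ge0// lerDl hP.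
exact: (mvt_bound E le1 S0 T_gt0).
Qed.

(** The mean of a nonnegative function is bounded by two quantities that tend
to zero. *)
Theorem energy_vanishes x : B x ->
  [/\ forall i, dt (disp s i) (x, T) = 0, vartheta m s (x, T) = 0
    & forall i, dx i (pot s) (x, T) = 0].
Proof.
have TT : 0 <= T <= T by rewrite T_ge0 lexx.
move=> Bx; have Op := BOm (clB Bx) TT; apply: total_eq0 => //.
have NT : null_mean M (fun x => \1_B x * total (x, T)).
  move=> e e0; have e20 : 0 < e / 2 by rewrite divr_gt0.
  apply: filterS2 (mean_stored_le e20) (null_mean_electric TT e20) => N SN EN.
  have -> : mean M N (fun x => \1_B x * total (x, T)) =
      mean M N (fun x => \1_B x * stored m s (x, T)) +
      mean M N (fun x => \1_B x * electric_work (x, T)).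
    by rewrite -mean_add; apply: mean_eq => y; exact: mulrDr.
  have ge0 : 0 <= mean M N (fun x => \1_B x * stored m s (x, T)) +
      mean M N (fun x => \1_B x * electric_work (x, T)).
    rewrite -mean_add -(mean_cst M N 0); apply: mean_le => k; rewrite -mulrDr.
    have [Bk|Bk] := pselect (B (grid M k)); last by rewrite ind0// mul0r.
    by rewrite ind1// mul1r; apply: total_ge0; exact: (BOm (clB Bk) TT).
  exact: (sum_bound ge0 SN EN).
have cf y : B y -> {for y, continuous (fun z => total (z, T))}.
  by move=> By; apply: (class_C_slice T class_C_total); exact: (BOm (clB By) TT).
have f0 y : B y -> 0 <= total (y, T).
  by move=> By; apply: total_ge0; exact: (BOm (clB By) TT).
exact: (null_mean_nonneg M0 oB BM cf f0 NT).
Qed.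

End Homogeneous.

(** * The difference of two states *)

Lemma surface_rearrange (R : realType) (a a1 a2 b b1 b2 c c1 c2 : R) :
  a = a1 - a2 -> b = b1 - b2 -> c = c1 - c2 -> forall k,
  a - b + k * c = (a1 - b1 + k * c1) - (a2 - b2 + k * c2).
Proof. by move=> -> -> -> k; ring. Qed.

Section Difference.
Context {R : realType}.
Local Notation V := 'rV[R]_3.
Local Notation W := ('rV[R]_3 * R)%type.

Definition state_sub (s s' : state R) : state R :=
  State (fun i p => disp s i p - disp s' i p) (fun p => temp s p - temp s' p)
        (fun p => pot s p - pot s' p).

Variables (Om : set W) (oOm : open Om).

Definition is_diff_on (f g h : W -> R) := forall p, Om p -> f p = g p - h p.

Lemma is_diff_on_derive f g h v : is_diff_on f g h -> class_C 1 Om g -> class_C 1 Om h ->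
  is_diff_on ('D_v f) ('D_v g) ('D_v h).
Proof.
move=> fgh Cg Ch p Op; rewrite -(derive_sub _ (Cg.1 _ Op) (Ch.1 _ Op)).
by apply: near_eq_derive; exact: (open_near oOm Op).
Qed.

Lemma is_diff_on_dx f g h i : is_diff_on f g h -> class_C 1 Om g -> class_C 1 Om h ->
  is_diff_on (dx i f) (dx i g) (dx i h).
Proof. exact: is_diff_on_derive. Qed.

Lemma is_diff_on_dt f g h : is_diff_on f g h -> class_C 1 Om g -> class_C 1 Om h ->
  is_diff_on (dt f) (dt g) (dt h).
Proof. exact: is_diff_on_derive. Qed.

Lemma is_diff_on_scale f g h (c : R) : is_diff_on f g h ->
  is_diff_on (fun p => c * f p) (fun p => c * g p) (fun p => c * h p).
Proof. by move=> fgh p Op; rewrite fgh// mulrBr. Qed.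

Lemma is_diff_on_add f g h f' g' h' : is_diff_on f g h -> is_diff_on f' g' h' ->
  is_diff_on (fun p => f p + f' p) (fun p => g p + g' p) (fun p => h p + h' p).
Proof. by move=> fgh fgh' p Op; rewrite fgh// fgh'// opprD addrACA. Qed.

Lemma is_diff_on_opp f g h : is_diff_on f g h ->
  is_diff_on (fun p => - f p) (fun p => - g p) (fun p => - h p).
Proof. by move=> fgh p Op; rewrite fgh// opprD. Qed.

Lemma is_diff_on_sum (I : Type) (r : seq I) (f g h : I -> W -> R) :
  (forall i, is_diff_on (f i) (g i) (h i)) ->
  is_diff_on (fun p => \sum_(i <- r) f i p) (fun p => \sum_(i <- r) g i p)
     (fun p => \sum_(i <- r) h i p).
Proof. by move=> fgh p Op; rewrite -sumrB; apply: eq_bigr => i _; exact: fgh. Qed.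

Lemma is_diff_on_mull f g h (k : W -> R) : is_diff_on f g h ->
  is_diff_on (fun p => k p * f p) (fun p => k p * g p) (fun p => k p * h p).
Proof. by move=> fgh p Op; rewrite fgh// mulrBr. Qed.

Variables (m : material R) (s s' : state R).
Hypotheses (Cu : forall i, class_C 4 Om (disp s i)) (Ct : class_C 3 Om (temp s))
  (Cp : class_C 4 Om (pot s)).
Hypotheses (Cu' : forall i, class_C 4 Om (disp s' i)) (Ct' : class_C 3 Om (temp s'))
  (Cp' : class_C 4 Om (pot s')).
Local Notation sd := (state_sub s s').

Let C1 k (f : W -> R) (C : class_C k.+1 Om f) : class_C 1 Om f := class_C_le (ltn0Sn k) C.

Lemma diff_disp i : is_diff_on (disp sd i) (disp s i) (disp s' i).
Proof. by []. Qed.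
Lemma diff_temp : is_diff_on (temp sd) (temp s) (temp s'). Proof. by []. Qed.
Lemma diff_pot : is_diff_on (pot sd) (pot s) (pot s'). Proof. by []. Qed.

Lemma diff_dxdisp i j : is_diff_on (dx j (disp sd i)) (dx j (disp s i)) (dx j (disp s' i)).
Proof. exact: (is_diff_on_dx j (diff_disp i) (C1 (Cu i)) (C1 (Cu' i))). Qed.

Lemma diff_dxtemp i : is_diff_on (dx i (temp sd)) (dx i (temp s)) (dx i (temp s')).
Proof. exact: (is_diff_on_dx i diff_temp (C1 Ct) (C1 Ct')). Qed.

Lemma diff_dttemp : is_diff_on (dt (temp sd)) (dt (temp s)) (dt (temp s')).
Proof. exact: (is_diff_on_dt diff_temp (C1 Ct) (C1 Ct')). Qed.

Lemma diff_efield i : is_diff_on (efield sd i) (efield s i) (efield s' i).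
Proof. exact: (is_diff_on_opp (is_diff_on_dx i diff_pot (C1 Cp) (C1 Cp'))). Qed.

Lemma diff_slot a : is_diff_on (slot_field m sd a) (slot_field m s a) (slot_field m s' a).
Proof.
case: a => [[[[i j]|[[i j] k]]|[i|[i j]]]|u].
- exact: (is_diff_on_scale _ (is_diff_on_add (diff_dxdisp i j) (diff_dxdisp j i))).
- exact: (is_diff_on_dx j (diff_dxdisp k i) (C1 (class_C_dx i (Cu k))) (C1 (class_C_dx i (Cu' k)))).
- exact: diff_efield.
- exact: (is_diff_on_dx j (diff_efield i) (C1 (class_C_efield oOm Cp i))
    (C1 (class_C_efield oOm Cp' i))).
- exact: (is_diff_on_add diff_temp (is_diff_on_scale _ diff_dttemp)).
Qed.

Lemma diff_conj a : is_diff_on (conj_field m sd a) (conj_field m s a) (conj_field m s' a).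
Proof. exact: (is_diff_on_sum (index_enum slot) (fun b => is_diff_on_scale _ (diff_slot b))). Qed.

Lemma diff_tau i j : is_diff_on (tau m sd i j) (tau m s i j) (tau m s' i j).
Proof. by rewrite !tau_conj; exact: diff_conj. Qed.
Lemma diff_mu i j k : is_diff_on (mu m sd i j k) (mu m s i j k) (mu m s' i j k).
Proof. by rewrite !mu_conj; exact: diff_conj. Qed.
Lemma diff_sigma i : is_diff_on (sigma m sd i) (sigma m s i) (sigma m s' i).
Proof. by rewrite !sigma_conj; apply: is_diff_on_opp; exact: diff_conj. Qed.
Lemma diff_quad i j : is_diff_on (quad m sd i j) (quad m s i j) (quad m s' i j).
Proof. by rewrite !quad_conj; apply: is_diff_on_opp; exact: diff_conj. Qed.

Lemma diff_heat_flux i : is_diff_on (heat_flux m sd i) (heat_flux m s i) (heat_flux m s' i).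
Proof.
apply: is_diff_on_scale; apply: is_diff_on_scale; apply: is_diff_on_add.
  exact: (is_diff_on_scale _ diff_dttemp).
by apply: is_diff_on_sum => j; apply: is_diff_on_scale; exact: diff_dxtemp.
Qed.

Lemma diff_heat_part : is_diff_on (heat_part m sd) (heat_part m s) (heat_part m s').
Proof.
apply: is_diff_on_add; first exact: (is_diff_on_scale _ diff_dttemp).
by apply: is_diff_on_sum => j; apply: is_diff_on_scale; exact: diff_dxtemp.
Qed.

(** The constant term alpha4 of the entropy survives in the difference. *)
Lemma diff_entropy p : Om p ->
  entropy m sd p = entropy m s p - entropy m s' p - (rho m)^-1 * alpha4 m.
Proof.
move=> Op; rewrite !entropyE.
have E1 : conjugate m (strain_slots m sd p) sT =
  conjugate m (strain_slots m s p) sT - conjugate m (strain_slots m s' p) sT := diff_conj sT Op.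
have E2 := diff_heat_part Op; rewrite /heat_part in E2.
by rewrite E1 E2; ring.
Qed.

Lemma class_C_entropy (t : state R) : (forall i, class_C 4 Om (disp t i)) ->
  class_C 3 Om (temp t) -> class_C 4 Om (pot t) -> class_C 2 Om (entropy m t).
Proof.
move=> Du Dt Dp.
rewrite (_ : entropy m t = fun q => - (rho m)^-1 *
    ((conj_field m t sT q + (beta m)^-1 * heat_part m t q) + alpha4 m)); last first.
  by apply/funext => q; rewrite entropyE.
exact: (class_C_scale _ oOm (class_C_add oOm (class_C_add oOm (class_C_conj oOm m Du Dt Dp sT)
  (class_C_scale _ oOm (class_C_heat_part oOm m Dt))) (class_C_cst 2 Om (alpha4 m)))).
Qed.

Lemma diff_dt_entropy : is_diff_on (dt (entropy m sd)) (dt (entropy m s)) (dt (entropy m s')).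
Proof.
move=> p Op.
have Ce := class_C_entropy Cu Ct Cp; have Ce' := class_C_entropy Cu' Ct' Cp'.
have E := dt_near oOm Op diff_entropy.
have C2 := class_C_sub_fun oOm Ce Ce'.
rewrite [LHS]E [LHS](derive_sub _ (C2.1 _ Op) (differentiable_cst ((rho m)^-1 * alpha4 m) p)).
by rewrite derive_cst subr0; exact: (derive_sub _ (Ce.1 _ Op) (Ce'.1 _ Op)).
Qed.

Variable n : 'I_3 -> V -> R.

Lemma diff_surface_moment h h1 h2 : (forall k j, is_diff_on (h k j) (h1 k j) (h2 k j)) ->
  is_diff_on (surface_moment n h) (surface_moment n h1) (surface_moment n h2).
Proof.
move=> dh p Op; rewrite /surface_moment -sumrB; apply: eq_bigr => k _; rewrite -sumrB.
by apply: eq_bigr => j _; rewrite (dh k j p Op) !mulrBl.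
Qed.

(** The normal is differentiable at boundary points only, hence the
hypothesis at the single point p. *)
Lemma diff_surface_force sg h sg1 h1 sg2 h2 p : Om p ->
  (forall i, differentiable (n i) p.1) ->
  (forall j, is_diff_on (sg j) (sg1 j) (sg2 j)) -> (forall k j, is_diff_on (h k j) (h1 k j) (h2 k j)) ->
  (forall k j, class_C 2 Om (h1 k j)) -> (forall k j, class_C 2 Om (h2 k j)) ->
  surface_force n sg h p = surface_force n sg1 h1 p - surface_force n sg2 h2 p.
Proof.
move=> Op dn dsg dh Ch1 Ch2.
have D1 k j : dx k (h k j) p = dx k (h1 k j) p - dx k (h2 k j) p.
  exact: (is_diff_on_dx k (dh k j) (C1 (Ch1 k j)) (C1 (Ch2 k j)) Op).
have dn1 k : differentiable (fun q : W => n k q.1) p.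
  have dfst : differentiable (fst : W -> V) p.
    by apply: linear_differentiable => q; exact: cvg_fst.
  exact: (differentiable_comp dfst (dn k)).
have D2 k j i : dx i (fun q => h k j q * n k q.1) p =
    dx i (fun q => h1 k j q * n k q.1) p - dx i (fun q => h2 k j q * n k q.1) p.
  have d1 : differentiable (fun q => h1 k j q * n k q.1) p.
    exact: (differentiableM ((Ch1 k j).1 _ Op) (dn1 k)).
  have d2 : differentiable (fun q => h2 k j q * n k q.1) p.
    exact: (differentiableM ((Ch2 k j).1 _ Op) (dn1 k)).
  have E := derive_sub (Defs.basis R i, 0) d1 d2; apply: etrans E.
  apply: near_eq_derive; apply: (open_near oOm Op) => q Oq.
  by rewrite (dh k j q Oq) mulrBl.
have E1 : \sum_(j < 3) (sg j p - \sum_(k < 3) dx k (h k j) p) * n j p.1 =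
   \sum_(j < 3) (sg1 j p - \sum_(k < 3) dx k (h1 k j) p) * n j p.1
   - \sum_(j < 3) (sg2 j p - \sum_(k < 3) dx k (h2 k j) p) * n j p.1.
  rewrite -sumrB; apply: eq_bigr => j _; rewrite (dsg j p Op) (eq_bigr _ (fun k _ => D1 k j)).
  by rewrite sumrB; ring.
have E2 : \sum_(j < 3) \sum_(k < 3) surf_grad n j (fun q => h k j q * n k q.1) p =
   \sum_(j < 3) \sum_(k < 3) surf_grad n j (fun q => h1 k j q * n k q.1) p
   - \sum_(j < 3) \sum_(k < 3) surf_grad n j (fun q => h2 k j q * n k q.1) p.
  rewrite -sumrB; apply: eq_bigr => j _; rewrite -sumrB; apply: eq_bigr => k _.
  by rewrite /surf_grad -sumrB; apply: eq_bigr => i _; rewrite D2 mulrBr.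
exact: (surface_rearrange E1 E2 (diff_surface_moment dh Op) _).
Qed.

Lemma diff_normal_deriv f g h : is_diff_on f g h -> class_C 1 Om g -> class_C 1 Om h ->
  is_diff_on (normal_deriv n f) (normal_deriv n g) (normal_deriv n h).
Proof.
move=> fgh Cg Ch; apply: is_diff_on_sum => i; apply: is_diff_on_mull.
exact: is_diff_on_dx.
Qed.

End Difference.

(** * Boundary values, time intervals, connectedness *)

Section Tools.
Context {R : realType}.
Local Notation V := 'rV[R]_3.
Local Notation W := ('rV[R]_3 * R)%type.

Lemma vanish_closure (S : set V) (g : V -> R) x : closure S x ->
  {for x, continuous g} -> (forall y, S y -> g y = 0) -> g x = 0.
Proof.
move=> Sx cg g0; apply/eqP; apply: contrapT => /negP gx.
have N : \forall y \near x, g y != 0.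
  have ogx : nbhs (g x) [set z : R | z != 0] by apply: open_nbhs_nbhs; split=> //; exact: open_neq.
  exact: cg ogx.
by have [y [/= Sy /eqP]] := Sx _ N; apply; exact: g0.
Qed.

Lemma after_in_I (t0 : \bar R) t : interval_I t0 t ->
  \forall h \near 0^'+, interval_I t0 (h + t).
Proof.
move=> [tge0 tlt].
have pos : \forall h \near (0 : R)^'+, 0 < h by exact: nbhs_right_gt.
case: t0 tlt => [r| |//]; last by move=> _; apply: filterS pos => h h0; split; [rewrite addr_ge0// ltW|rewrite ltry].
rewrite lte_fin => tr; have rt : 0 < r - t by rewrite subr_gt0.
near=> h; split; first by rewrite addr_ge0// ltW//; near: h.
by rewrite lte_fin -ltrBrDr; near: h; exact: nbhs_right_lt.
Unshelve. all: by end_near. Qed.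

(** At t = 0 the field is only known to vanish for later times, so that the
derivative is computed from the right. *)
Lemma dt_vanish (t0 : \bar R) (f : W -> R) x t : interval_I t0 t ->
  differentiable f (x, t) -> (forall r, interval_I t0 r -> f (x, r) = 0) -> dt f (x, t) = 0.
Proof.
move=> It df f0; have D := is_derive_time df.
rewrite -[LHS](@derive_val _ _ _ _ _ _ _ D).
have cv : cvg ((fun h => h^-1 *: (((fun r => f (x, r)) \o shift t) (h *: (1 : R)) - f (x, t))) @ 0^').
  by case: D.
rewrite /derive cvg_at_rightE//; apply: cvg_lim => //.
apply: cvg_near_cst; apply: filterS (after_in_I It) => h Ih.
by rewrite /= -[h *: (1 : R)]/(h * 1) mulr1 !f0// subrr scaler0.
Qed.

Lemma segment_in_I (t0 : \bar R) T t : interval_I t0 T -> 0 <= t <= T -> interval_I t0 t.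
Proof.
move=> [T0 TT] /andP[h0 h1]; split=> //; apply: le_lt_trans TT.
by rewrite lee_fin.
Qed.

Lemma common_domain (B : set V) (t0 : \bar R) (s : state R) : regular_state B t0 s ->
  exists Om : set W, [/\ open Om, closure B `*` interval_I t0 `<=` Om,
    forall i, class_C 4 Om (disp s i), class_C 3 Om (temp s) & class_C 4 Om (pot s)].
Proof.
move=> [Hu [Ot [oOt It Ct]] [Op [oOp Ip Cp]]].
have [U UP] := choice Hu.
exists ([set p | forall i, U i p] `&` (Ot `&` Op)); split.
- apply: openI; last exact: openI.
  rewrite openE => p Upi.
  have N : \forall q \near p, forall i, U i q.
    apply: (@filter_forall _ _ U (nbhs p) (nbhs_filter p)) => i; have [oU _ _] := UP i.
    exact: (open_nbhs_nbhs (conj oU (Upi i))).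
  exact: N.
- move=> p Bp; split; last by split; [exact: It|exact: Ip].
  by move=> i; have [_ h _] := UP i; exact: h.
- move=> i; have [_ _ C] := UP i; apply: class_C_sub C => p [h _]; exact: h.
- by apply: class_C_sub Ct => p [_ []].
- by apply: class_C_sub Cp => p [_ []].
Qed.

Lemma derive_grad0 (f : V -> R) x v : differentiable f x ->
  (forall i, 'D_(Defs.basis R i) f x = 0) -> 'D_v f x = 0.
Proof.
move=> df f0; rewrite deriveE// {1}(row_sum_delta v) linear_sum big1// => i _.
by rewrite linearZ/= -deriveE// [X in _ *: X]f0 scaler0.
Qed.

(** The set where f takes the value f x0 and its complement are both open. *)
Lemma connected_cst (B : set V) (f : V -> R) x0 : open B -> connected B -> B x0 ->
  (forall x, B x -> differentiable f x) ->
  (forall x i, B x -> 'D_(Defs.basis R i) f x = 0) -> forall x, B x -> f x = f x0.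
Proof.
move=> oB cB Bx0 df f0.
have lc x : B x -> \forall y \near x, f y = f x.
  move=> Bx; have /nbhs_ballP[r /= r0 rB] := open_nbhs_nbhs (conj oB Bx).
  apply/nbhs_ballP; exists r => //= y xy.
  have inB t : 0 <= t <= 1 -> B (x + t *: (y - x)).
    move=> /andP[t0 t1]; apply: rB; move: xy; rewrite -ball_normE /ball_/= => xy.
    rewrite opprD addrA subrr sub0r normrN normrZ (ger0_norm t0).
    by rewrite (le_lt_trans _ xy)// distrC ler_piMl.
  have [t [t01 E]] := @MVT_line _ _ f x (y - x) 1 ltr01 (fun t ht => df _ (inB t ht)).
  move: E; rewrite scale1r [x + _]addrC subrK mul1r.
  rewrite (derive_grad0 _ (df _ (inB t t01)) (fun i => f0 _ i (inB t t01))).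
  by move/eqP; rewrite subr_eq0 => /eqP.
pose C := [set x | B x /\ f x = f x0]; pose D := [set x | B x /\ f x != f x0].
suff CB : C = B by move=> x; rewrite -{1}CB => -[].
apply: cB; first by exists x0.
- exists C; last by apply/seteqP; split=> x [] // ? [].
  rewrite openE => x [Bx fx].
  by apply: filterS2 (open_nbhs_nbhs (conj oB Bx)) (lc _ Bx) => y By fy; split=> //; rewrite fy.
- exists (~` D); last first.
    apply/seteqP; split=> x; first by move=> [Bx fx]; split=> // -[_]; rewrite fx eqxx.
    by move=> [Bx Dx]; split=> //; apply/eqP; apply: contrapT => /negP h; apply: Dx.
  apply: open_closedC; rewrite openE => x [Bx fx].
  by apply: filterS2 (open_nbhs_nbhs (conj oB Bx)) (lc _ Bx) => y By fy; split=> //; rewrite fy.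
Qed.

(** The alternative at a boundary point, in which the closure of S takes the
points that belong neither to S nor to Sigma; continuity then settles them. *)
Lemma bd_split (B S Sg : set V) x : splits_boundary B S Sg -> bd B x -> closure S x \/ Sg x.
Proof. by move=> [_ _ <- _] [[]|]; [left|right]. Qed.

End Tools.

(** * The data of the difference of two solutions *)

Lemma balance_sub (R : realType) (a a1 a2 c c1 c2 u u1 u2 r f : R) :
  a = a1 - a2 -> c = c1 - c2 -> u = u1 - u2 ->
  a1 - c1 + f = r * u1 -> a2 - c2 + f = r * u2 -> a - c = r * u.
Proof. by move=> -> -> -> e1 e2; rewrite mulrBr -e1 -e2; ring. Qed.

Lemma charge_sub (R : realType) (a a1 a2 c c1 c2 f : R) :
  a = a1 - a2 -> c = c1 - c2 -> a1 - c1 = f -> a2 - c2 = f -> a - c = 0.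
Proof. by move=> -> -> e1 e2; lra. Qed.

Lemma heat_sub (R : realType) (a a1 a2 u u1 u2 r f : R) :
  a = a1 - a2 -> u = u1 - u2 -> r * u1 + a1 - f = 0 -> r * u2 + a2 - f = 0 ->
  r * u + a = 0.
Proof. by move=> -> -> e1 e2; rewrite mulrBr; lra. Qed.

Lemma product_zero (R : realType) (a b c e : R) :
  a = 0 \/ b = 0 -> c = 0 \/ e = 0 -> a * b + c * e = 0.
Proof. by move=> [] -> [] ->; rewrite ?mul0r ?mulr0 addr0. Qed.

Lemma continuous_sumf (R : realType) (V : topologicalType) (I : Type) (r : seq I)
    (f : I -> V -> R) x : (forall i, {for x, continuous (f i)}) ->
  {for x, continuous (fun y => \sum_(i <- r) f i y)}.
Proof.
move=> cf; elim: r => [|i r IH].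
  rewrite (_ : (fun y => _) = fun=> 0); first exact: cst_continuous.
  by apply/funext => y; rewrite big_nil.
rewrite (_ : (fun y => _) = fun y => f i y + \sum_(j <- r) f j y); first exact: continuousD (cf i) IH.
by apply/funext => y; rewrite big_cons.
Qed.

Section Assembly.
Context {R : realType}.
Local Notation V := 'rV[R]_3.
Local Notation W := ('rV[R]_3 * R)%type.
Variables (B : set V) (n : 'I_3 -> V -> R) (t0 : \bar R) (b : boundary_parts R)
  (m : material R) (d : problem_data R) (s s' : state R) (Om : set W).
Hypotheses (oB : open B) (hn : outward_unit_normal B n) (hb : boundary_splitting B b).
Hypotheses (oOm : open Om) (BOm : closure B `*` interval_I t0 `<=` Om)
  (Cu : forall i, class_C 4 Om (disp s i)) (Ct : class_C 3 Om (temp s))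
  (Cp : class_C 4 Om (pot s))
  (Cu' : forall i, class_C 4 Om (disp s' i)) (Ct' : class_C 3 Om (temp s'))
  (Cp' : class_C 4 Om (pot s')).
Hypotheses (hs : balance_equations B t0 m d s) (hs' : balance_equations B t0 m d s')
  (is_ : initial_conditions B m d s) (is' : initial_conditions B m d s')
  (bs : boundary_conditions t0 n b m d s) (bs' : boundary_conditions t0 n b m d s').
Local Notation sd := (state_sub s s').

Let Du i : class_C 4 Om (disp sd i) := class_C_sub_fun oOm (Cu i) (Cu' i).
Let Dt : class_C 3 Om (temp sd) := class_C_sub_fun oOm Ct Ct'.
Let Dp : class_C 4 Om (pot sd) := class_C_sub_fun oOm Cp Cp'.
Let inOm x t : closure B x -> interval_I t0 t -> Om (x, t).
Proof. by move=> cx It; exact: BOm. Qed.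

Lemma diff_balance x t : B x -> interval_I t0 t ->
  [/\ forall i, \sum_(j < 3) dx j (tau m sd j i) (x, t)
        - \sum_(k < 3) \sum_(j < 3) dx j (dx k (mu m sd k j i)) (x, t)
        = rho m * dt (dt (disp sd i)) (x, t),
      \sum_(i < 3) dx i (sigma m sd i) (x, t)
        - \sum_(j < 3) \sum_(i < 3) dx i (dx j (quad m sd j i)) (x, t) = 0
    & rho m * T0 m * dt (entropy m sd) (x, t)
        + \sum_(i < 3) dx i (heat_flux m sd i) (x, t) = 0].
Proof.
move=> Bx It; have Op := inOm (subset_closure Bx) It.
have [e1 e2 e3] := @hs (x, t) (conj Bx It); have [f1 f2 f3] := @hs' (x, t) (conj Bx It).
have D1 f g h j : is_diff_on Om f g h -> class_C 2 Om g -> class_C 2 Om h ->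
    dx j f (x, t) = dx j g (x, t) - dx j h (x, t).
  by move=> fgh Cg Ch; exact: (is_diff_on_dx oOm j fgh (class_C_lt Cg) (class_C_lt Ch) Op).
have D2 f g h j k : is_diff_on Om f g h -> class_C 2 Om g -> class_C 2 Om h ->
    dx j (dx k f) (x, t) = dx j (dx k g) (x, t) - dx j (dx k h) (x, t).
  move=> fgh Cg Ch.
  exact: (is_diff_on_dx oOm j (is_diff_on_dx oOm k fgh (class_C_lt Cg) (class_C_lt Ch))
    (class_C_dx k Cg) (class_C_dx k Ch) Op).
split=> [i||].
- have E1 : \sum_(j < 3) dx j (tau m sd j i) (x, t) =
      \sum_(j < 3) dx j (tau m s j i) (x, t) - \sum_(j < 3) dx j (tau m s' j i) (x, t).
    rewrite -sumrB; apply: eq_bigr => j _.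
    exact: (D1 _ _ _ _ (diff_tau oOm m Cu Ct Cp Cu' Ct' Cp' j i)
      (class_C_tau oOm m Cu Ct Cp j i) (class_C_tau oOm m Cu' Ct' Cp' j i)).
  have E2 : \sum_(k < 3) \sum_(j < 3) dx j (dx k (mu m sd k j i)) (x, t) =
      \sum_(k < 3) \sum_(j < 3) dx j (dx k (mu m s k j i)) (x, t)
      - \sum_(k < 3) \sum_(j < 3) dx j (dx k (mu m s' k j i)) (x, t).
    rewrite -sumrB; apply: eq_bigr => k _; rewrite -sumrB; apply: eq_bigr => j _.
    exact: (D2 _ _ _ _ _ (diff_mu oOm m Cu Ct Cp Cu' Ct' Cp' k j i)
      (class_C_mu oOm m Cu Ct Cp k j i) (class_C_mu oOm m Cu' Ct' Cp' k j i)).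
  have E3 : dt (dt (disp sd i)) (x, t) = dt (dt (disp s i)) (x, t) - dt (dt (disp s' i)) (x, t).
    have D0 := is_diff_on_dt oOm (diff_disp s s' i)
      (class_C_le (isT : (1 <= 4)%N) (Cu i)) (class_C_le (isT : (1 <= 4)%N) (Cu' i)).
    exact: (is_diff_on_dt oOm D0 (class_C_le (isT : (1 <= 3)%N) (class_C_dt (Cu i)))
      (class_C_le (isT : (1 <= 3)%N) (class_C_dt (Cu' i))) Op).
  exact: (balance_sub E1 E2 E3 (e1 i) (f1 i)).
- have E1 : \sum_(i < 3) dx i (sigma m sd i) (x, t) =
      \sum_(i < 3) dx i (sigma m s i) (x, t) - \sum_(i < 3) dx i (sigma m s' i) (x, t).
    rewrite -sumrB; apply: eq_bigr => j _.
    exact: (D1 _ _ _ _ (diff_sigma oOm m Cu Ct Cp Cu' Ct' Cp' j)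
      (class_C_sigma oOm m Cu Ct Cp j) (class_C_sigma oOm m Cu' Ct' Cp' j)).
  have E2 : \sum_(j < 3) \sum_(i < 3) dx i (dx j (quad m sd j i)) (x, t) =
      \sum_(j < 3) \sum_(i < 3) dx i (dx j (quad m s j i)) (x, t)
      - \sum_(j < 3) \sum_(i < 3) dx i (dx j (quad m s' j i)) (x, t).
    rewrite -sumrB; apply: eq_bigr => k _; rewrite -sumrB; apply: eq_bigr => j _.
    exact: (D2 _ _ _ _ _ (diff_quad oOm m Cu Ct Cp Cu' Ct' Cp' k j)
      (class_C_quad oOm m Cu Ct Cp k j) (class_C_quad oOm m Cu' Ct' Cp' k j)).
  exact: (charge_sub E1 E2 e2 f2).
- have E1 : \sum_(i < 3) dx i (heat_flux m sd i) (x, t) =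
      \sum_(i < 3) dx i (heat_flux m s i) (x, t) - \sum_(i < 3) dx i (heat_flux m s' i) (x, t).
    rewrite -sumrB; apply: eq_bigr => j _.
    exact: (D1 _ _ _ _ (diff_heat_flux oOm m Ct Ct' j)
      (class_C_heat_flux oOm m Ct j) (class_C_heat_flux oOm m Ct' j)).
  exact: (heat_sub E1 (diff_dt_entropy oOm m Cu Ct Cp Cu' Ct' Cp' Op) e3 f3).
Qed.

Lemma diff_initial x : closure B x -> interval_I t0 0 ->
  [/\ forall i, disp sd i (x, 0) = 0, forall i, dt (disp sd i) (x, 0) = 0,
      temp sd (x, 0) = 0 & entropy m sd (x, 0) = - (rho m)^-1 * alpha4 m].
Proof.
move=> cx I0; have Op := inOm cx I0.
have [u1 v1 t1 n1] := @is_ _ cx; have [u2 v2 t2 n2] := @is' _ cx.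
split=> [i|i||].
- by rewrite /= u1 u2 subrr.
- have E : dt (disp sd i) (x, 0) = dt (disp s i) (x, 0) - dt (disp s' i) (x, 0).
    exact: (is_diff_on_dt oOm (diff_disp s s' i) (class_C_le (isT : (1 <= 4)%N) (Cu i))
      (class_C_le (isT : (1 <= 4)%N) (Cu' i)) Op).
  by rewrite E v1 v2 subrr.
- by rewrite /= t1 t2 subrr.
- have E := diff_entropy oOm m Cu Ct Cp Cu' Ct' Cp' Op.
  by rewrite E n1 n2 subrr sub0r mulNr.
Qed.

Let contn i x : bd B x -> {for x, continuous (n i)}.
Proof.
move=> bx; have [[A [_ bA Cn]] _] := hn.
exact: (Cn i 0%N x (bA _ bx)).
Qed.

Let diffn i x : bd B x -> differentiable (n i) x.
Proof.
move=> bx; have [[A [_ bA Cn]] _] := hn.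
exact: ((Cn i 1%N).1 x (bA _ bx)).
Qed.

Let cont_slice (f : W -> R) x t : class_C 0 Om f -> Om (x, t) ->
  {for x, continuous (fun y => f (y, t))}.
Proof. by move=> Cf Op; exact: (class_C_slice t Cf). Qed.

(** Data given on S hold on its closure by continuity, and may be
differentiated in time. *)
Lemma dirichlet_zero (S : set V) (f : W -> R) x t : S `<=` bd B -> class_C 2 Om f ->
  (forall y r, S y -> interval_I t0 r -> f (y, r) = 0) ->
  bd B x -> closure S x -> interval_I t0 t ->
  f (x, t) = 0 /\ dt f (x, t) = 0.
Proof.
move=> Sb Cf f0 bx Sx It; have Op := inOm bx.1 It.
split.
  apply: (vanish_closure Sx (cont_slice (class_C_lt (class_C_lt Cf)) Op)).
  by move=> y Sy; exact: f0.
apply: (vanish_closure Sx (cont_slice (class_C_lt (class_C_dt Cf)) Op)) => y Sy.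
apply: (dt_vanish It); last by move=> r; exact: f0.
exact: (Cf.1 _ (inOm (Sb _ Sy).1 It)).
Qed.

(** The same for the normal derivative, which commutes with the derivative in
time because n does not depend on it. *)
Lemma neumann_zero (S : set V) (f : W -> R) x t : S `<=` bd B -> class_C 3 Om f ->
  (forall y r, S y -> interval_I t0 r -> normal_deriv n f (y, r) = 0) ->
  bd B x -> closure S x -> interval_I t0 t ->
  normal_deriv n f (x, t) = 0 /\ normal_deriv n (dt f) (x, t) = 0.
Proof.
move=> Sb Cf f0 bx Sx It; have Op := inOm bx.1 It.
have C1 i := class_C_dx i Cf.
have C2 i := class_C_dx i (class_C_dt Cf).
have cont g : (forall i, class_C 1 Om (dx i g)) ->
    {for x, continuous (fun y => normal_deriv n g (y, t))}.
  move=> Cg; apply: (@continuous_sumf _ _ _ _ (fun i y => n i y * dx i g (y, t))) => i.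
  by apply: continuousM; [exact: contn|exact: (cont_slice (class_C_lt (Cg i)) Op)].
split.
  by apply: (vanish_closure Sx (cont f (fun i => class_C_lt (C1 i)))) => y Sy; exact: f0.
apply: (vanish_closure Sx (cont (dt f) C2)) => y Sy.
have Oy := inOm (Sb _ Sy).1 It.
have Cs := class_C_sum (index_enum 'I_3) (P := xpredT) oOm
  (fun i _ => class_C_scale (n i y) oOm (C1 i)).
have Z : dt (fun q => \sum_i n i y * dx i f q) (y, t) = 0.
  by apply: (dt_vanish It); [exact: (Cs.1 _ Oy)|move=> r; exact: f0].
have [_ D] := derive_sumf (index_enum 'I_3) (F := fun i q => n i y * dx i f q) ((0, 1) : W)
  (fun i => (class_C_scale (n i y) oOm (C1 i)).1 _ Oy).
apply: etrans (etrans _ (esym D)) Z; apply: eq_bigr => i _.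
exact: (etrans (congr1 (fun z => n i y * z) (esym (dt_dx i oOm (class_C_lt Cf) Oy)))
  (esym (derive_scale (n i y) _ ((C1 i).1 _ Oy)))).
Qed.

Let equal_at (S : set V) (f g : W -> R) y r :
  equal_on S t0 f g -> S y -> interval_I t0 r -> f (y, r) = g (y, r).
Proof. by move=> fg Sy Ir; exact: (@fg (y, r) (conj Sy Ir)). Qed.

Let equal_zero (S : set V) (f g h f0 : W -> R) :
  (forall y, S y -> bd B y) -> is_diff_on Om f g h ->
  equal_on S t0 g f0 -> equal_on S t0 h f0 ->
  forall y r, S y -> interval_I t0 r -> f (y, r) = 0.
Proof.
move=> Sb fgh eg eh y r Sy Ir; have Oy := inOm (Sb _ Sy).1 Ir.
by rewrite (fgh _ Oy) (equal_at eg Sy Ir) (equal_at eh Sy Ir) subrr.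
Qed.

Let force_zero x t sg h sg1 h1 sg2 h2 g : bd B x -> interval_I t0 t ->
  (forall j, is_diff_on Om (sg j) (sg1 j) (sg2 j)) ->
  (forall k j, is_diff_on Om (h k j) (h1 k j) (h2 k j)) ->
  (forall k j, class_C 2 Om (h1 k j)) -> (forall k j, class_C 2 Om (h2 k j)) ->
  surface_force n sg1 h1 (x, t) = g -> surface_force n sg2 h2 (x, t) = g ->
  surface_force n sg h (x, t) = 0.
Proof.
move=> bx It ds dh C1 C2 e1 e2.
rewrite (diff_surface_force oOm (inOm bx.1 It) (fun i => diffn i bx) ds dh C1 C2).
by rewrite e1 e2 subrr.
Qed.

Let moment_zero x t h h1 h2 g : bd B x -> interval_I t0 t ->
  (forall k j, is_diff_on Om (h k j) (h1 k j) (h2 k j)) ->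
  surface_moment n h1 (x, t) = g -> surface_moment n h2 (x, t) = g ->
  surface_moment n h (x, t) = 0.
Proof.
move=> bx It dh e1 e2.
by rewrite (diff_surface_moment n dh (inOm bx.1 It)) e1 e2 subrr.
Qed.

(** At each boundary point, in each of the two products, one of the factors is
zero by the boundary conditions. *)
Lemma diff_bc_disp i x t : bd B x -> interval_I t0 t ->
  surf_P m n sd i (x, t) * dt (disp sd i) (x, t)
  + surf_R m n sd i (x, t) * normal_deriv n (dt (disp sd i)) (x, t) = 0.
Proof.
move=> bx It; have [sp1 sp2 _ _ _] := hb.
have dtau j := diff_tau oOm m Cu Ct Cp Cu' Ct' Cp' j i.
have dmu k j := diff_mu oOm m Cu Ct Cp Cu' Ct' Cp' k j i.
have A : surf_P m n sd i (x, t) = 0 \/ dt (disp sd i) (x, t) = 0.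
  have [Sx|Gx] := bd_split sp1 bx; [right|left].
    have [Sb _ _ _] := sp1.
    apply: (dirichlet_zero Sb (class_C_lt (class_C_lt (Du i))) _ bx Sx It).2.
    exact: (equal_zero Sb (diff_disp s s' i) (bc_u bs i) (bc_u bs' i)).
  have e1 : surface_force n (fun j => tau m s j i) (fun k j => mu m s k j i) (x, t)
    = P_hat d i (x, t) := equal_at (bc_P bs i) Gx It.
  have e2 : surface_force n (fun j => tau m s' j i) (fun k j => mu m s' k j i) (x, t)
    = P_hat d i (x, t) := equal_at (bc_P bs' i) Gx It.
  exact: (force_zero bx It dtau dmu (fun k j => class_C_mu oOm m Cu Ct Cp k j i)
    (fun k j => class_C_mu oOm m Cu' Ct' Cp' k j i) e1 e2).
have D : surf_R m n sd i (x, t) = 0 \/ normal_deriv n (dt (disp sd i)) (x, t) = 0.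
  have [Sx|Gx] := bd_split sp2 bx; [right|left].
    have [Sb _ _ _] := sp2.
    apply: (neumann_zero Sb (class_C_lt (Du i)) _ bx Sx It).2.
    have dN := diff_normal_deriv oOm n (diff_disp s s' i)
      (class_C_le (isT : (1 <= 4)%N) (Cu i)) (class_C_le (isT : (1 <= 4)%N) (Cu' i)).
    exact: (equal_zero Sb dN (bc_Du bs i) (bc_Du bs' i)).
  have e1 : surface_moment n (fun k j => mu m s k j i) (x, t) = R_hat d i (x, t) :=
    equal_at (bc_R bs i) Gx It.
  have e2 : surface_moment n (fun k j => mu m s' k j i) (x, t) = R_hat d i (x, t) :=
    equal_at (bc_R bs' i) Gx It.
  exact: (moment_zero bx It dmu e1 e2).
exact: (product_zero A D).
Qed.

Lemma diff_bc_pot x t : bd B x -> interval_I t0 t ->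
  surf_Lambda m n sd (x, t) * pot sd (x, t)
  + surf_H m n sd (x, t) * normal_deriv n (pot sd) (x, t) = 0 /\
  surf_Lambda m n sd (x, t) * dt (pot sd) (x, t)
  + surf_H m n sd (x, t) * normal_deriv n (dt (pot sd)) (x, t) = 0.
Proof.
move=> bx It; have [_ _ _ sp4 sp5] := hb.
have dsig j := diff_sigma oOm m Cu Ct Cp Cu' Ct' Cp' j.
have dq k j := diff_quad oOm m Cu Ct Cp Cu' Ct' Cp' k j.
have A : surf_Lambda m n sd (x, t) = 0 \/ (pot sd (x, t) = 0 /\ dt (pot sd) (x, t) = 0).
  have [Sx|Gx] := bd_split sp4 bx; [right|left].
    have [Sb _ _ _] := sp4.
    apply: (dirichlet_zero Sb (class_C_lt (class_C_lt Dp)) _ bx Sx It).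
    exact: (equal_zero Sb (diff_pot s s') (bc_phi bs) (bc_phi bs')).
  have e1 : surface_force n (sigma m s) (quad m s) (x, t) = Lambda_hat d (x, t) :=
    equal_at (bc_Lambda bs) Gx It.
  have e2 : surface_force n (sigma m s') (quad m s') (x, t) = Lambda_hat d (x, t) :=
    equal_at (bc_Lambda bs') Gx It.
  exact: (force_zero bx It dsig dq (class_C_quad oOm m Cu Ct Cp)
    (class_C_quad oOm m Cu' Ct' Cp') e1 e2).
have D : surf_H m n sd (x, t) = 0 \/ (normal_deriv n (pot sd) (x, t) = 0 /\
    normal_deriv n (dt (pot sd)) (x, t) = 0).
  have [Sx|Gx] := bd_split sp5 bx; [right|left].
    have [Sb _ _ _] := sp5.
    apply: (neumann_zero Sb (class_C_lt Dp) _ bx Sx It).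
    have dN := diff_normal_deriv oOm n (diff_pot s s')
      (class_C_le (isT : (1 <= 4)%N) Cp) (class_C_le (isT : (1 <= 4)%N) Cp').
    exact: (equal_zero Sb dN (bc_Dphi bs) (bc_Dphi bs')).
  have e1 : surface_moment n (quad m s) (x, t) = H_hat d (x, t) := equal_at (bc_H bs) Gx It.
  have e2 : surface_moment n (quad m s') (x, t) = H_hat d (x, t) := equal_at (bc_H bs') Gx It.
  exact: (moment_zero bx It dq e1 e2).
case: A => [A|[A1 A2]]; case: D => [D|[D1 D2]]; split; apply: product_zero; by [left|right].
Qed.

Lemma diff_bc_heat x t : bd B x -> interval_I t0 t ->
  (\sum_(i < 3) heat_flux m sd i (x, t) * n i x) * vartheta m sd (x, t) = 0.
Proof.
move=> bx It; have [_ _ sp3 _ _] := hb.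
have [Sx|Gx] := bd_split sp3 bx.
  have [Sb _ _ _] := sp3.
  have [e1 e2] : temp sd (x, t) = 0 /\ dt (temp sd) (x, t) = 0.
    apply: (dirichlet_zero Sb (class_C_lt Dt) _ bx Sx It).
    exact: (equal_zero Sb (diff_temp s s') (bc_theta bs) (bc_theta bs')).
  by rewrite /vartheta e1 e2 mulr0 addr0 mulr0.
have E : \sum_(i < 3) heat_flux m sd i (x, t) * n i x =
    \sum_(i < 3) heat_flux m s i (x, t) * n i x - \sum_(i < 3) heat_flux m s' i (x, t) * n i x.
  rewrite -sumrB; apply: eq_bigr => i _.
  by rewrite (diff_heat_flux oOm m Ct Ct' i (inOm bx.1 It)) mulrBl.
have e1 := equal_at (bc_q bs) Gx It : \sum_(i < 3) heat_flux m s i (x, t) * n i x = q_hat d (x, t).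
have e2 := equal_at (bc_q bs') Gx It : \sum_(i < 3) heat_flux m s' i (x, t) * n i x = q_hat d (x, t).
by rewrite E e1 e2 subrr mul0r.
Qed.

End Assembly.

(** * Uniqueness *)

(** The square of f does not increase. *)
Lemma decay_zero (R : realType) (f : 'rV[R]_3 * R -> R) x (T : R) : 0 <= T ->
  (forall t, 0 <= t <= T -> differentiable f (x, t)) ->
  (forall t, 0 <= t <= T -> f (x, t) * dt f (x, t) <= 0) ->
  f (x, 0) = 0 -> f (x, T) = 0.
Proof.
move=> T0 df le0 f0.
have D t : 0 <= t <= T -> is_derive t 1 (fun r => f (x, r) * f (x, r))
    (f (x, t) *: dt f (x, t) + f (x, t) *: dt f (x, t)).
  by move=> tT; have Dt := is_derive_time (df _ tT); exact: (is_deriveM Dt Dt).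
have [||c] := @MVT_segment R (fun r => f (x, r) * f (x, r))
  (fun t => f (x, t) *: dt f (x, t) + f (x, t) *: dt f (x, t)) 0 T T0.
- by move=> t; rewrite in_itv/= => /andP[t0 tT]; apply: D; rewrite !ltW.
- apply: derivable_within_continuous => t; rewrite in_itv/= => tT.
  by have [] := D t tT.
rewrite in_itv/= => cT; rewrite f0 mulr0 !subr0 => E.
apply/eqP; rewrite -sqrf_eq0 eq_le sqr_ge0 andbT expr2 E.
by rewrite mulr_le0_ge0// -[leRHS]addr0; apply: lerD; exact: le0.
Qed.

Lemma relaxation_sign (R : realType) (b y z : R) : 0 < b -> y + b * z = 0 -> y * z <= 0.
Proof.
move=> b0 E; have -> : y = - (b * z) by lra.
by rewrite mulNr -mulrA oppr_le0 mulr_ge0 ?(ltW b0)// -expr2 sqr_ge0.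
Qed.

Lemma bounded_region (R : realType) (B : set 'rV[R]_3) : bounded_set B ->
  (exists M : R, 0 < M /\ forall x, B x -> `|x| < M) /\ compact (closure B).
Proof.
move=> [M0 [_ bB]]; pose M := Num.max M0 0 + 1.
have M0M : M0 < M by rewrite (@le_lt_trans _ _ (Num.max M0 0)) ?ltrDl// le_max lexx.
have Mpos : 0 < M by rewrite (@le_lt_trans _ _ (Num.max M0 0)) ?ltrDl// le_max lexx orbT.
have BM x : B x -> `|x| <= M by exact: bB.
split; first by exists (M + 1); split=> [|x /BM]; [rewrite addr_gt0|move/le_lt_trans; apply; rewrite ltrDl].
apply: bounded_closed_compact; last exact: closed_closure.
exists M; split; first by rewrite num_real.
move=> r Mr x cx; apply: ltW; apply: le_lt_trans Mr.
have cl : closed [set y : 'rV[R]_3 | `|y| <= M].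
  exact: (closed_comp (fun y _ => @norm_continuous _ _ y) (@closed_le R M)).
by apply: cl; apply: closure_subset cx => y; exact: BM.
Qed.

Theorem theorem1 (R : realType) (B : set 'rV[R]_3) (n : 'I_3 -> 'rV[R]_3 -> R)
    (t0 : \bar R) (b : boundary_parts R) (m : material R) (d : problem_data R)
    (hB : smooth_region B) (hn : outward_unit_normal B n)
    (ht0 : (0%:E < t0)%E) (hb : boundary_splitting B b)
    (hP : P_nonnegative m)
    (hrho : 0 < rho m) (hbeta : 0 < beta m) (hT0 : 0 < T0 m)
    (hsym : symmetry_relations m)
    (hW : W_positive_semidefinite m)
    (hG : G_positive_definite m)
    (hS4 : S4 b !=set0) (s s' : state R) :
  solution_of_Pi B n t0 b m d s ->
  solution_of_Pi B n t0 b m d s' ->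
  same_state B t0 s s'.
Proof.
move=> [rs bals inis bcs] [rs' bals' inis' bcs'].
have [oB cB bB sB] := hB.
have [[M [M0 BM]] clB] := bounded_region bB.
have [Om1 [oOm1 BOm1 Cu1 Ct1 Cp1]] := common_domain rs.
have [Om2 [oOm2 BOm2 Cu2 Ct2 Cp2]] := common_domain rs'.
pose Om := Om1 `&` Om2.
have oOm : open Om := openI oOm1 oOm2.
have BOm : closure B `*` interval_I t0 `<=` Om by move=> p Bp; split; [exact: BOm1|exact: BOm2].
have Cu i : class_C 4 Om (disp s i) := class_C_sub (@subIsetl _ Om1 Om2) (Cu1 i).
have Ct : class_C 3 Om (temp s) := class_C_sub (@subIsetl _ Om1 Om2) Ct1.
have Cp : class_C 4 Om (pot s) := class_C_sub (@subIsetl _ Om1 Om2) Cp1.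
have Cu' i : class_C 4 Om (disp s' i) := class_C_sub (@subIsetr _ Om1 Om2) (Cu2 i).
have Ct' : class_C 3 Om (temp s') := class_C_sub (@subIsetr _ Om1 Om2) Ct2.
have Cp' : class_C 4 Om (pot s') := class_C_sub (@subIsetr _ Om1 Om2) Cp2.
pose sd := state_sub s s'.
have Du i : class_C 4 Om (disp sd i) := class_C_sub_fun oOm (Cu i) (Cu' i).
have Dt : class_C 3 Om (temp sd) := class_C_sub_fun oOm Ct Ct'.
have Dp : class_C 4 Om (pot sd) := class_C_sub_fun oOm Cp Cp'.
have I0 : interval_I t0 0 by split.
have inOm x t : closure B x -> interval_I t0 t -> Om (x, t) by move=> cx It; exact: BOm.
have init x (cx : closure B x) := diff_initial oOm BOm Cu Ct Cp Cu' Ct' Cp' inis inis' cx I0.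
have key x T : B x -> interval_I t0 T -> [/\ forall i, dt (disp sd i) (x, T) = 0,
    vartheta m sd (x, T) = 0 & forall i, dx i (pot sd) (x, T) = 0].
  move=> Bx IT.
  have seg t := segment_in_I (t := t) IT.
  apply: (energy_vanishes M0 oB BM clB sB hn oOm Du Dt Dp hP hrho hbeta hT0 hsym hW hG IT.1 _ _ _ _ _ _ _ Bx).
  - by move=> y t cy /seg; exact: inOm.
  - move=> y t By /seg It.
    exact: (diff_balance oOm BOm Cu Ct Cp Cu' Ct' Cp' bals bals' By It).
  - by move=> y By; exact: (init y (subset_closure By)).
  - move=> i y t by_ /seg It.
    exact: (diff_bc_disp hn hb oOm BOm Cu Ct Cp Cu' Ct' Cp' bcs bcs' i by_ It).
  - move=> y t by_ /seg It.
    exact: (diff_bc_pot hn hb oOm BOm Cu Ct Cp Cu' Ct' Cp' bcs bcs' by_ It).1.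
  - move=> y t by_ /seg It.
    exact: (diff_bc_pot hn hb oOm BOm Cu Ct Cp Cu' Ct' Cp' bcs bcs' by_ It).2.
  - move=> y t by_ /seg It.
    exact: (diff_bc_heat hb oOm BOm Ct Ct' bcs bcs' by_ It).
(* the fields are continuous up to the boundary, so that it suffices to know
that they agree inside *)
have toclosure (f g : 'rV[R]_3 * R -> R) : class_C 0 Om (fun p => f p - g p) ->
    (forall x t, B x -> interval_I t0 t -> f (x, t) - g (x, t) = 0) ->
    equal_on (closure B) t0 f g.
  move=> Cfg fg [x t] [cx It]; apply/eqP; rewrite -subr_eq0; apply/eqP.
  have c : {for x, continuous (fun y => f (y, t) - g (y, t))}.
    by apply: (class_C_slice t Cfg); exact: (inOm _ _ cx It).
  by apply: (vanish_closure cx c) => y By; exact: fg.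
split=> [i||].
- apply: toclosure => [|x T Bx IT]; first exact: (class_C_le (isT : (0 <= 4)%N) (Du i)).
  apply: (@decay_zero R (disp sd i) x T IT.1).
  + by move=> t /(segment_in_I IT) It; exact: ((Du i).1 _ (inOm _ _ (subset_closure Bx) It)).
  + move=> t /(segment_in_I IT) It; have [E _ _] := key x t Bx It.
    by rewrite (E i) mulr0.
  + by have [E _ _ _] := init x (subset_closure Bx); exact: E.
- apply: toclosure => [|x T Bx IT]; first exact: (class_C_le (isT : (0 <= 3)%N) Dt).
  apply: (@decay_zero R (temp sd) x T IT.1).
  + by move=> t /(segment_in_I IT) It; exact: (Dt.1 _ (inOm _ _ (subset_closure Bx) It)).
  + move=> t /(segment_in_I IT) It; have [_ E _] := key x t Bx It.
    exact: (relaxation_sign hbeta E).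
  + by have [_ _ E _] := init x (subset_closure Bx); exact: E.
have [z Sz] := hS4.
have [_ _ _ [S4b _ _ _] _] := hb.
have [cz _] := S4b z Sz.
apply: toclosure => [|x T Bx IT]; first exact: (class_C_le (isT : (0 <= 4)%N) Dp).
have C1 := class_C_slice T (class_C_le (isT : (1 <= 4)%N) Dp).
have cst y : B y -> pot sd (y, T) = pot sd (x, T).
  move=> By; apply: (connected_cst (f := fun y => pot sd (y, T)) oB cB Bx) By => [w Bw|w i Bw].
    exact: (C1.1 _ (inOm _ _ (subset_closure Bw) IT)).
  rewrite derive_slice; have [_ _ E] := key w T Bw IT; exact: E.
have Cc := class_C_sub_fun oOm (class_C_le (isT : (0 <= 4)%N) Dp)
  (class_C_cst 0 Om (pot sd (x, T))).
have c : {for z, continuous (fun y => pot sd (y, T) - pot sd (x, T))}.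
  by apply: (class_C_slice T Cc); exact: (inOm _ _ cz IT).
have Z0 : pot sd (z, T) - pot sd (x, T) = 0.
  by apply: (vanish_closure cz c) => y By; rewrite cst// subrr.
(* the value prescribed on S4 fixes the constant *)
have ez : pot sd (z, T) = 0.
  have e1 := bc_phi bcs; have e2 := bc_phi bcs'.
  by rewrite /sd/= (e1 (z, T) (conj Sz IT)) (e2 (z, T) (conj Sz IT)) subrr.
by move: Z0; rewrite ez sub0r => /eqP; rewrite oppr_eq0 => /eqP.
Qed.
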